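(* Let $p\in(1,\infty)$. For every separable $C^{*}$-algebra $\mathcal{A}$, there is an isomorphic homomorphism $\phi:\mathcal{A}\to B(\ell^{p})/K(\ell^{p})$; that is, there are a bounded linear multiplicative map $\phi:\mathcal{A}\to B(\ell^{p})/K(\ell^{p})$ and a constant $C\geq 1$ such that $\frac{1}{C}\|a\|\leq\|\phi(a)\|\leq C\|a\|$ for all $a\in\mathcal{A}$.
   Context: All spaces are over $\mathbb{C}$, and $\ell^{p}=\ell^{p}(\mathbb{N})$. $B(\ell^{p})$ is the algebra of bounded linear operators on $\ell^{p}$, $K(\ell^{p})$ is the ideal of compact operators, and $B(\ell^{p})/K(\ell^{p})$ carries the quotient norm. A homomorphism between Banach algebras is a bounded linear map $\phi$ with $\phi(ab)=\phi(a)\phi(b)$ for all $a,b$; it is isomorphic if there exists $C\geq1$ with $\frac1C\|a\|\le\|\phi(a)\|\le C\|a\|$ for all $a$. The $C^*$-algebra is not assumed to be unital. *)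

(* Defs.v *)
From HB Require Import structures.
From mathcomp Require Import all_boot all_order all_algebra.
From mathcomp Require Import generic_quotient ring_quotient.
From mathcomp Require Import all_classical all_reals all_analysis.
From mathcomp Require Import complex.

Set Implicit Arguments.
Unset Strict Implicit.
Unset Printing Implicit Defensive.

Import Order.TTheory GRing.Theory Num.Theory.
Import numFieldNormedType.Exports.

Local Open Scope classical_set_scope.
Local Open Scope ring_scope.
Local Open Scope complex_scope.

(* The norm of a normed space over [R[i]] takes its values in [R[i]]; this is
   the same norm read in [R]. *)
Definition rnorm (R : realType) (V : normedZmodType R[i]) (x : V) : R :=
  complex.Re `|x|.

Section rnorm_theory.
Context {R : realType}.

Lemma rnormE (V : normedZmodType R[i]) (x : V) : `|x| = (rnorm x)%:C.
Proof.
rewrite /rnorm; case: `|x| (normr_ge0 x) => a b; rewrite lecE /= => /andP[].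
by move=> /eqP -> _.
Qed.

Let rcD (a b : R) : (a + b)%:C = a%:C + b%:C.
Proof. exact: rmorphD. Qed.

Let rcM (a b : R) : (a * b)%:C = a%:C * b%:C.
Proof. exact: rmorphM. Qed.

Lemma rnorm_ge0 (V : normedZmodType R[i]) (x : V) : 0 <= rnorm x.
Proof. by rewrite -lecR -rnormE; exact: normr_ge0. Qed.

Lemma rnorm0 (V : normedZmodType R[i]) : rnorm (0 : V) = 0.
Proof. by rewrite /rnorm normr0. Qed.

Lemma rnorm0_eq0 (V : normedZmodType R[i]) (x : V) : rnorm x = 0 -> x = 0.
Proof. by move=> x0; apply/normr0_eq0; rewrite rnormE x0. Qed.

Lemma ler_rnormD (V : normedZmodType R[i]) (x y : V) :
  rnorm (x + y) <= rnorm x + rnorm y.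
Proof. by rewrite -lecR rcD -!rnormE; exact: ler_normD. Qed.

Lemma rnormM (x y : R[i]) : rnorm (x * y) = rnorm x * rnorm y.
Proof. by apply: (@complexI R); rewrite rcM -!rnormE normrM. Qed.

Lemma rnormZ (V : normedModType R[i]) (a : R[i]) (x : V) :
  rnorm (a *: x) = rnorm a * rnorm x.
Proof. by apply: (@complexI R); rewrite rcM -!rnormE normrZ. Qed.

Lemma rnormC (a : R) : 0 <= a -> rnorm a%:C = a.
Proof.
by move=> a0; apply: (@complexI R); rewrite -rnormE ger0_norm// lecR.
Qed.

End rnorm_theory.

Section lp_space.
Context {R : realType}.
Implicit Types (p : R) (x y : nat -> R[i]).

Definition lp_mem p : pred (nat -> R[i]) :=
  fun x => `[< (\sum_(n <oo) (rnorm (x n) `^ p)%:E < +oo)%E >].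

Definition lp_norm p x : R :=
  fine (\sum_(n <oo) (rnorm (x n) `^ p)%:E)%E `^ p^-1.

Local Notation N p x :=
  ('N[@counting nat R]_p%:E [EFin \o (fun n => rnorm (x n))])%E.

Let sum_ge0 p x : (0 <= \sum_(n <oo) (rnorm (x n) `^ p)%:E)%E.
Proof. by apply: nneseries_ge0 => n _ _; rewrite lee_fin powR_ge0. Qed.

Let NE p x : 0 < p ->
  N p x = ((\sum_(n <oo) (rnorm (x n) `^ p)%:E) `^ p^-1)%E.
Proof.
move=> p0; rewrite (Lnorm_counting _ p0); congr (_ `^ _)%E.
by apply: eq_eseriesr => n _; rewrite /= ger0_norm ?rnorm_ge0.
Qed.

Let N_lty p x : 0 < p -> lp_mem p x = (N p x < +oo)%E.
Proof.
move=> p0; rewrite NE//; apply/asboolP/idP => [xp|].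
  by rewrite poweR_lty.
by apply: lty_poweRy; rewrite invr_eq0 gt_eqF.
Qed.

Lemma lp_normE p x : 0 < p -> lp_mem p x -> (lp_norm p x)%:E = N p x.
Proof.
move=> p0 /asboolP xp; rewrite NE// /lp_norm -poweR_EFin fineK//.
by rewrite ge0_fin_numE.
Qed.

Let N_le_D p x y : 1 <= p -> (N p (x + y) <= N p x + N p y)%E.
Proof.
move=> p1; have p0 : 0 < p by exact: lt_le_trans p1.
apply: le_trans (minkowski_EFin _ _ _ p1) => //.
rewrite !Lnorm_counting//; apply: gt0_ler_poweR.
- by rewrite invr_ge0 ltW.
- by rewrite in_itv /= leey andbT; apply: nneseries_ge0 => n _ _; rewrite lee_fin powR_ge0.
- by rewrite in_itv /= leey andbT; apply: nneseries_ge0 => n _ _; rewrite lee_fin powR_ge0.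
apply: lee_nneseries => [n _ _|n _]; first by rewrite lee_fin powR_ge0.
rewrite /= lee_fin ge0_ler_powR ?nnegrE ?(ltW p0)//.
by rewrite !ger0_norm ?addr_ge0 ?rnorm_ge0//; exact: ler_rnormD.
Qed.

Let sumZ p (a : R[i]) x : 0 < p ->
  (\sum_(n <oo) (rnorm (a * x n) `^ p)%:E =
   (rnorm a `^ p)%:E * \sum_(n <oo) (rnorm (x n) `^ p)%:E)%E.
Proof.
move=> p0; rewrite -nneseriesZl; last first.
  by move=> n _; rewrite lee_fin powR_ge0.
by apply: eq_eseriesr => n _; rewrite rnormM powRM ?rnorm_ge0// EFinM.
Qed.

Variables (p : R) (p_ge1 : 1 <= p).

Let p_gt0 : 0 < p. Proof. exact: lt_le_trans p_ge1. Qed.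

Lemma lp_submod_closed : submod_closed (lp_mem p).
Proof.
split=> [|a x y].
  apply/asboolP; rewrite eseries0// => n _ _.
  by rewrite rnorm0 powR0 ?gt_eqF.
rewrite -!topredE /= => xp yp; rewrite (N_lty (a *: x + y) p_gt0).
apply: le_lt_trans (N_le_D _ _ p_ge1) _; apply: lte_add_pinfty.
  rewrite -(N_lty (a *: x) p_gt0); apply/asboolP; rewrite (sumZ a x p_gt0).
  apply: lte_mul_pinfty => //; first by rewrite lee_fin powR_ge0.
  by move/asboolP: xp.
by rewrite -(N_lty y p_gt0).
Qed.

HB.instance Definition _ :=
  GRing.isSubmodClosed.Build _ _ (lp_mem p) lp_submod_closed.

(* The proof of [1 <= p] is not used in the carrier; it is a parameter of the
   type because the norm instance below needs it. *)
Definition lp of 1 <= p := {x : nat -> R[i] | lp_mem p x}.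

HB.instance Definition _ := [isSub of lp p_ge1 for @sval _ _].
HB.instance Definition _ := gen_eqMixin (lp p_ge1).
HB.instance Definition _ := gen_choiceMixin (lp p_ge1).
HB.instance Definition _ := [SubChoice_isSubLmodule of lp p_ge1 by <:].

Lemma lpP (x : lp p_ge1) : lp_mem p (val x).
Proof. exact: (valP x). Qed.

Let lp_normD x y : lp_mem p x -> lp_mem p y -> lp_mem p (x + y) ->
  lp_norm p (x + y) <= lp_norm p x + lp_norm p y.
Proof.
have H (a b c : R) (A B C : \bar R) : a%:E = A -> b%:E = B -> c%:E = C ->
    (A <= B + C)%E -> a <= b + c.
  by move=> <- <- <-; rewrite -EFinD lee_fin.
move=> xp yp xyp.
exact: (H _ _ _ _ _ _ (lp_normE p_gt0 xyp) (lp_normE p_gt0 xp)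
                       (lp_normE p_gt0 yp) (N_le_D x y p_ge1)).
Qed.

Let lp_normZ a x : lp_mem p x -> lp_norm p (a *: x) = rnorm a * lp_norm p x.
Proof.
move=> /asboolP xp; rewrite /lp_norm (sumZ a x p_gt0) fineM//; last first.
  by rewrite ge0_fin_numE.
rewrite /= powRM ?powR_ge0 ?fine_ge0// -powRrM divff ?gt_eqF//.
by rewrite powRr1// rnorm_ge0.
Qed.

Let lp_norm0_eq0 x : lp_mem p x -> lp_norm p x = 0 -> x = 0.
Proof.
move=> /asboolP xp /powR_eq0_eq0 x0; apply/funext => n.
have {}x0 : (\sum_(k <oo) (rnorm (x k) `^ p)%:E = 0)%E.
  by rewrite -[LHS]fineK ?x0// ge0_fin_numE.
apply/rnorm0_eq0/(@powR_eq0_eq0 _ _ p)/EFin_inj/le_anti/andP.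
split; last by rewrite lee_fin powR_ge0.
rewrite -[leRHS]x0.
apply: le_trans (nneseries_lim_ge n.+1 _); last first.
  by move=> k _ _; rewrite lee_fin powR_ge0.
rewrite big_nat_recr//= leeDr// sume_ge0// => k _.
by rewrite lee_fin powR_ge0.
Qed.

Let norm (x : lp p_ge1) : R[i] := (lp_norm p (val x))%:C.

Let ler_normD (x y : lp p_ge1) : norm (x + y) <= norm x + norm y.
Proof.
rewrite /norm -(rmorphD (real_complex R)) lecR.
exact: (lp_normD (lpP x) (lpP y) (lpP (x + y))).
Qed.

Let normZ (a : R[i]) (x : lp p_ge1) : norm (a *: x) = `|a| * norm x.
Proof.
rewrite /norm rnormE -(rmorphM (real_complex R)); congr (_%:C).
exact: (lp_normZ a (lpP x)).
Qed.

Let norm0_eq0 (x : lp p_ge1) : norm x = 0 -> x = 0.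
Proof.
by move=> /(@complexI R) x0; apply: val_inj; exact: (lp_norm0_eq0 (lpP x) x0).
Qed.

HB.instance Definition _ :=
  @Lmodule_isNormed.Build R[i] (lp p_ge1) norm ler_normD normZ norm0_eq0.

Lemma rnorm_lpE (x : lp p_ge1) : rnorm x = lp_norm p (val x).
Proof. by []. Qed.

End lp_space.

Section bounded_operators.
Context {R : realType} (X : normedModType R[i]).

Definition bop_mem : pred (X -> X) := fun f =>
  `[< linear f /\ exists M : R, forall x, rnorm (f x) <= M * rnorm x >].

Lemma bop_submod_closed : submod_closed bop_mem.
Proof.
split=> [|a f g].
  apply/asboolP; split=> [a x y|]; first by rewrite /= scaler0 addr0.
  by exists 0 => x; rewrite rnorm0 mul0r.
rewrite -!topredE /= => /asboolP[lf [M fM]] /asboolP[lg [N gN]].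
apply/asboolP; split=> [b x y|].
  rewrite -[LHS]/(a *: f (b *: x + y) + g (b *: x + y)) lf lg.
  by rewrite -[RHS]/(b *: (a *: f x + g x) + (a *: f y + g y)) !scalerDr
             !scalerA (mulrC b) addrACA.
exists (rnorm a * M + N) => x; rewrite (le_trans (ler_rnormD _ _))//.
by rewrite mulrDl lerD// rnormZ -mulrA ler_wpM2l// rnorm_ge0.
Qed.

HB.instance Definition _ :=
  GRing.isSubmodClosed.Build _ _ bop_mem bop_submod_closed.

Definition bop := {f : X -> X | bop_mem f}.

HB.instance Definition _ := [isSub of bop for @sval _ _].
HB.instance Definition _ := gen_eqMixin bop.
HB.instance Definition _ := gen_choiceMixin bop.
HB.instance Definition _ := [SubChoice_isSubLmodule of bop by <:].

Definition bop_fun (T : bop) : X -> X := val T.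
Coercion bop_fun : bop >-> Funclass.

Lemma bopP (T : bop) :
  linear T /\ exists M : R, forall x, rnorm (T x) <= M * rnorm x.
Proof. exact/asboolP/(valP T). Qed.

HB.instance Definition _ (T : bop) :=
  GRing.isLinear.Build R[i] X X *:%R T (bopP T).1.

Lemma bop_ext (S T : bop) : S =1 T -> S = T.
Proof. by move=> ST; apply/val_inj/funext. Qed.

Lemma id_bop_mem : bop_mem id.
Proof. by apply/asboolP; split=> //; exists 1 => x; rewrite mul1r. Qed.

Lemma comp_bop_mem (S T : bop) : bop_mem (S \o T).
Proof.
apply/asboolP; split=> [a x y|]; first by rewrite /= !linearP.
have [_ [M SM]] := bopP S; have [_ [N TN]] := bopP T.
exists (`|M| * N) => x; rewrite (le_trans (SM _))// -mulrA.
rewrite (@le_trans _ _ (`|M| * rnorm (T x)))//.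
  by rewrite ler_wpM2r ?rnorm_ge0// ler_norm.
by rewrite ler_wpM2l.
Qed.

Let one : bop := exist bop_mem _ id_bop_mem.
Let mul (S T : bop) : bop := exist bop_mem _ (comp_bop_mem S T).

Let mulA : associative mul.
Proof. by move=> S T U; exact: bop_ext. Qed.
Let mul1 : left_id one mul.
Proof. by move=> T; exact: bop_ext. Qed.
Let mul_1 : right_id one mul.
Proof. by move=> T; exact: bop_ext. Qed.
Let mulDl : left_distributive mul +%R.
Proof. by move=> S T U; exact: bop_ext. Qed.
Let mulDr : right_distributive mul +%R.
Proof.
by move=> S T U; apply: bop_ext => x; rewrite [LHS](linearD S).
Qed.

HB.instance Definition _ :=
  GRing.Zmodule_isPzRing.Build bop mulA mul1 mul_1 mulDl mulDr.

Lemma bop_mulE (S T : bop) (x : X) : (S * T : bop) x = S (T x).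
Proof. by []. Qed.

Lemma bop_addE (S T : bop) (x : X) : (S + T : bop) x = S x + T x.
Proof. by []. Qed.

Lemma bop_scaleE (a : R[i]) (T : bop) (x : X) : (a *: T : bop) x = a *: T x.
Proof. by []. Qed.

Lemma bop_scalerAl (a : R[i]) (S T : bop) : a *: (S * T : bop) = (a *: S : bop) * T.
Proof. exact: bop_ext. Qed.

Lemma bop_scalerAr (a : R[i]) (S T : bop) : a *: (S * T : bop) = S * (a *: T : bop).
Proof. by apply: bop_ext => x; rewrite [RHS](linearZ_LR S). Qed.

Definition opnorm (T : bop) : R :=
  sup [set rnorm (T x) | x in [set x : X | rnorm x <= 1]].

Let opnorm_has_sup (T : bop) :
  has_sup [set rnorm (T x) | x in [set x : X | rnorm x <= 1]].
Proof.
split; first by exists (rnorm (T 0)), 0 => //=; rewrite rnorm0.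
have [_ [M TM]] := bopP T; exists `|M| => _ [x /= x1 <-].
rewrite (le_trans (TM x))// (@le_trans _ _ (`|M| * rnorm x))//.
  by rewrite ler_wpM2r ?rnorm_ge0// ler_norm.
by rewrite ler_piMr.
Qed.

Lemma opnorm_le (T : bop) (x : X) : rnorm (T x) <= opnorm T * rnorm x.
Proof.
have [x0|x0] := eqVneq (rnorm x) 0.
  by rewrite (rnorm0_eq0 x0) linear0 rnorm0 mulr0.
have {}x0 : 0 < rnorm x by rewrite lt_def x0 rnorm_ge0.
have rinv : rnorm (rnorm x)^-1%:C = (rnorm x)^-1.
  by rewrite rnormC// invr_ge0 ltW.
rewrite -ler_pdivrMr// mulrC -rinv -rnormZ -linearZ_LR.
apply: sup_upper_bound => //.
by eexists; last reflexivity; rewrite /= rnormZ rinv mulVf// gt_eqF.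
Qed.

Lemma opnorm_ge0 (T : bop) : 0 <= opnorm T.
Proof.
apply: le_trans (rnorm_ge0 (T 0)) _; apply: sup_upper_bound => //.
by exists 0 => //=; rewrite rnorm0.
Qed.

Lemma opnorm_lub (T : bop) (M : R) : 0 <= M ->
  (forall x, rnorm (T x) <= M * rnorm x) -> opnorm T <= M.
Proof.
move=> M0 TM; apply: ge_sup; first by have [] := opnorm_has_sup T.
by move=> _ [x /= x1 <-]; rewrite (le_trans (TM x))// ler_piMr.
Qed.

Let norm (T : bop) : R[i] := (opnorm T)%:C.

Let ler_normD (S T : bop) : norm (S + T) <= norm S + norm T.
Proof.
rewrite /norm -(rmorphD (real_complex R)) lecR; apply: opnorm_lub => [|x].
  by rewrite addr_ge0 ?opnorm_ge0.
by rewrite bop_addE (le_trans (ler_rnormD _ _))// mulrDl lerD// opnorm_le.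
Qed.

Let opnormZ_le (a : R[i]) (T : bop) : opnorm (a *: T) <= rnorm a * opnorm T.
Proof.
apply: opnorm_lub => [|x]; first by rewrite mulr_ge0 ?rnorm_ge0 ?opnorm_ge0.
by rewrite bop_scaleE rnormZ -mulrA ler_wpM2l ?rnorm_ge0// opnorm_le.
Qed.

Let normZ (a : R[i]) (T : bop) : norm (a *: T) = `|a| * norm T.
Proof.
rewrite /norm rnormE -(rmorphM (real_complex R)); congr (_%:C); apply/le_anti.
rewrite opnormZ_le /=; have [->|a0] := eqVneq a 0.
  by rewrite rnorm0 mul0r opnorm_ge0.
have ra0 : 0 < rnorm a.
  by rewrite lt_def rnorm_ge0 andbT; apply: contra_neq a0 => /rnorm0_eq0.
rewrite mulrC -ler_pdivlMr// mulrC.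
rewrite (le_trans _ (le_trans (opnormZ_le a^-1 (a *: T)) _))//.
  by rewrite scalerA mulVf// scale1r.
have e : rnorm a * rnorm a^-1 = 1 by rewrite -rnormM divff// /rnorm normr1.
by rewrite ler_wpM2r ?opnorm_ge0// -[leRHS]mulr1 -e mulKf ?gt_eqF.
Qed.

Let norm0_eq0 (T : bop) : norm T = 0 -> T = 0.
Proof.
move=> /(@complexI R) T0; apply: bop_ext => x; apply/rnorm0_eq0/le_anti.
by rewrite rnorm_ge0 andbT (le_trans (opnorm_le _ _))// T0 mul0r.
Qed.

HB.instance Definition _ :=
  @Lmodule_isNormed.Build R[i] bop norm ler_normD normZ norm0_eq0.

Lemma rnorm_bopE (T : bop) : rnorm T = opnorm T.
Proof. by []. Qed.

End bounded_operators.

Section calkin_algebra.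
Context {R : realType} (X : normedModType R[i]).

Definition compact_op : pred (bop X) := fun T =>
  `[< precompact (T @` [set x : X | rnorm x <= 1]) >].

Let precompact_image (Y Z : normedModType R[i]) (f : Y -> Z) (A : set Y) :
  continuous f -> precompact A -> precompact (f @` A).
Proof.
move=> cf [K AK [cK _]]; apply: (@precompact_subset _ _ (f @` K)).
  exact: image_subset.
apply: compact_precompact; first exact: norm_hausdorff.
by apply: continuous_compact => //; exact: continuous_subspaceT.
Qed.

Lemma bop_continuous (T : bop X) : continuous T.
Proof.
pose f : {linear X -> X} := T.
suff : continuous f by [].
apply: bounded_linear_continuous; apply/linear_boundedP.
exists (opnorm T)%:C; split=> [|r Tr x].
  by apply: ger0_real; rewrite lecR opnorm_ge0.
apply: le_trans (ler_wpM2r (normr_ge0 x) (ltW Tr)).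
rewrite rnormE (rnormE x) -(rmorphM (real_complex R)) lecR.
exact: opnorm_le.
Qed.

Let compact_op_scaleD a (S T : bop X) :
  compact_op S -> compact_op T -> compact_op (a *: S + T).
Proof.
move=> /asboolP[K SK [cK _]] /asboolP[L TL [cL _]]; apply/asboolP.
pose f (z : X * X) := a *: z.1 + z.2.
apply: (@precompact_subset _ _ (f @` (K `*` L))).
  move=> _ [x x1 <-]; exists (S x, T x) => //.
  by split; [apply: SK; exists x|apply: TL; exists x].
apply: compact_precompact; first exact: norm_hausdorff.
apply: continuous_compact; last exact: compact_setX.
apply: continuous_subspaceT => z; apply: cvgD; last exact: cvg_snd.
by apply: cvgZ; [exact: cvg_cst|exact: cvg_fst].
Qed.

Lemma compact_op_submod_closed : submod_closed compact_op.
Proof.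
split=> [|a S T]; last exact: compact_op_scaleD.
apply/asboolP/(@precompact_subset _ _ [set 0]).
  by move=> _ [x _ <-].
apply: compact_precompact; first exact: norm_hausdorff.
exact: compact_set1.
Qed.

HB.instance Definition _ :=
  GRing.isSubmodClosed.Build _ _ compact_op compact_op_submod_closed.

Lemma compact_op_mull (S T : bop X) : T \in compact_op -> S * T \in compact_op.
Proof.
move=> /asboolP cT; apply/asboolP.
rewrite (_ : _ @` _ = S @` (T @` [set x : X | rnorm x <= 1])).
  by apply: precompact_image cT; exact: bop_continuous.
by rewrite image_comp.
Qed.

Lemma compact_op_mulr (S T : bop X) : S \in compact_op -> S * T \in compact_op.
Proof.
move=> /asboolP cS; apply/asboolP.
pose M : R := opnorm T + 1.
have M0 : 0 < M by rewrite ltr_wpDl ?opnorm_ge0.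
apply: (@precompact_subset _ _
    (( *:%R M%:C : X -> X) @` (S @` [set x : X | rnorm x <= 1]))); last first.
  apply: precompact_image cS => x.
  by apply: cvgZ; [exact: cvg_cst|exact: cvg_id].
move=> _ [x /= x1 <-]; exists (S (M^-1%:C *: T x)).
  exists (M^-1%:C *: T x) => //=.
  rewrite rnormZ rnormC ?invr_ge0 ?(ltW M0)//.
  rewrite ler_pdivrMl// mulr1 (le_trans (opnorm_le _ _))//.
  rewrite (le_trans (ler_piMr _ x1)) ?opnorm_ge0//.
  by rewrite lerDl.
by rewrite linearZ scalerA -(rmorphM (real_complex R)) divff ?gt_eqF// scale1r.
Qed.

Definition calkin := Quotient.quot (GRing.ZmodClosed.clone (bop X) compact_op _).

HB.instance Definition _ := Choice.on calkin.
HB.instance Definition _ := EqQuotient.on calkin.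
HB.instance Definition _ := GRing.Zmodule.on calkin.

Definition calkin_pi (T : bop X) : calkin := (\pi_calkin T)%qT.

Lemma calkin_piP (S T : bop X) :
  calkin_pi S = calkin_pi T <-> S - T \in compact_op.
Proof. by rewrite Quotient.idealrBE; split=> /eqP. Qed.

Lemma calkin_piK (x : calkin) : calkin_pi (repr x) = x.
Proof. exact: reprK. Qed.

Lemma calkin_piD (S T : bop X) :
  calkin_pi (S + T) = calkin_pi S + calkin_pi T.
Proof. exact: (Quotient.pi_add (GRing.ZmodClosed.clone (bop X) compact_op _) S T). Qed.

Let compact_op_repr (T : bop X) : T - repr (calkin_pi T) \in compact_op.
Proof. by apply/calkin_piP; rewrite calkin_piK. Qed.

Let scale (a : R[i]) (x : calkin) : calkin := calkin_pi (a *: repr x).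

Let pi_scale a (T : bop X) : calkin_pi (a *: T) = scale a (calkin_pi T).
Proof. by apply/calkin_piP; rewrite -scalerBr rpredZ. Qed.

Let scaleA a b x : scale a (scale b x) = scale (a * b) x.
Proof. by rewrite -[x]calkin_piK -!pi_scale scalerA. Qed.

Let scale1 : left_id 1 scale.
Proof. by move=> x; rewrite -[x]calkin_piK -pi_scale scale1r. Qed.

Let scaleDr : right_distributive scale +%R.
Proof.
move=> a x y; rewrite -[x]calkin_piK -[y]calkin_piK.
by rewrite -calkin_piD -!pi_scale -calkin_piD scalerDr.
Qed.

Let scaleDl x : {morph scale^~ x : a b / a + b}.
Proof.
move=> a b; rewrite -[x]calkin_piK.
by rewrite -!pi_scale -calkin_piD scalerDl.
Qed.

HB.instance Definition _ := GRing.Zmodule_isLmodule.Build R[i] calkin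
  scaleA scale1 scaleDr scaleDl.

Let one : calkin := calkin_pi 1.

Let mul (x y : calkin) : calkin := calkin_pi (repr x * repr y).

Let pi_mul (S T : bop X) : calkin_pi (S * T) = mul (calkin_pi S) (calkin_pi T).
Proof.
apply/calkin_piP; set S' := repr _; set T' := repr _.
rewrite (_ : _ - _ = S * (T - T') + (S - S') * T'); last first.
  by rewrite mulrBr mulrBl addrA subrK.
by apply: rpredD; [exact: compact_op_mull|exact: compact_op_mulr].
Qed.

Let mulA : associative mul.
Proof.
move=> x y z; rewrite -[x]calkin_piK -[y]calkin_piK -[z]calkin_piK.
by rewrite -!pi_mul mulrA.
Qed.

Let mul_1l : left_id one mul.
Proof. by move=> x; rewrite -[x]calkin_piK -pi_mul mul1r. Qed.

Let mul_1r : right_id one mul.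
Proof. by move=> x; rewrite -[x]calkin_piK -pi_mul mulr1. Qed.

Let mulDl : left_distributive mul +%R.
Proof.
move=> x y z; rewrite -[x]calkin_piK -[y]calkin_piK -[z]calkin_piK.
by rewrite -calkin_piD -!pi_mul -calkin_piD mulrDl.
Qed.

Let mulDr : right_distributive mul +%R.
Proof.
move=> x y z; rewrite -[x]calkin_piK -[y]calkin_piK -[z]calkin_piK.
by rewrite -calkin_piD -!pi_mul -calkin_piD mulrDr.
Qed.

HB.instance Definition _ := GRing.Zmodule_isPzRing.Build calkin
  mulA mul_1l mul_1r mulDl mulDr.

Lemma calkin_piZ a (T : bop X) : calkin_pi (a *: T) = a *: calkin_pi T.
Proof. exact: pi_scale. Qed.

Lemma calkin_piM (S T : bop X) : calkin_pi (S * T) = calkin_pi S * calkin_pi T.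
Proof. exact: pi_mul. Qed.

Definition calkin_norm (x : calkin) : R :=
  inf [set rnorm T | T in [set T : bop X | calkin_pi T = x]].

Lemma calkin_normE (T : bop X) :
  calkin_norm (calkin_pi T) =
  inf [set rnorm (T - K) | K in [set K : bop X | compact_op K]].
Proof.
congr inf; apply/seteqP; split=> _ [S /= Sx <-].
  by exists (T - S); [exact/calkin_piP/esym|rewrite subKr].
by exists (T - S) => //=; apply/esym/calkin_piP; rewrite subKr.
Qed.

End calkin_algebra.

(* C*-algebras over [R[i]], not necessarily unital: the product and the
   involution come on top of the Banach space structure because the ring
   structures of the library all have a unit. *)
HB.mixin Record isCstarAlgebra (R : realType) A
    of CompleteNormedModule R[i] A := {
  cmul : A -> A -> A;
  star : A -> A;
  cmulA : associative cmul;
  cmulDl : left_distributive cmul +%R;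
  cmulDr : right_distributive cmul +%R;
  cmulZl : forall (a : R[i]) (x y : A), cmul (a *: x) y = a *: cmul x y;
  cmulZr : forall (a : R[i]) (x y : A), cmul x (a *: y) = a *: cmul x y;
  cmul_norm_le : forall x y : A, `|cmul x y| <= `|x| * `|y|;
  starK : involutive star;
  starD : {morph star : x y / x + y};
  starZ : forall (a : R[i]) (x : A), star (a *: x) = a^* *: star x;
  starM : forall x y : A, star (cmul x y) = cmul (star y) (star x);
  cstar_identity : forall x : A, `|cmul (star x) x| = `|x| ^+ 2
}.

#[short(type="cstarAlgType")]
HB.structure Definition CstarAlgebra (R : realType) :=
  {A of isCstarAlgebra R A & CompleteNormedModule R[i] A}.

Definition separable (T : topologicalType) : Prop :=
  exists2 D : set T, countable D & dense D.

(* Main.v *)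
(* Represent A on Hilbert spaces. For suitable finite-dimensional blocks H_n,
   a dense set of elements of A acts by matrices which are block tridiagonal
   from some block on. Truncating every element to its tridiagonal part gives
   an operator on the l^p-sum of the H_n, bounded because each block is, and
   this is multiplicative modulo compact operators because on the dense set
   nothing is lost far out. The l^p-sum of the H_n embeds complementedly in
   l^p by Khintchine's inequality. The lower bound is seen on unit vectors lying
   in a single block arbitrarily far out, on which compact operators become
   invisible: one GNS representation is used for each element of a dense
   sequence, infinitely often, and its cyclic vector spans the first block.

   The GNS representations require states norming a given element: b^* b is
   positive by Kaplansky's argument, carried out in the unital algebra of
   adjointable operators on A so that A itself need not have a unit, and
   Hahn-Banach applies to the sublinear functional inf {t >= 0 | t - Re x >= 0}. *)
Require Import Defs.
From HB Require Import structures.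
From mathcomp Require Import all_boot all_order all_algebra.
From mathcomp Require Import all_classical all_reals all_analysis.
From mathcomp Require Import complex ring lra zify.

Set Implicit Arguments.
Unset Strict Implicit.
Unset Printing Implicit Defensive.

Import Order.TTheory GRing.Theory Num.Theory.
Import numFieldNormedType.Exports.

Local Open Scope classical_set_scope.
Local Open Scope ring_scope.
Local Open Scope complex_scope.

(** * Limits of norm-controlled sequences *)

Section limits.
Context {R : realType}.

(** An operator on the Hilbert sum of the blocks need not be bounded on their l^p-sum when p is not
    2, but a matrix with boundedly many block diagonals is. This is why every element is cut to
    three diagonals: the cut is linear in the element with a uniform bound, so the map is defined on
    all of A at once, and only multiplicativity has to be transported from the dense set. A product
    of two tridiagonal matrices has five diagonals. The list of elements steering the choice of
    blocks therefore contains the products of elements of the dense set, which makes the outer two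
    diagonals vanish far out. It also contains the adjoints: the blocks are built so that a listed
    element moves a vector at most one block up, and the same for its adjoint limits how far it
    moves down. Spectral theory is replaced by norm estimates: the A-valued inner product x^* y
    gives adjointable operators on A a C^*-identity, and square roots come from an iteration. The
    GNS spaces are neither quotiented nor completed; vectors of length zero are carried along, and
    matrix entries are values of the form. *)

Lemma rcD (a b : R) : (a + b)%:C = a%:C + b%:C.
Proof. exact: rmorphD. Qed.

Lemma rcM (a b : R) : (a * b)%:C = a%:C * b%:C.
Proof. exact: rmorphM. Qed.

Lemma rcN (a : R) : (- a)%:C = - a%:C.
Proof. exact: rmorphN. Qed.

Lemma rnormN (V : normedZmodType R[i]) (x : V) : rnorm (- x) = rnorm x.
Proof. by rewrite /rnorm normrN. Qed.

Lemma rdistC (V : normedZmodType R[i]) (x y : V) : rnorm (x - y) = rnorm (y - x).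
Proof. by rewrite -rnormN opprB. Qed.

Lemma ler_rdistD (V : normedZmodType R[i]) (z x y : V) :
  rnorm (x - y) <= rnorm (x - z) + rnorm (z - y).
Proof. by rewrite (le_trans _ (ler_rnormD _ _))// addrA subrK. Qed.

Lemma rnorm_eps0 (V : normedZmodType R[i]) (x : V) (K : R) :
  (forall e, 0 < e -> rnorm x <= K * e) -> x = 0.
Proof.
move=> h; apply/rnorm0_eq0/le_anti; rewrite rnorm_ge0 andbT.
apply/ler_addgt0Pr => e e0; rewrite add0r.
have K1 : 0 < `|K| + 1 by rewrite ltr_wpDl.
rewrite (le_trans (h (e / (`|K| + 1)) _)) ?divr_gt0//.
rewrite mulrA ler_pdivrMr// mulrC ler_wpM2l ?(ltW e0)//.
by rewrite (le_trans (ler_norm _))// lerDl.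
Qed.

(** The increments of [u] are dominated by those of a bounded scalar sequence, so a single
    hypothesis yields convergence together with the explicit error [l - g n]. *)
Lemma cauchy_limit (V : completeNormedModType R[i]) (u : nat -> V)
    (g : nat -> R) (l : R) :
  (forall m n, (n <= m)%N -> rnorm (u m - u n) <= g m - g n) ->
  (forall n, g n <= l) ->
  (forall e, 0 < e -> exists n, l - g n <= e) ->
  exists y, forall n, rnorm (y - u n) <= l - g n.
Proof.
move=> ug gl lg.
have cu : cvg (u @ \oo).
  apply: cauchy_cvg; apply: cauchy_exP => -[e ei].
  rewrite ltcE /= => /andP[/eqP -> e0].
  have [n ne] := lg (e / 2) (divr_gt0 e0 (ltr0Sn _ 1)).
  exists (u n); exists n => // m /= nm.
  rewrite -ball_normE /= rnormE -[_ +i* 0]/(e%:C) ltcR.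
  rewrite rdistC (le_lt_trans (ug _ _ nm))// (le_lt_trans (lerB (gl m) (lexx _)))//.
  by rewrite (le_lt_trans ne)// ltr_pdivrMr// ltr_pMr// ltr1n.
exists (lim (u @ \oo)) => n; apply/ler_addgt0Pr => e e0.
have e0' : 0 < e%:C by rewrite ltcR.
have /cvgrPdist_lt /(_ _ e0') [N _ hN] := cu.
have := hN (maxn n N) (leq_maxr _ _).
rewrite rnormE ltcR => /ltW h.
rewrite (le_trans (ler_rdistD (u (maxn n N)) _ _))// addrC lerD//.
by rewrite (le_trans (ug _ _ (leq_maxl _ _)))// lerB.
Qed.

Lemma nondecreasing_sup (g : nat -> R) (b : R) :
  (forall m n, (n <= m)%N -> g n <= g m) -> (forall n, g n <= b) ->
  exists l, [/\ l <= b, forall n, g n <= l &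
    forall e, 0 < e -> exists n, l - g n <= e].
Proof.
move=> gi gb; have hs : has_sup (range g).
  by split; [exists (g 0%N), 0%N | exists b => _ [n _ <-]].
exists (sup (range g)); split.
- by apply: ge_sup => [|_ [n _ <-]//]; exists (g 0%N), 0%N.
- by move=> n; apply: sup_upper_bound => //; exists n.
- move=> e e0; have [_ [n _ <-] h] := sup_adherent e0 hs.
  by exists n; rewrite lerBlDr -lerBlDl ltW.
Qed.

Lemma rnorm_bopM (X : normedModType R[i]) (S T : bop X) :
  rnorm (S * T) <= rnorm S * rnorm T.
Proof.
rewrite !rnorm_bopE; apply: opnorm_lub => [|x].
  by rewrite mulr_ge0 ?opnorm_ge0.
rewrite bop_mulE (le_trans (opnorm_le _ _))// -mulrA.
by rewrite ler_wpM2l ?opnorm_ge0// opnorm_le.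
Qed.

Lemma rnorm_bop_le (X : normedModType R[i]) (T : bop X) x :
  rnorm (T x) <= rnorm T * rnorm x.
Proof. exact: opnorm_le. Qed.

Lemma rnorm_bop1 (X : normedModType R[i]) : rnorm (1 : bop X) <= 1.
Proof. by rewrite rnorm_bopE; apply: opnorm_lub => // x; rewrite mul1r. Qed.

(** Limits are taken pointwise; the error [(l - g n) * rnorm x] is uniform on the unit ball, which
    gives linearity, boundedness and the norm estimate together. *)
Lemma bop_cauchy_limit (V : completeNormedModType R[i]) (u : nat -> bop V)
    (g : nat -> R) (l : R) :
  (forall m n, (n <= m)%N -> rnorm (u m - u n) <= g m - g n) ->
  (forall n, g n <= l) ->
  (forall e, 0 < e -> exists n, l - g n <= e) ->
  exists y : bop V, forall n, rnorm (y - u n) <= l - g n.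
Proof.
move=> ug gl lg.
have h (x : V) : exists y, forall n, rnorm (y - u n x) <= (l - g n) * rnorm x.
  have [||e e0|y hy] := @cauchy_limit V (fun n => u n x)
      (fun n => g n * rnorm x) (l * rnorm x).
  - move=> m n nm; rewrite -mulrBl -[u m x - u n x]/((u m - u n : bop V) x).
    by rewrite (le_trans (rnorm_bop_le _ _))// ler_wpM2r ?rnorm_ge0// ug.
  - by move=> n; rewrite ler_wpM2r ?rnorm_ge0.
  - have x1 : 0 < rnorm x + 1 by rewrite ltr_wpDl ?rnorm_ge0.
    have [n hn] := lg (e / (rnorm x + 1)) (divr_gt0 e0 x1).
    exists n; rewrite -mulrBl (le_trans (ler_wpM2r (rnorm_ge0 x) hn))//.
    rewrite mulrAC ler_pdivrMr// ler_wpM2l ?(ltW e0)// lerDl//.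
  - by exists y => n; rewrite mulrBl; exact: hy.
have [f hf] := choice h.
have fm : bop_mem f.
  apply/asboolP; split=> [a x y|].
    apply/eqP; rewrite -subr_eq0; apply/eqP.
    apply: (@rnorm_eps0 _ _ (rnorm (a *: x + y) + rnorm a * rnorm x + rnorm y)).
    move=> e /lg [n ne].
    have -> : f (a *: x + y) - (a *: f x + f y) =
      (f (a *: x + y) - u n (a *: x + y)) + (a *: (u n x - f x) + (u n y - f y)).
      rewrite [u n (a *: x + y)]linearP scalerBr [X in _ = _ + X]addrACA -opprD addrA.
      by rewrite subrK.
    rewrite (le_trans (ler_rnormD _ _))// -addrA mulrDl lerD//.
      by rewrite (le_trans (hf _ n))// mulrC ler_wpM2l ?rnorm_ge0.
    rewrite (le_trans (ler_rnormD _ _))// mulrDl lerD//.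
      rewrite rnormZ -mulrA ler_wpM2l ?rnorm_ge0// rdistC.
      by rewrite (le_trans (hf _ n))// mulrC ler_wpM2l ?rnorm_ge0.
    by rewrite rdistC (le_trans (hf _ n))// mulrC ler_wpM2l ?rnorm_ge0.
  exists (l - g 0%N + rnorm (u 0%N)) => x.
  rewrite -[f x](subrK (u 0%N x)) (le_trans (ler_rnormD _ _))// mulrDl lerD//.
  exact: rnorm_bop_le.
exists (exist _ f fm) => n; rewrite rnorm_bopE; apply: opnorm_lub => [|x].
  by rewrite subr_ge0.
exact: hf.
Qed.

End limits.

(** * Adjointable operators on a C*-algebra *)

Section adjointable.
Context {R : realType} {A : cstarAlgType R}.
Implicit Types (x y z : A) (S T : bop A) (r : R).

Lemma cmul0l x : cmul 0 x = 0.
Proof. by have := cmulZl 0 (0 : A) x; rewrite !scale0r. Qed.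

Lemma cmul0r x : cmul x 0 = 0.
Proof. by have := cmulZr 0 x (0 : A); rewrite !scale0r. Qed.

Lemma cmulBl x y z : cmul (x - y) z = cmul x z - cmul y z.
Proof. by rewrite cmulDl -(scaleN1r y) cmulZl scaleN1r. Qed.

Lemma cmulBr x y z : cmul z (x - y) = cmul z x - cmul z y.
Proof. by rewrite cmulDr -(scaleN1r y) cmulZr scaleN1r. Qed.

Lemma star0 : star (0 : A) = 0.
Proof. by have := starZ 0 (0 : A); rewrite rmorph0 !scale0r. Qed.

Lemma rnorm_cmul x y : rnorm (cmul x y) <= rnorm x * rnorm y.
Proof. by rewrite -lecR rcM -!rnormE; exact: cmul_norm_le. Qed.

Lemma rnorm_cstar x : rnorm (cmul (star x) x) = rnorm x ^+ 2.
Proof. by apply: (@complexI R); rewrite expr2 rcM -!rnormE cstar_identity expr2. Qed.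

Lemma rnorm_star x : rnorm (star x) = rnorm x.
Proof.
suff h y : rnorm y <= rnorm (star y).
  by apply/le_anti; rewrite h andbT -{2}[x]starK h.
have [->|y0] := eqVneq (rnorm y) 0; first exact: rnorm_ge0.
have {}y0 : 0 < rnorm y by rewrite lt_def y0 rnorm_ge0.
by rewrite -(ler_pM2r y0) -expr2 -rnorm_cstar rnorm_cmul.
Qed.

(* [S] and [T] are adjoint for the A-valued inner product (x, y) |-> x^* y. *)
Definition adj S T := forall x y, cmul (star (S x)) y = cmul (star x) (T y).

Lemma adj_sym S T : adj S T -> adj T S.
Proof.
move=> h x y; apply: (can_inj starK).
by rewrite !starM !starK -h.
Qed.

Lemma adjD S T S' T' : adj S S' -> adj T T' -> adj (S + T) (S' + T').
Proof. by move=> h k x y; rewrite !bop_addE starD cmulDl cmulDr h k. Qed.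

Lemma adjZ (a : R[i]) S S' : adj S S' -> adj (a *: S) (Num.conj a *: S').
Proof. by move=> h x y; rewrite !bop_scaleE starZ cmulZl cmulZr h. Qed.

Lemma conjCr r : Num.conj r%:C = r%:C :> R[i].
Proof. exact: conjc_real. Qed.

Lemma adjZr r S S' : adj S S' -> adj (r%:C *: S) (r%:C *: S').
Proof. by move=> /(adjZ r%:C); rewrite conjCr. Qed.

Lemma adjN S S' : adj S S' -> adj (- S) (- S').
Proof.
by move=> /(adjZr (-1)); rewrite !rmorphN !rmorph1 !scaleN1r.
Qed.

Lemma adjB S T S' T' : adj S S' -> adj T T' -> adj (S - T) (S' - T').
Proof. by move=> h /adjN; exact: adjD. Qed.

Lemma adjM S T S' T' : adj S S' -> adj T T' -> adj (S * T) (T' * S').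
Proof. by move=> h k x y; rewrite !bop_mulE h k. Qed.

Lemma adj0 : adj 0 0.
Proof. by move=> x y; rewrite /= star0 cmul0l cmul0r. Qed.

Lemma adj1 : adj 1 1.
Proof. by []. Qed.

(** The C^*-identity of A is inherited: the squared norm of S x is the norm of (S x)^* (S x), and
    adjointness turns this product into x^* (T S x). *)
Lemma rnorm_adj S T : adj S T -> rnorm S ^+ 2 <= rnorm (T * S).
Proof.
move=> h; rewrite -[leRHS]sqr_sqrtr ?rnorm_ge0// lerXn2r ?nnegrE ?rnorm_ge0 ?sqrtr_ge0//.
rewrite [leLHS]rnorm_bopE; apply: opnorm_lub => [|x]; first exact: sqrtr_ge0.
rewrite -ler_sqr ?nnegrE ?mulr_ge0 ?sqrtr_ge0 ?rnorm_ge0// exprMn.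
rewrite sqr_sqrtr ?rnorm_ge0//.
rewrite -rnorm_cstar h (le_trans (rnorm_cmul _ _))// rnorm_star expr2 mulrC mulrA.
rewrite -[T (S x)]/((T * S : bop A) x).
by rewrite ler_wpM2r ?rnorm_ge0// rnorm_bop_le.
Qed.

Lemma adj_eq0 S T : adj S T -> T * S = 0 -> S = 0.
Proof.
move=> /rnorm_adj h TS; apply/rnorm0_eq0/eqP; rewrite -sqrf_eq0.
by rewrite -[_ == _]orFb eq_le exprn_ge0 ?rnorm_ge0// andbT -(rnorm0 (bop A)) -TS.
Qed.

Lemma rnorm_sqr_adj S : adj S S -> rnorm (S * S) = rnorm S ^+ 2.
Proof.
by move=> h; apply/le_anti; rewrite expr2 rnorm_bopM -expr2 rnorm_adj.
Qed.

Lemma adj_limit S : (forall e : R, 0 < e -> exists2 T, adj T T & rnorm (S - T) <= e) ->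
  adj S S.
Proof.
move=> h x y; apply/eqP; rewrite -subr_eq0; apply/eqP.
apply: (@rnorm_eps0 _ _ _ (rnorm x * rnorm y + rnorm x * rnorm y)) => e /h[T aT Te].
have -> : cmul (star (S x)) y - cmul (star x) (S y) =
   cmul (star ((S - T : bop A) x)) y - cmul (star x) ((S - T : bop A) y).
  rewrite -[(S - T : bop A) x]/(S x - T x) -[(S - T : bop A) y]/(S y - T y).
  rewrite -[- T x]scaleN1r -[- T y]scaleN1r starD starZ cmulDl cmulDr cmulZl cmulZr.
  by rewrite rmorphN rmorph1 !scaleN1r aT opprB addrA subrK.
have k z : rnorm ((S - T : bop A) z) <= e * rnorm z.
  by rewrite (le_trans (rnorm_bop_le _ _))// ler_wpM2r ?rnorm_ge0.
rewrite (le_trans (ler_rnormD _ _))// rnormN mulrDl lerD//.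
  rewrite (le_trans (rnorm_cmul _ _))// rnorm_star.
  by apply: le_trans (ler_wpM2r (rnorm_ge0 y) (k x)) _; lra.
rewrite (le_trans (rnorm_cmul _ _))// rnorm_star.
by apply: le_trans (ler_wpM2l (rnorm_ge0 x) (k y)) _; lra.
Qed.

Lemma rnormCr r : 0 <= r -> forall S, rnorm (r%:C *: S) = r * rnorm S.
Proof. by move=> r0 S; rewrite rnormZ rnormC. Qed.

Lemma half_double (V : lmodType R[i]) (x : V) : 2^-1%:C *: x + 2^-1%:C *: x = x.
Proof.
rewrite -scalerDl -rcD (_ : _ + _ = 1); last by field.
by rewrite -[1%:C]/(1 : R[i]) scale1r.
Qed.

(* The square root 1 - T of 1 - S is the limit of T' = (S + T^2) / 2; in norm,
   this iteration is dominated by the same one for the scalar 1. *)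
Let sqrt_step S T := 2^-1%:C *: (S + T * T).
Let sqrt_iter S n := iter n (sqrt_step S) 0.
Let sqrt_num n : R := iter n (fun t => 2^-1 * (1 + t ^+ 2)) 0.

Let sqrt_iter_comm S n T : T * S = S * T ->
  T * sqrt_iter S n = sqrt_iter S n * T.
Proof.
move=> h; elim: n => [|n ih]; first by rewrite /= mulr0 mul0r.
rewrite /= /sqrt_step -bop_scalerAr -bop_scalerAl mulrDl mulrDr h.
by rewrite mulrA ih -!mulrA ih.
Qed.

Let sqrt_num_ge0 n : 0 <= sqrt_num n.
Proof. by case: n => //= n; rewrite mulr_ge0// addr_ge0// sqr_ge0. Qed.

Let sqrt_num_le1 n : sqrt_num n <= 1.
Proof.
elim: n => //= n ih; rewrite ler_pdivrMl// mulr1 -[2](natrD _ 1 1) lerD//.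
by rewrite expr_le1.
Qed.

Let sqrt_iter_le S n : rnorm S <= 1 -> rnorm (sqrt_iter S n) <= sqrt_num n.
Proof.
move=> S1; elim: n => [|n ih]; first by rewrite rnorm0.
rewrite rnormCr// ler_wpM2l// (le_trans (ler_rnormD _ _))// lerD//.
by rewrite (le_trans (rnorm_bopM _ _))// expr2 ler_pM ?rnorm_ge0.
Qed.

(** Scalars and operators obey the same recursion. The factorisation of a difference of squares
    carries the domination through, since two iterates are polynomials in [S] and commute. *)
Let sqrt_iter_diff S n : rnorm S <= 1 ->
  rnorm (sqrt_iter S n.+1 - sqrt_iter S n) <= sqrt_num n.+1 - sqrt_num n.
Proof.
move=> S1; elim: n => [|n ih].
  rewrite /= /sqrt_step mul0r addr0 subr0 rnormCr// expr0n /= addr0 subr0.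
  by rewrite ler_wpM2l.
rewrite [sqrt_iter S n.+2]/= [sqrt_num n.+2]/= {2}/sqrt_iter {2}/sqrt_num !iterS.
rewrite -/(sqrt_iter S n) -/(sqrt_num n).
set y' := sqrt_iter S n.+1 in ih *; set y := sqrt_iter S n in ih *.
rewrite /sqrt_step -scalerBr opprD addrACA subrr add0r -mulrBr opprD addrACA subrr add0r.
rewrite rnormCr// ler_wpM2l//.
have yy' : y' * y = y * y'.
  by apply: sqrt_iter_comm; apply/esym/sqrt_iter_comm.
have -> : y' * y' - y * y = (y' - y) * (y' + y).
  by rewrite mulrDr !mulrBl yy' addrA subrK.
rewrite subr_sqr (le_trans (rnorm_bopM _ _))// ler_pM ?rnorm_ge0//.
by rewrite (le_trans (ler_rnormD _ _))// lerD// sqrt_iter_le.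
Qed.

Lemma bop_sqrt S : adj S S -> rnorm S <= 1 ->
  exists T, [/\ adj T T, rnorm T <= 1, (1 - T) * (1 - T) = 1 - S &
    forall Z, Z * S = S * Z -> Z * T = T * Z].
Proof.
move=> aS S1.
have mono m n : (n <= m)%N ->
    rnorm (sqrt_iter S m - sqrt_iter S n) <= sqrt_num m - sqrt_num n.
  move=> /subnK <-; elim: (m - n)%N => [|k ih]; first by rewrite add0n !subrr rnorm0.
  rewrite addSn (le_trans (ler_rdistD (sqrt_iter S (k + n)) _ _))//.
  by have := sqrt_iter_diff (k + n) S1; lra.
have [l [l1 gl lg]] : exists l, [/\ l <= 1, forall n, sqrt_num n <= l &
    forall e, 0 < e -> exists n, l - sqrt_num n <= e].
  apply: nondecreasing_sup sqrt_num_le1 => m n /mono h.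
  by rewrite -subr_ge0 (le_trans _ h)// rnorm_ge0.
have [T hT] := bop_cauchy_limit mono gl lg.
have T1 : rnorm T <= 1.
  rewrite -[T](subrK (sqrt_iter S 0)) (le_trans (ler_rnormD _ _))//.
  by rewrite (le_trans (lerD (hT 0%N) (lexx _)))//= rnorm0 addr0 subr0.
exists T; split => //.
- apply: adj_limit => e /lg[n ne]; exists (sqrt_iter S n); last first.
    exact: le_trans (hT n) ne.
  elim: n {ne} => [|n ih]; first exact: adj0.
  by apply: adjZr; apply: adjD => //; exact: adjM.
(* The fixed point equation 2 T = S + T^2 is [(1 - T) * (1 - T) = 1 - S] rearranged. *)
- have e2 : 2^-1%:C *: (S + T * T) = T.
    apply/esym/eqP; rewrite -subr_eq0; apply/eqP.
    apply: (@rnorm_eps0 _ _ _ 2) => e /lg[n ne].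
    have -> : T - 2^-1%:C *: (S + T * T) = (T - sqrt_iter S n.+1) +
       2^-1%:C *: (sqrt_iter S n * (sqrt_iter S n - T) + (sqrt_iter S n - T) * T).
      rewrite mulrBr mulrBl addrA subrK; set y := sqrt_iter S n.
      rewrite -[sqrt_iter S n.+1]/(2^-1%:C *: (S + y * y)) -addrA; congr (_ + _).
      rewrite -scalerN -[- (_ *: _)]scalerN -scalerDr; congr (_ *: _).
      by rewrite opprD (opprD S (y * y)) [RHS]addrA subrK.
    have h (k : bop A) : rnorm k <= 1 -> rnorm (k * (sqrt_iter S n - T)) <= e.
      move=> k1; rewrite (le_trans (rnorm_bopM _ _))// -[e]mul1r ler_pM ?rnorm_ge0//.
      by rewrite rdistC (le_trans (hT _)).
    have h' : rnorm ((sqrt_iter S n - T) * T : bop A) <= e.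
      rewrite (le_trans (rnorm_bopM _ _))// -[e]mulr1 ler_pM ?rnorm_ge0//.
      by rewrite rdistC (le_trans (hT _)).
    have b1 : rnorm (T - sqrt_iter S n.+1) <= e.
      have := mono _ _ (leqnSn n); have := hT n.+1.
      by have := rnorm_ge0 (sqrt_iter S n.+1 - sqrt_iter S n); lra.
    apply: le_trans (ler_rnormD _ _) _; rewrite rnormCr//.
    have := ler_rnormD (sqrt_iter S n * (sqrt_iter S n - T)) ((sqrt_iter S n - T) * T).
    by have := h _ (le_trans (sqrt_iter_le n S1) (sqrt_num_le1 n)); lra.
  have {}e2 : T + T = S + T * T by rewrite -[in LHS]e2 half_double.
  by rewrite mulrBr mulr1 mulrBl mul1r opprB addrACA -opprD e2 opprD addrACA subrr addr0.
- move=> Z ZS; apply/eqP; rewrite -subr_eq0; apply/eqP.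
  apply: (@rnorm_eps0 _ _ _ (rnorm Z + rnorm Z)) => e /lg[n ne].
  have -> : Z * T - T * Z = Z * (T - sqrt_iter S n) - (T - sqrt_iter S n) * Z.
    by rewrite mulrBr mulrBl (sqrt_iter_comm n ZS) opprB addrA subrK.
  rewrite (le_trans (ler_rnormD _ _))// rnormN [leRHS]mulrDl lerD//.
    by rewrite (le_trans (rnorm_bopM _ _))// ler_wpM2l ?rnorm_ge0// (le_trans (hT n) ne).
  by rewrite (le_trans (rnorm_bopM _ _))// mulrC ler_wpM2l ?rnorm_ge0// (le_trans (hT n) ne).
Qed.

End adjointable.

(** * Positive operators *)

Section positive.
Context {R : realType} {A : cstarAlgType R}.
Implicit Types (S T : bop A) (r t : R).

(* Encodes that the spectrum of T lies in [0, 2t], but visibly defines a cone. *)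
Definition pos T := adj T T /\ exists2 t, 0 <= t & rnorm (t%:C *: (1 : bop A) - T) <= t.

Lemma pos_adj T : pos T -> adj T T.
Proof. by case. Qed.

Lemma posD S T : pos S -> pos T -> pos (S + T).
Proof.
move=> [aS [s s0 sS]] [aT [t t0 tT]]; split; first exact: adjD.
exists (s + t); first exact: addr_ge0.
by rewrite rcD scalerDl opprD addrACA (le_trans (ler_rnormD _ _))// lerD.
Qed.

Lemma posZ r T : 0 <= r -> pos T -> pos (r%:C *: T).
Proof.
move=> r0 [aT [t t0 tT]]; split; first exact: adjZr.
exists (r * t); first exact: mulr_ge0.
by rewrite rcM -scalerA -scalerBr rnormCr// ler_wpM2l.
Qed.

Lemma pos_normB T : adj T T -> pos ((rnorm T)%:C *: (1 : bop A) - T).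
Proof.
move=> aT; split; first by apply: adjB => //; apply: adjZr; exact: adj1.
by exists (rnorm T); rewrite ?rnorm_ge0// subKr.
Qed.

Lemma scalerCK (V : lmodType R[i]) r (x : V) : r != 0 ->
  r%:C *: (r^-1%:C *: x) = x.
Proof.
by move=> r0; rewrite scalerA -rcM divff// -[1%:C]/(1 : R[i]) scale1r.
Qed.

(** Rescaling: T = t (1 - X) with [X] of norm at most 1, so the root is sqrt t times the root of 1 -
    X. The degenerate value t = 0 forces [T = 0]. *)
Lemma pos_sqrt T : pos T -> exists S, [/\ pos S, S * S = T &
  forall Z, Z * T = T * Z -> Z * S = S * Z].
Proof.
move=> [aT [t]]; rewrite le_eqVlt => /orP[/eqP <-|t0 tT].
  rewrite scale0r sub0r rnormN => T0.
  have -> : T = 0 by apply/rnorm0_eq0/le_anti; rewrite T0 rnorm_ge0.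
  exists 0; split; rewrite ?mulr0//; split; first exact: adj0.
  by exists 0 => //; rewrite scale0r subr0 rnorm0.
pose X := 1 - t^-1%:C *: T.
have tX : t%:C *: X = t%:C *: (1 : bop A) - T by rewrite scalerBr scalerCK ?gt_eqF.
have aX : adj X X by apply: adjB; [exact: adj1|exact: adjZr].
have X1 : rnorm X <= 1.
  by rewrite -(ler_pM2l t0) mulr1 -rnormCr ?(ltW t0)// tX.
have [Y [aY Y1 YX YZ]] := bop_sqrt aX X1.
exists ((Num.sqrt t)%:C *: (1 - Y)); split.
- split; first by apply/adjZr/adjB => //; exact: adj1.
  exists (Num.sqrt t); rewrite ?sqrtr_ge0// -scalerBr subKr.
  by rewrite rnormCr ?sqrtr_ge0// ler_piMr ?sqrtr_ge0.
- rewrite -bop_scalerAl -bop_scalerAr scalerA YX -rcM -expr2 sqr_sqrtr ?(ltW t0)//.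
  by rewrite /X subKr scalerCK ?gt_eqF.
- move=> Z ZT; rewrite -bop_scalerAl -bop_scalerAr mulrBr mulrBl mulr1 mul1r YZ//.
  by rewrite /X mulrBr mulrBl mulr1 mul1r -bop_scalerAl -bop_scalerAr ZT.
Qed.

Lemma adj_ci S T : adj S S -> adj T T -> adj (S + 'i *: T) (S - 'i *: T).
Proof.
move=> aS aT; apply: adjD => //; have := adjZ 'i aT.
by rewrite conjCi scaleNr.
Qed.

(** For commuting self-adjoint [S] and [T] this is |s + i t|^2 = s^2 + t^2. Through [rnorm_adj] it
    bounds the norm of [S + 'i *: T] and, by averaging, those of [S] and [T]; this does duty for a
    functional calculus. *)
Lemma mul_ci S T : S * T = T * S ->
  (S - 'i *: T) * (S + 'i *: T) = S * S + T * T.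
Proof.
move=> ST; rewrite mulrDr !mulrBl -!bop_scalerAl -!bop_scalerAr.
by rewrite scalerA mulCii scaleN1r opprK ST addrA subrK.
Qed.

Lemma mul_ic S T : S * T = T * S ->
  (S + 'i *: T) * (S - 'i *: T) = S * S + T * T.
Proof.
move=> ST; have := @mul_ci S (- T); rewrite !scalerN opprK mulrNN => -> //.
by rewrite mulrN mulNr ST.
Qed.

Lemma rnormi : rnorm ('i : R[i]) = 1.
Proof. by apply: (@complexI R); rewrite -rnormE normCi. Qed.

Lemma ciB S T : (S + 'i *: T) - (S - 'i *: T) = 'i *: T + 'i *: T.
Proof. by rewrite opprB addrC addrA subrK. Qed.

(* T +- i sqrt(1 - T^2) are unitary. *)
Lemma rnorm_1Bsqr T : adj T T -> rnorm T <= 1 -> rnorm (1 - T * T) <= 1.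
Proof.
move=> aT T1; have aTT : adj (T * T) (T * T) by exact: adjM.
have TT1 : rnorm (T * T) <= 1.
  by rewrite (le_trans (rnorm_bopM _ _))// mulr_ile1 ?rnorm_ge0.
have [Y [aY Y1 YX YZ]] := bop_sqrt aTT TT1.
set S := 1 - Y in YX; rewrite -YX.
have aS : adj S S by apply: adjB => //; exact: adj1.
have TS : T * S = S * T.
  by rewrite mulrBr mulrBl mulr1 mul1r YZ// mulrA.
have ad := adj_ci aT aS.
have h1 : rnorm (T + 'i *: S) <= 1.
  rewrite -(@expr_le1 _ 2) ?rnorm_ge0// (le_trans (rnorm_adj ad))//.
  by rewrite mul_ci// YX addrC subrK rnorm_bop1.
have h2 : rnorm (T - 'i *: S) <= 1.
  rewrite -(@expr_le1 _ 2) ?rnorm_ge0// (le_trans (rnorm_adj (adj_sym ad)))//.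
  by rewrite mul_ic// YX addrC subrK rnorm_bop1.
have S1 : rnorm S <= 1.
  have := ler_rnormD (T + 'i *: S) (- (T - 'i *: S)).
  rewrite rnormN ciB -scalerDr rnormZ rnormi mul1r -mulr2n -scaler_nat.
  rewrite -(rmorph_nat (real_complex R)) rnormCr//; lra.
by rewrite (le_trans (rnorm_bopM _ _))// mulr_ile1 ?rnorm_ge0.
Qed.

Lemma pos_sqr T : adj T T -> pos (T * T).
Proof.
move=> aT; split; first exact: adjM.
have [/eqP T0|T0] := eqVneq (rnorm T) 0.
  exists 0 => //; rewrite (rnorm0_eq0 (eqP T0)) mulr0 scale0r subr0 rnorm0//.
have Tp : 0 < rnorm T by rewrite lt_def T0 rnorm_ge0.
exists (rnorm T ^+ 2); first exact: sqr_ge0.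
pose S := (rnorm T)^-1%:C *: T.
have ST : T = (rnorm T)%:C *: S by rewrite scalerCK.
have aS : adj S S by exact: adjZr.
have S1 : rnorm S <= 1 by rewrite rnormCr ?invr_ge0 ?(ltW Tp)// mulVf.
rewrite {2 3}ST -bop_scalerAl -bop_scalerAr scalerA -rcM -expr2 -scalerBr.
rewrite rnormCr ?sqr_ge0// ler_piMr ?sqr_ge0//; exact: rnorm_1Bsqr.
Qed.

(** A positive root [S] of [- (T * T)] commutes with [T], so [S * S + T * T = 0] makes both
    [S + 'i *: T] and its adjoint vanish. *)
Lemma pos_oppsqr_eq0 T : adj T T -> pos (- (T * T)) -> T = 0.
Proof.
move=> aT /pos_sqrt[S [/pos_adj aS SS SZ]].
have ST : S * T = T * S by rewrite -SZ// mulrN mulNr mulrA.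
have ad := adj_ci aS aT.
have h1 : S + 'i *: T = 0 by apply: adj_eq0 ad _; rewrite mul_ci// SS addNr.
have h2 : S - 'i *: T = 0.
  by apply: adj_eq0 (adj_sym ad) _; rewrite mul_ic// SS addNr.
have /eqP := ciB S T; rewrite h1 h2 subr0 -scalerDr eq_sym scaler_eq0 (negbTE (neq0Ci _)) /=.
by rewrite -mulr2n -scaler_nat scaler_eq0 pnatr_eq0 => /eqP.
Qed.

(** Up to sign, [S + T] and ['i *: (S - T)] are twice the real and imaginary parts of [S]; in the
    sum of their squares S^2 and T^2 cancel, leaving 2 (S T + T S). *)
Lemma pos_adjMD S T : adj S T -> pos (S * T + T * S).
Proof.
move=> aST; have aTS := adj_sym aST.
have aX : adj (S + T) (S + T) by rewrite {2}addrC; exact: adjD.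
have aY : adj ('i *: (S - T)) ('i *: (S - T)).
  by have := adjZ 'i (adjB aST aTS); rewrite conjCi scaleNr -scalerN opprB.
have -> : S * T + T * S = 2^-1%:C *: ((S + T) * (S + T) +
    ('i *: (S - T)) * ('i *: (S - T))).
  rewrite -bop_scalerAl -bop_scalerAr scalerA mulCii scaleN1r.
  rewrite -[LHS]half_double -scalerDr; congr (_ *: _).
  rewrite mulrBr !mulrBl mulrDr !mulrDl opprB opprD opprK.
  rewrite [X in _ = _ + X]addrC [RHS]addrACA [X in _ = X + _]addrACA subrr add0r.
  by rewrite [X in _ = _ + X]addrACA subrr addr0 [LHS]addrACA addrC.
by apply: posZ => //; apply: posD; exact: pos_sqr.
Qed.

(** Linear growth of powers excludes a > 1. Only exponents 2^n occur because the norm of a power of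
    a self-adjoint operator is obtained by repeated squaring. *)
Lemma pow2_growth (a k : R) : 0 <= a ->
  (forall n, a ^+ (2 ^ n) <= 1 + (2 ^ n)%:R * k) -> a <= 1.
Proof.
move=> a0 h; rewrite leNgt; apply/negP => a1.
have ber n : 1 + n%:R * (a - 1) <= a ^+ n.
  elim: n => [|n ih]; first by rewrite mul0r addr0 expr0.
  rewrite exprS (le_trans _ (ler_wpM2l a0 ih))// -natr1.
  by have := mulr_ge0 (ler0n R n) (sqr_ge0 (a - 1)); lra.
pose d := a - 1; have d0 : 0 < d by rewrite subr_gt0.
(* Bernoulli at m = 2^n, squared, gives a^(2 m) >= m^2 d^2. Once m > M this exceeds m (2 |k| + 1),
   hence also the assumed bound 1 + 2 m k. *)
pose M := (2 * `|k| + 1) / d ^+ 2.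
have [n Mn] : exists n : nat, M < (2 ^ n)%:R.
  exists (Num.truncn M).+1; apply: (lt_le_trans (truncnS_gt M)).
  by rewrite ler_nat ltnW// ltn_expl.
have {h} := h n.+1; rewrite expnS mulnC exprM.
have := ber (2 ^ n)%N; rewrite -/d natrM.
have m1 : 1 <= (2 ^ n)%:R :> R by rewrite ler1n expn_gt0.
set m := _%:R in Mn m1 *; set b := a ^+ _ => mb b2.
have : 2 * `|k| + 1 < m * d ^+ 2 by rewrite -ltr_pdivrMr// exprn_gt0.
have := ler_norm k; have : 0 <= `|k| by [].
have : (m * d) ^+ 2 <= b ^+ 2 by rewrite ler_sqr ?nnegrE; nra.
set K := `|k| => *.
have h1 : m * k <= m * K by apply: ler_wpM2l; lra.
have h2 : m * (2 * K + 1) < m * (m * d ^+ 2) by rewrite ltr_pM2l; lra.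
nra.
Qed.

Lemma rnorm_pow2 T n : adj T T -> rnorm (T ^+ (2 ^ n)) = rnorm T ^+ (2 ^ n) /\
  adj (T ^+ (2 ^ n)) (T ^+ (2 ^ n)).
Proof.
move=> aT; elim: n => [|n [ih1 ih2]]; first by rewrite !expr1.
rewrite expnS mulnC !exprM -ih1 !expr2; split; last exact: adjM.
by rewrite rnorm_sqr_adj.
Qed.

End positive.

(** * Positivity of squares *)

Section positivity_of_squares.
Context {R : realType} {A : cstarAlgType R}.
Implicit Types (S T c g : bop A) (r t : R).

(* With z := 1 - c c' / t of norm at most 1 and v := 1 - c' c / t, the power
   v ^+ n = 1 - c' (\sum_(j < n) z ^+ j) c / t grows at most linearly in n, so
   the self-adjoint v = 1 + g^2 / t has norm at most 1. *)
Lemma pos_swap_eq0 c c' g : adj c c' -> pos (c * c') -> adj g g ->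
  c' * c = - (g * g) -> c = 0.
Proof.
move=> ac [aS [t]]; rewrite le_eqVlt => /orP[/eqP <-|t0] tT ag cg.
  move: tT; rewrite scale0r sub0r rnormN => T0.
  have cc : c * c' = 0 by apply/rnorm0_eq0/le_anti; rewrite T0 rnorm_ge0.
  apply: (adj_eq0 ac); have -> : c' = 0 by exact: (adj_eq0 (adj_sym ac)).
  exact: mul0r.
pose z := 1 - t^-1%:C *: (c * c').
pose v := 1 - t^-1%:C *: (c' * c).
have z1 : rnorm z <= 1.
  rewrite -(ler_pM2l t0) mulr1 -rnormCr ?(ltW t0)// scalerBr scalerCK//.
  by rewrite gt_eqF.
have av : adj v v.
  apply: adjB; first exact: adj1.
  by apply: adjZr; exact: (adjM (adj_sym ac) ac).
have cv : c * v = z * c.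
  rewrite /v /z mulrBr mulrBl mulr1 mul1r -bop_scalerAl -bop_scalerAr.
  by rewrite mulrA.
have vn n : exists2 X : bop A, rnorm X <= n%:R &
    v ^+ n = 1 - t^-1%:C *: (c' * X * c).
  elim: n => [|n [X Xn vX]].
    by exists 0; rewrite ?rnorm0// mulr0 mul0r scaler0 subr0 expr0.
  exists (1 + X * z).
    rewrite (le_trans (ler_rnormD _ _))// -nat1r lerD// ?rnorm_bop1//.
    by rewrite (le_trans (rnorm_bopM _ _))// -[leRHS]mulr1 ler_pM ?rnorm_ge0.
  rewrite exprSr vX mulrBl mul1r -bop_scalerAl -(mulrA (c' * X)) cv.
  rewrite mulrDr mulr1 mulrDl scalerDr opprD addrA -/v.
  by rewrite !mulrA.
have v1 : rnorm v <= 1.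
  apply: (@pow2_growth _ _ (t^-1 * (rnorm c' * rnorm c))); first exact: rnorm_ge0.
  move=> n; rewrite -(rnorm_pow2 n av).1; have [X Xn ->] := vn (2 ^ n)%N.
  rewrite (le_trans (ler_rnormD _ _))// lerD ?rnorm_bop1// rnormN.
  rewrite rnormCr ?invr_ge0 ?(ltW t0)// mulrCA ler_wpM2l ?invr_ge0 ?(ltW t0)//.
  rewrite (le_trans (rnorm_bopM _ _))// mulrA ler_wpM2r ?rnorm_ge0//.
  by rewrite (le_trans (rnorm_bopM _ _))// mulrC ler_wpM2r ?rnorm_ge0.
(* The difference of t and [c' * c], that is of t and [- (g * g)], is [t%:C *: v], of norm at most
   t: this is what [pos] asks of [- (g * g)]. *)
have g0 : g = 0.
  apply: pos_oppsqr_eq0 => //; split; first by apply/adjN/adjM.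
  exists t; first exact: ltW.
  rewrite -cg (_ : _ - _ = t%:C *: v); last first.
    by rewrite scalerBr scalerCK// gt_eqF.
  by rewrite rnormCr ?(ltW t0)// ler_piMr// ltW.
by apply: (adj_eq0 ac); rewrite cg g0 mul0r oppr0.
Qed.

(** Kaplansky's argument. With [e] the root of [h * h], [w = e - h] is twice the negative part of
    [h]. For [c = T * w], its adjoint times [c] is minus the square of [s * w], while the product in
    the other order is a sum of positive terms. Hence [c = 0], so [h * w = 0], and w^2 = - 2 h w
    vanishes. *)
Lemma pos_adjM T T' : adj T T' -> pos (T' * T).
Proof.
move=> aT; set h := T' * T.
have ah : adj h h by exact: (adjM (adj_sym aT) aT).
have [e [pe eh eZ]] := pos_sqrt (pos_sqr ah).
have [s [ps se sZ]] := pos_sqrt pe.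
have he : h * e = e * h by apply: eZ; rewrite mulrA.
have hs : h * s = s * h by exact: sZ.
have es : e * s = s * e by exact: sZ.
pose w := e - h.
have aw : adj w w by apply: adjB => //; exact: pos_adj.
have ws : w * s = s * w by rewrite mulrBl mulrBr hs es.
have ew : e * w = - (h * w) by rewrite !mulrBr eh opprB he.
have hw : h * w = w * h by rewrite mulrBl mulrBr he.
have ag : adj (s * w) (s * w) by rewrite -{2}ws; apply: adjM => //; exact: pos_adj.
have gg : s * w * (s * w) = - (h * w * w).
  by rewrite mulrA -(mulrA s) ws mulrA se ew mulNr.
have ac := adjM aT aw.
have cc : w * T' * (T * w) = - (s * w * (s * w)).
  by rewrite gg opprK hw /h !mulrA.
have c0 : T * w = 0.
  apply: (pos_swap_eq0 ac _ ag cc).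
  have -> : T * w * (w * T') = (T * w * (w * T') + w * T' * (T * w)) + s * w * (s * w).
    by rewrite cc subrK.
  by apply: posD; [exact: pos_adjMD|exact: pos_sqr].
have hw0 : h * w = 0 by rewrite -mulrA c0 mulr0.
have w0 : w = 0.
  by apply: (adj_eq0 aw); rewrite {1}/w mulrBl ew hw0 oppr0 addr0.
by rewrite -[h](subKr e) -/w w0 subr0.
Qed.

(** With commuting roots [X] of [T] and [Y] of t - T, both X + i Y and X - i Y have norm at most
    sqrt t, and so has their mean [X]. *)
Lemma rnorm_pos_le T t : 0 <= t -> pos T -> pos (t%:C *: (1 : bop A) - T) -> rnorm T <= t.
Proof.
move=> t0 pT; have aT := pos_adj pT.
move=> /pos_sqrt[Y [/pos_adj aY YY YZ]].
have [X [/pos_adj aX XX XZ]] := pos_sqrt pT.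
have XY : X * Y = Y * X.
  apply: YZ; rewrite mulrBl mulrBr -bop_scalerAl -bop_scalerAr mulr1 mul1r.
  by rewrite -XX mulrA.
have e : X * X + Y * Y = t%:C *: (1 : bop A) by rewrite XX YY addrC subrK.
have et : rnorm (t%:C *: (1 : bop A)) <= Num.sqrt t ^+ 2.
  by rewrite rnormCr// sqr_sqrtr// ler_piMr// rnorm_bop1.
have ad := adj_ci aX aY.
have h1 : rnorm (X + 'i *: Y) <= Num.sqrt t.
  rewrite -ler_sqr ?nnegrE ?rnorm_ge0 ?sqrtr_ge0// (le_trans (rnorm_adj ad))//.
  by rewrite mul_ci// e.
have h2 : rnorm (X - 'i *: Y) <= Num.sqrt t.
  rewrite -ler_sqr ?nnegrE ?rnorm_ge0 ?sqrtr_ge0// (le_trans (rnorm_adj (adj_sym ad)))//.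
  by rewrite mul_ic// e.
have X1 : rnorm X <= Num.sqrt t.
  have := ler_rnormD (X + 'i *: Y) (X - 'i *: Y).
  rewrite addrACA subrr addr0 -mulr2n -scaler_nat.
  rewrite -(rmorph_nat (real_complex R)) rnormCr//; lra.
rewrite -XX (le_trans (rnorm_bopM _ _))// -[leRHS]sqr_sqrtr// expr2.
by rewrite ler_pM ?rnorm_ge0.
Qed.

Lemma lmul_mem (a : A) : bop_mem (cmul a).
Proof.
apply/asboolP; split=> [c x y|]; first by rewrite cmulDr cmulZr.
by exists (rnorm a) => x; exact: rnorm_cmul.
Qed.

(** The left regular representation brings A into an algebra with unit, where t - a makes sense. It
    is isometric because its norm can be tested on [star a]. *)
Definition lmul (a : A) : bop A := exist (bop_mem (X := A)) _ (lmul_mem a).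

Lemma lmulE (a x : A) : lmul a x = cmul a x. Proof. by []. Qed.

Lemma lmulD (a b : A) : lmul (a + b) = lmul a + lmul b.
Proof. by apply: bop_ext => x; rewrite bop_addE !lmulE cmulDl. Qed.

Lemma lmulZ (c : R[i]) (a : A) : lmul (c *: a) = c *: lmul a.
Proof. by apply: bop_ext => x; rewrite bop_scaleE !lmulE cmulZl. Qed.

Lemma lmulM (a b : A) : lmul (cmul a b) = lmul a * lmul b.
Proof. by apply: bop_ext => x; rewrite bop_mulE !lmulE cmulA. Qed.

Lemma adj_lmul (a : A) : adj (lmul a) (lmul (star a)).
Proof. by move=> x y; rewrite !lmulE starM cmulA. Qed.

Lemma rnorm_lmul (a : A) : rnorm (lmul a) = rnorm a.
Proof.
apply/le_anti/andP; split.
  by rewrite rnorm_bopE; apply: opnorm_lub => [|x]; rewrite ?rnorm_ge0 ?rnorm_cmul.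
have [->|a0] := eqVneq (rnorm a) 0; first exact: rnorm_ge0.
have {}a0 : 0 < rnorm a by rewrite lt_def a0 rnorm_ge0.
rewrite -(ler_pM2r a0) -expr2 -{1}(rnorm_star a) -rnorm_cstar starK.
by rewrite -lmulE (le_trans (rnorm_bop_le _ _))// rnorm_star.
Qed.

Lemma pos_lmul (a : A) : pos (lmul (cmul (star a) a)).
Proof. by rewrite lmulM; exact/pos_adjM/adj_lmul. Qed.

End positivity_of_squares.

(** * The Hahn-Banach theorem *)

Section hahn_banach.
Context {R : realType} {V : lmodType R[i]}.
Implicit Types (p q : V -> R) (x y : V) (r t : R).

Definition sublin p := (forall x y, p (x + y) <= p x + p y) /\
  (forall r x, 0 < r -> p (r%:C *: x) <= r * p x).

Lemma sublin0 p : sublin p -> p 0 = 0.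
Proof.
move=> [_ h]; apply/le_anti/andP; split.
  have := h 2^-1 0; rewrite scaler0 => /(_ _)/wrap[]//; lra.
have := h 2 0; rewrite scaler0 => /(_ _)/wrap[]//; lra.
Qed.

Lemma sublin_ge p x : sublin p -> - p (- x) <= p x.
Proof. by move=> hp; have := hp.1 x (- x); rewrite subrr (sublin0 hp); lra. Qed.

Lemma sublinZ p r x : sublin p -> 0 < r -> p (r%:C *: x) = r * p x.
Proof.
move=> hp r0; apply/le_anti; rewrite hp.2//=.
have := hp.2 r^-1 (r%:C *: x); rewrite invr_gt0 => /(_ r0).
rewrite scalerA -rcM mulVf ?gt_eqF// -[1%:C]/(1 : R[i]) scale1r.
by rewrite ler_pdivlMl.
Qed.

(* A sublinear functional p dominates [shift p y], so a minimal p is additive: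
   p (- y) = shift p y (- y) <= - p y. *)
Let shift p y x := inf [set p (x + t%:C *: y) - t * p y | t in [set t | 0 <= t]].

Let shift_lb p y x t : sublin p -> 0 <= t ->
  - p (- x) <= p (x + t%:C *: y) - t * p y.
Proof.
move=> hp; rewrite le_eqVlt => /orP[/eqP <-|t0].
  by rewrite scale0r addr0 mul0r subr0 sublin_ge.
have := hp.1 (x + t%:C *: y) (- x); rewrite addrC addKr (sublinZ _ hp t0); lra.
Qed.

Let shift_has_inf p y x : sublin p ->
  has_inf [set p (x + t%:C *: y) - t * p y | t in [set t | 0 <= t]].
Proof.
move=> hp; split; first by eexists; exists 0 => //=.
by exists (- p (- x)) => _ [t /= t0 <-]; exact: shift_lb.
Qed.

Let shift_le p y x t : sublin p -> 0 <= t ->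
  shift p y x <= p (x + t%:C *: y) - t * p y.
Proof.
by move=> hp t0; apply: inf_lbound; [have [] := shift_has_inf y x hp | exists t].
Qed.

Let shift_glb p y x b : sublin p ->
  (forall t, 0 <= t -> b <= p (x + t%:C *: y) - t * p y) -> b <= shift p y x.
Proof.
move=> hp h; apply: lb_le_inf => [|_ [t /= t0 <-]]; last exact: h.
by have [] := shift_has_inf y x hp.
Qed.

Let shift_le_id p y x : sublin p -> shift p y x <= p x.
Proof.
by move=> hp; have := shift_le y x hp (lexx 0); rewrite scale0r addr0 mul0r subr0.
Qed.

Let shift_opp p y : sublin p -> shift p y (- y) <= - p y.
Proof.
move=> hp; have := shift_le y (- y) hp ler01.
by rewrite -[1%:C]/(1 : R[i]) scale1r addNr (sublin0 hp) mul1r sub0r.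
Qed.

Let shift_sublin p y : sublin p -> sublin (shift p y).
Proof.
move=> hp; split=> [x x'|r x r0].
  rewrite -lerBlDr; apply: shift_glb => // t t0; rewrite lerBlDr -lerBlDl.
  apply: shift_glb => // t' t'0; rewrite lerBlDl.
  apply: le_trans (shift_le y (x + x') hp (addr_ge0 t0 t'0)) _.
  have := hp.1 (x + t%:C *: y) (x' + t'%:C *: y).
  by rewrite addrACA -scalerDl -rcD; lra.
rewrite -ler_pdivrMl//; apply: shift_glb => // t t0.
rewrite ler_pdivrMl//; apply: le_trans (shift_le y _ hp (mulr_ge0 (ltW r0) t0)) _.
by rewrite rcM -scalerA -scalerDr (sublinZ _ hp r0) mulrBr mulrA.
Qed.

(** A minimal sublinear functional is real-linear. Zorn is started at [shift q h] instead of [q]: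
    its value at [- h] is at most [- q h], which forces equality at [h]. *)
Theorem hahn_banach q h : sublin q -> exists F : V -> R,
  [/\ forall x y, F (x + y) = F x + F y, forall r x, F (r%:C *: x) = r * F x,
   forall x, F x <= q x & F h = q h].
Proof.
move=> hq; pose q' := shift q h.
have hq' : sublin q' by exact: shift_sublin.
pose T := {p : V -> R | sublin p /\ forall x, p x <= q' x}.
(* The order is reversed, so a maximal element for Zorn is a minimal functional. *)
pose Rel (s t : T) := `[< forall x, sval t x <= sval s x >].
have [||||p pmin] := @Zorn T Rel.
- by move=> t; apply/asboolP.
- move=> r s t /asboolP rs /asboolP st; apply/asboolP => x.
  exact: le_trans (st x) (rs x).
- move=> [s hs] [t ht] /asboolP st /asboolP ts; apply: eq_exist => /=.
  by apply/funext => x; apply/le_anti; rewrite st ts.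
- move=> S tot.
  have [[s0 Ss0]|Se] := pselect (exists s, S s); last first.
    exists (exist _ q' (conj hq' (fun=> lexx _))) => s Ss.
    by exfalso; apply: Se; exists s.
  (* The pointwise infimum of a chain is finite because all members dominate [- q' (- x)], and
     subadditive because of two members the smaller one serves for both arguments. *)
  pose P x := inf [set sval s x | s in S].
  have lbd x : has_inf [set sval s x | s in S].
    split; first by exists (sval s0 x), s0.
    exists (- q' (- x)) => _ [s Ss <-]; have [sl sq] := svalP s.
    by apply: le_trans (sublin_ge x sl); rewrite lerN2.
  have Ple x s : S s -> P x <= sval s x.
    by move=> Ss; apply: inf_lbound; [have [] := lbd x | exists s].
  have Pglb x b : (forall s, S s -> b <= sval s x) -> b <= P x.
    move=> hb; apply: lb_le_inf => [|_ [s Ss <-]]; last exact: hb.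
    by have [] := lbd x.
  have hP : sublin P /\ forall x, P x <= q' x.
    split; last by move=> x; apply: le_trans (Ple x s0 Ss0) _; exact: (svalP s0).2.
    split=> [x y|r x r0].
      rewrite -lerBlDr; apply: (Pglb) => s Ss; rewrite lerBlDr -lerBlDl.
      apply: (Pglb) => t St; rewrite lerBlDl.
      have [/asboolP st|/asboolP ts] := tot _ _ Ss St.
        apply: le_trans (Ple _ t St) _; apply: le_trans ((svalP t).1.1 x y) _.
        by rewrite lerD.
      apply: le_trans (Ple _ s Ss) _; apply: le_trans ((svalP s).1.1 x y) _.
      by rewrite lerD.
    rewrite -ler_pdivrMl//; apply: (Pglb) => s Ss; rewrite ler_pdivrMl//.
    by apply: le_trans (Ple _ s Ss) _; exact: (svalP s).1.2.
  exists (exist _ P hP) => s Ss; apply/asboolP => x /=; exact: Ple.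
case: p pmin => p [hp pq'] pmin.
have pN y : p (- y) = - p y.
  have hs := shift_sublin y hp.
  have hsq x : shift p y x <= q' x by apply: le_trans (pq' x); exact: shift_le_id.
  have := pmin (exist _ _ (conj hs hsq)).
  move=> /(_ (asboolT (fun x => shift_le_id y x hp)))/(congr1 sval) /= e.
  apply/le_anti; rewrite -{1}e shift_opp//=.
  by have := sublin_ge y hp; lra.
exists p; split=> [x y|r x|x|].
- apply/le_anti; rewrite hp.1 /=.
  by have := hp.1 (x + y) (- y); rewrite addrK pN; lra.
- have [r0|r0|->] := ltgtP r 0; last by rewrite scale0r mul0r sublin0.
    by rewrite -{1}[r]opprK rcN scaleNr pN sublinZ ?oppr_gt0// mulNr opprK.
  exact: sublinZ.
- by apply: le_trans (pq' x) _; exact: shift_le_id.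
- apply/le_anti; rewrite (le_trans (pq' h)) ?shift_le_id//=.
  by rewrite -lerN2 -pN (le_trans (pq' _))// shift_opp.
Qed.

End hahn_banach.

(** * Positive functionals *)

Section states.
Context {R : realType} {A : cstarAlgType R}.
Implicit Types (a b x y : A) (f : A -> R[i]).

(* The second and third clauses make [(x, y) |-> f (y^* x)] a positive
   semidefinite hermitian form, and by the last one left multiplication by [a]
   is bounded by the norm of [a] in this form. *)
Definition pos_functional f := [/\
  forall c x y, f (c *: x + y) = c * f x + f y,
  forall x, f (star x) = Num.conj (f x),
  forall x, 0 <= f (cmul (star x) x) &
  forall a b, f (cmul (star (cmul a b)) (cmul a b)) <=
    (rnorm a ^+ 2)%:C * f (cmul (star b) b)].

Let re x := 2^-1%:C *: (x + star x).

Let reD x y : re (x + y) = re x + re y.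
Proof. by rewrite /re starD addrACA scalerDr. Qed.

Let reZ (r : R) x : re (r%:C *: x) = r%:C *: re x.
Proof. by rewrite /re starZ conjCr -scalerDr !scalerA mulrC. Qed.

Let re_id x : star x = x -> re x = x.
Proof. by rewrite /re => ->; rewrite scalerDr half_double. Qed.

Let re_star x : star (re x) = re x.
Proof. by rewrite /re starZ conjCr starD starK addrC. Qed.

Let rnorm_re x : rnorm (re x) <= rnorm x.
Proof. by rewrite rnormZ rnormC//; have := ler_rnormD x (star x); rewrite rnorm_star; lra. Qed.

Let above x := [set t : R | 0 <= t /\ pos (t%:C *: (1 : bop A) - lmul (re x))].
Let upper x := inf (above x).

Let above_has_inf x : has_inf (above x).
Proof.
split; last by exists 0 => t [].
exists (rnorm (re x)); split; first exact: rnorm_ge0.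
rewrite -rnorm_lmul; apply: pos_normB.
by have := adj_lmul (re x); rewrite re_star.
Qed.

Let upper_le x t : above x t -> upper x <= t.
Proof. by move=> h; apply: inf_lbound => //; have [] := above_has_inf x. Qed.

Let upper_ge x (l : R) : (forall t, above x t -> l <= t) -> l <= upper x.
Proof. by move=> h; apply: lb_le_inf => //; have [] := above_has_inf x. Qed.

Let upper_norm x : upper x <= rnorm x.
Proof.
apply: le_trans (rnorm_re x); apply: upper_le; split; first exact: rnorm_ge0.
rewrite -rnorm_lmul; apply: pos_normB.
by have := adj_lmul (re x); rewrite re_star.
Qed.

Let upper_sublin : sublin upper.
Proof.
split=> [x y|r x r0].
  rewrite -lerBlDr; apply: upper_ge => t [t0 pt]; rewrite lerBlDr -lerBlDl.
  apply: upper_ge => s [s0 ps]; rewrite lerBlDl; apply: upper_le.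
  split; first exact: addr_ge0.
  rewrite reD lmulD rcD scalerDl opprD addrACA; exact: (posD pt ps).
rewrite -ler_pdivrMl//; apply: upper_ge => t [t0 pt]; rewrite ler_pdivrMl//.
apply: upper_le; split; first by rewrite mulr_ge0// ltW.
by rewrite reZ lmulZ rcM -scalerA -scalerBr; apply: posZ => //; exact: ltW.
Qed.

Let star_sq x : star (cmul (star x) x) = cmul (star x) x.
Proof. by rewrite starM starK. Qed.

Let upper_sq x : upper (- cmul (star x) x) <= 0.
Proof.
apply: upper_le; split=> //; rewrite scale0r sub0r re_id; last first.
  by rewrite -scaleN1r starZ rmorphN rmorph1 star_sq.
rewrite -[X in lmul X]scaleN1r lmulZ scaleN1r opprK; exact: pos_lmul.
Qed.

Let upper_sq_norm x : rnorm (cmul (star x) x) <= upper (cmul (star x) x).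
Proof.
apply: upper_ge => t [t0]; rewrite re_id// -(rnorm_lmul (cmul _ _)) => pt.
by apply: rnorm_pos_le => //; exact: pos_lmul.
Qed.

(** No unit is available as cyclic vector, and [star a] takes its place: the two values are the
    squared lengths of [k] and of [star a] in the resulting form. Norming at the square of [k]
    rather than at [k] makes the first exact; the second is then forced by boundedness of the
    multiplication. *)
Theorem exists_pos_functional a : let k := cmul a (star a) in
  exists f, [/\ pos_functional f, f (cmul (star k) k) = (rnorm a ^+ 4)%:C &
    f k <= (rnorm a ^+ 2)%:C].
Proof.
move=> k.
have [F [FD FZ Fup Fk]] := hahn_banach (cmul (star k) k) upper_sublin.
pose J : R[i] := 0 +i* 1.
have JJ x : J *: (J *: x) = - x.
  rewrite scalerA (_ : J * J = -1) ?scaleN1r//.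
  by apply/eqP; rewrite eq_complex /= !(mulr0, mul0r, mulr1, subr0, addr0, sub0r, oppr0) !eqxx.
have FN x : F (- x) = - F x.
  by have := FZ (-1) x; rewrite rcN -[1%:C]/(1 : R[i]) scaleN1r mulN1r.
(* If [re x = 0], then 0 is admissible in [above x]. Applied to [x] and [- x], this shows that [F]
   sees only the real part and is invariant under [star]. *)
have F0 x : re x = 0 -> F x <= 0.
  move=> x0; apply: le_trans (Fup x) _; apply: upper_le; split=> //.
  have -> : lmul (re x) = 0 by rewrite x0; apply: bop_ext => y; rewrite lmulE cmul0l.
  rewrite scale0r subr0 -(mulr0 (0 : bop A)); apply: pos_sqr; exact: adj0.
have F00 x : re x = 0 -> F x = 0.
  move=> x0; apply/le_anti; rewrite F0//= -oppr_le0 -FN F0//.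
  by rewrite -scaleN1r (_ : -1 = (-1)%:C) ?rcN// -rcN reZ x0 scaler0.
have Fstar x : F (star x) = F x.
  apply/eqP; rewrite -subr_eq0 -FN -FD F00//.
  rewrite /re starD starK -scaleN1r starZ rmorphN rmorph1 !scaleN1r.
  by rewrite -[star x - x]opprB addNr scaler0.
have Jstar x : star (J *: x) = - (J *: star x).
  rewrite starZ (_ : Num.conj J = - J) ?scaleNr//.
  by apply/eqP; rewrite eq_complex /= oppr0 !eqxx.
(* The complexification F(x) - i F(i x), with [J] the imaginary unit. *)
pose f x : R[i] := F x +i* (- F (J *: x)).
have fsq x : f (cmul (star x) x) = (F (cmul (star x) x))%:C.
  rewrite /f (_ : F (J *: _) = 0) ?oppr0//.
  have := Fstar (J *: cmul (star x) x); rewrite Jstar star_sq FN; lra.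
have Fsq x : 0 <= F (cmul (star x) x).
  by rewrite -oppr_le0 -FN (le_trans (Fup _))// upper_sq.
exists f; split; last 2 first.
- rewrite fsq Fk; congr (_%:C); apply/le_anti/andP; split.
    rewrite (le_trans (upper_norm _))// rnorm_cstar -[k]/(cmul a (star a)).
    by rewrite -[X in cmul X]starK rnorm_cstar rnorm_star -exprM.
  rewrite (le_trans _ (upper_sq_norm _))// rnorm_cstar -[k]/(cmul a (star a)).
  by rewrite -[X in cmul X]starK rnorm_cstar rnorm_star -exprM.
- rewrite /k -[X in cmul X]starK fsq lecR (le_trans (Fup _))//.
  by rewrite (le_trans (upper_norm _))// rnorm_cstar rnorm_star.
split.
- move=> [u v] x y.
  have -> : (u +i* v) *: x = u%:C *: x + v%:C *: (J *: x).
    rewrite scalerA -scalerDl; congr (_ *: _).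
    by apply/eqP; rewrite eq_complex /= !(mulr0, mul0r, mulr1, subr0, addr0, sub0r, add0r) !eqxx.
  apply/eqP; rewrite eq_complex /f /= !scalerDr !(scalerA J) ![J * _]mulrC -!scalerA.
  by rewrite JJ !FD !FZ FN; apply/andP; split; apply/eqP; ring.
- move=> x; apply/eqP; rewrite eq_complex /f /= Fstar eqxx /= opprK.
  by have := Fstar (J *: x); rewrite Jstar FN => ->.
- by move=> x; rewrite fsq lecR.
- move=> c b; rewrite !fsq -rcM lecR -subr_ge0.
  (* With [Y] a root of |c|^2 - c^* c, positivity of the functional at the element [Y b] of A is the
     claimed inequality. *)
  have pc : pos ((rnorm c ^+ 2)%:C *: (1 : bop A) - lmul (cmul (star c) c)).
    rewrite -rnorm_cstar -rnorm_lmul; apply: pos_normB.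
    by have := adj_lmul (cmul (star c) c); rewrite star_sq.
  have [Y [/pos_adj aY YY _]] := pos_sqrt pc.
  have := Fsq (Y b); rewrite aY -[Y (Y b)]/((Y * Y : bop A) b) YY.
  rewrite -[X in cmul _ X]/((rnorm c ^+ 2)%:C *: b - cmul (cmul (star c) c) b).
  by rewrite cmulDr cmulZr FD FZ -scaleN1r cmulZr scaleN1r FN starM !cmulA.
Qed.

End states.

(** * Orthonormal chains *)

Section orthonormal_chain.
Context {R : realType} {A : cstarAlgType R} (f : A -> R[i]).
Hypothesis hf : pos_functional f.
Implicit Types (a d v x y z : A) (c : R[i]).

Definition form x y : R[i] := f (cmul (star y) x).

Lemma form_lin c x y z : form (c *: x + y) z = c * form x z + form y z.
Proof. by case: hf => h _ _ _; rewrite /form cmulDr cmulZr h. Qed.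

Lemma form0l z : form 0 z = 0.
Proof. by have := form_lin (-1) 0 0 z; rewrite scaler0 addr0 mulN1r addNr. Qed.

Lemma formD x y z : form (x + y) z = form x z + form y z.
Proof. by have := form_lin 1 x y z; rewrite scale1r mul1r. Qed.

Lemma formZ c x z : form (c *: x) z = c * form x z.
Proof. by have := form_lin c x 0 z; rewrite addr0 form0l addr0. Qed.

Lemma formN x z : form (- x) z = - form x z.
Proof. by rewrite -scaleN1r formZ mulN1r. Qed.

Lemma form_sum n (F : 'I_n -> A) z :
  form (\sum_(k < n) F k) z = \sum_(k < n) form (F k) z.
Proof. by apply: (big_morph (form^~ z)) => [x y|]; [exact: formD|exact: form0l]. Qed.

Lemma formC x y : form y x = Num.conj (form x y).
Proof. by case: hf => _ h _ _; rewrite /form -h starM starK. Qed.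

Lemma form0r z : form z 0 = 0.
Proof. by rewrite formC form0l rmorph0. Qed.

Lemma formZr c x z : form x (c *: z) = Num.conj c * form x z.
Proof. by rewrite [LHS]formC formZ rmorphM [form x z]formC. Qed.

Lemma formDr x y z : form x (y + z) = form x y + form x z.
Proof. by rewrite [LHS]formC formD rmorphD [form x y]formC [form x z]formC. Qed.

Lemma form_ge0 x : 0 <= form x x.
Proof. by case: hf => _ _ h _; exact: h. Qed.

Lemma form_star d x y : form (cmul d x) y = form x (cmul (star d) y).
Proof. by rewrite /form starM starK cmulA. Qed.

Lemma form_le d x : form (cmul d x) (cmul d x) <= (rnorm d ^+ 2)%:C * form x x.
Proof. by case: hf => _ _ _ h; exact: h. Qed.

(** The degenerate case of Cauchy-Schwarz: if [w = form x y] were nonzero, the squared length of y -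
    t w' x, with w' the conjugate of [w], would be affine in t and become negative. *)
Lemma form_null x y : form x x = 0 -> form x y = 0.
Proof.
move=> x0; apply/eqP/negPn/negP => xy0.
pose w := form x y.
have rw0 : rnorm w != 0 by apply: contraNneq xy0 => /rnorm0_eq0/eqP.
have key (t : R) : 0 <= form y y - (2 * t)%:C * (rnorm w ^+ 2)%:C.
  have := form_ge0 ((- t)%:C * Num.conj w *: x + y).
  rewrite form_lin !formDr !formZr x0 mulr0 add0r (formC x y) -/w.
  have -> : Num.conj ((- t)%:C * Num.conj w) = (- t)%:C * w.
    by rewrite rmorphM /= conjCK; congr (_ * _); exact: conjCr.
  have -> : (rnorm w ^+ 2)%:C = w * Num.conj w.
    by rewrite -normCK rnormE expr2 rcM.
  rewrite (_ : 2 * t = t + t) ?rcD ?rcN; last by ring.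
  by move=> h; apply: le_trans h _; rewrite le_eqVlt; apply/orP; left; apply/eqP; ring.
(* This value of [t] makes the expression equal to -1. *)
have := key ((complex.Re (form y y) + 1) / (2 * rnorm w ^+ 2)).
rewrite -rcM lecE /= => /andP[_].
rewrite (_ : 2 * _ * _ = complex.Re (form y y) + 1); first by case: (form y y) => u z /=; lra.
by field.
Qed.

(** Zero entries are allowed so that Gram-Schmidt keeps its indexing when a residual has length
    zero; no independent subsequence has to be selected. *)
Definition orthonormal (e : nat -> A) :=
  (forall n, e n = 0 \/ form (e n) (e n) = 1) /\
  (forall n m, n != m -> form (e n) (e m) = 0).

(* [x] lies in the span of the first [n] vectors of [e], up to a vector of
   length zero *)
Definition in_span (e : nat -> A) n x :=
  forall y, form x y = \sum_(k < n) form x (e k) * form (e k) y.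

(** The recursion is run on the list of the vectors found so far. Since the inverse of 0 is 0, a
    residual of length zero gives [e n = 0]. *)
Lemma gram_schmidt_seq (v : nat -> A) : exists e : nat -> A, forall n,
  let r := v n - \sum_(k < n) form (v n) (e k) *: e k in
  e n = (Num.sqrt (complex.Re (form r r)))^-1%:C *: r.
Proof.
pose step (s : seq A) :=
  let w := v (size s) in
  let r := w - \sum_(k < size s) form w (nth 0 s k) *: nth 0 s k in
  rcons s ((Num.sqrt (complex.Re (form r r)))^-1%:C *: r).
pose es n := iter n step [::].
have es_size n : size (es n) = n by elim: n => //= n ih; rewrite size_rcons ih.
have es_nth n k : (k < n)%N -> nth 0 (es n) k = nth 0 (es k.+1) k.
  elim: n => // n ih; rewrite ltnS leq_eqVlt => /orP[/eqP -> //|kn].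
  by rewrite -(ih kn) /= nth_rcons es_size kn.
exists (fun k => nth 0 (es k.+1) k) => n /=.
rewrite {1}/step nth_rcons es_size ltnn eqxx.
have -> : \sum_(k < n) form (v n) (nth 0 (es n) k) *: nth 0 (es n) k =
  \sum_(k < n) form (v n) (nth 0 (es k.+1) k) *: nth 0 (es k.+1) k.
  by apply: eq_bigr => k _; rewrite es_nth.
by [].
Qed.

Lemma form_re x : form x x = (complex.Re (form x x))%:C.
Proof.
by case: (form x x) (form_ge0 x) => u w; rewrite lecE /= => /andP[/eqP -> _].
Qed.

Lemma form_unit e x : e = 0 \/ form e e = 1 -> form x e * form e e = form x e.
Proof. by move=> [->|->]; rewrite ?form0r ?mulr1 ?mul0r. Qed.

Lemma sqrtV_sqr (u : R) : 0 < u ->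
  (Num.sqrt u)^-1 * ((Num.sqrt u)^-1 * u) = 1.
Proof.
move=> u0; have := sqr_sqrtr (ltW u0); have : Num.sqrt u != 0 by rewrite gt_eqF ?sqrtr_gt0.
by move: (Num.sqrt u) => s s0 <-; field.
Qed.

(** The third clause says, as an induction principle, that [e n] is an actual combination of [v 0],
    ..., [v n], whereas [in_span] speaks only up to vectors of length zero. *)
Lemma gram_schmidt (v : nat -> A) : exists e : nat -> A, [/\ orthonormal e,
  forall n, in_span e n.+1 (v n),
  forall P : A -> Prop, P 0 -> (forall c x y, P x -> P y -> P (c *: x + y)) ->
    forall n, (forall k, (k <= n)%N -> P (v k)) -> P (e n) &
  form (v 0%N) (v 0%N) = 1 -> e 0%N = v 0%N].
Proof.
have [e he] := gram_schmidt_seq v.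
pose r n := v n - \sum_(k < n) form (v n) (e k) *: e k.
have er n : e n = (Num.sqrt (complex.Re (form (r n) (r n))))^-1%:C *: r n := he n.
have e01 n : e n = 0 \/ form (e n) (e n) = 1.
  rewrite er; set u := complex.Re _.
  have u0 : 0 <= u by have := form_ge0 (r n); rewrite form_re lecR.
  have [u1|u1] := eqVneq u 0; first by left; rewrite u1 sqrtr0 invr0 scale0r.
  by right; rewrite formZr formZ form_re -/u conjCr -!rcM sqrtV_sqr// lt_def u1.
have orth m : forall n, (n < m)%N -> form (e m) (e n) = 0.
  elim/ltn_ind: m => m ih n nm; rewrite er formZ.
  suff -> : form (r m) (e n) = 0 by rewrite mulr0.
  rewrite /r formD formN form_sum (bigD1 (Ordinal nm)) //= big1 => [|k kn].
    by rewrite addr0 formZ (@form_unit (e n) _ (e01 n)) subrr.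
  rewrite formZ; have [kn'|] := ltnP k n.
    by rewrite (formC (e n)) ih// rmorph0 mulr0.
  rewrite leq_eqVlt => /orP[/eqP nk|nk].
    by move: kn; rewrite -val_eqE /= nk eqxx.
  by rewrite ih// mulr0.
have orth2 n m : n != m -> form (e n) (e m) = 0.
  rewrite neq_ltn => /orP[nm|mn]; last exact: orth.
  by rewrite formC orth// rmorph0.
have r_orth n k : (k < n)%N -> form (r n) (e k) = 0.
  move=> kn; rewrite /r formD formN form_sum (bigD1 (Ordinal kn)) //= big1 => [|j jk].
    by rewrite addr0 formZ (@form_unit (e k) _ (e01 k)) subrr.
  by rewrite formZ orth2 ?mulr0.
exists e; split=> //.
- move=> n y; have vr : v n = r n + \sum_(k < n) form (v n) (e k) *: e k by rewrite subrK.
  rewrite {1}vr formD form_sum addrC big_ord_recr /=; congr (_ + _).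
    by apply: eq_bigr => k _; rewrite formZ.
  have -> : form (v n) (e n) = form (r n) (e n).
    rewrite {1}vr formD form_sum big1 ?addr0// => k _.
    by rewrite formZ orth2 ?mulr0// neq_ltn ltn_ord.
  rewrite er formZr formZ conjCr; set u := complex.Re _.
  have [u1|u1] := eqVneq u 0.
    by rewrite u1 sqrtr0 invr0 !mul0r form_null// form_re -/u u1.
  have u0 : 0 <= u by have := form_ge0 (r n); rewrite form_re lecR.
  rewrite form_re -/u mulrCA mulrA [X in X * _](_ : _ = 1) ?mul1r//.
  by rewrite -!rcM sqrtV_sqr// lt_def u1.
- move=> P P0 Plin n Pv.
  have : forall m, (m <= n)%N -> P (e m).
    elim/ltn_ind => m ih mn; rewrite er -[_ *: _]addr0; apply: (Plin) => //.
    rewrite /r addrC -[v m]scale1r.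
    have : forall j, (j <= m)%N -> P (\sum_(k < j) form (v m) (e k) *: e k).
      elim=> [|j jh] jm; first by rewrite big_ord0.
      rewrite big_ord_recr /= addrC; apply: (Plin); last by apply: jh; exact: ltnW.
      by apply: (ih) => //; exact: leq_trans (ltnW jm) mn.
    move=> /(_ m (leqnn m)) Ps; rewrite scale1r -scaleN1r; apply: (Plin) => //.
    exact: Pv.
  exact.
- move=> v1; rewrite er; have -> : r 0%N = v 0%N by rewrite /r big_ord0 subr0.
  by rewrite v1 /= sqrtr1 invr1 -[1%:C]/(1 : R[i]) scale1r.
Qed.

Lemma mul_conjC_rnorm (c : R[i]) : c * Num.conj c = (rnorm c ^+ 2)%:C.
Proof. by rewrite -normCK rnormE expr2 rcM. Qed.

Lemma orthonormal_shift e s : orthonormal e -> orthonormal (fun k => e (s + k)%N).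
Proof.
by move=> [h1 h2]; split=> [n|n m nm]; [exact: h1|rewrite h2 ?eqn_add2l].
Qed.

Lemma rc_sum n (F : 'I_n -> R) : (\sum_(k < n) F k)%:C = \sum_(k < n) (F k)%:C.
Proof. by apply: (big_morph (real_complex R)) => // x y; exact: rcD. Qed.

Lemma bessel e n x : orthonormal e ->
  \sum_(k < n) rnorm (form x (e k)) ^+ 2 <= complex.Re (form x x).
Proof.
move=> [e01 eo]; pose r := x - \sum_(k < n) form x (e k) *: e k.
have r_orth (k : 'I_n) : form r (e k) = 0.
  rewrite /r formD formN form_sum (bigD1 k) //= big1 => [|j jk].
    by rewrite addr0 formZ (@form_unit (e k) _ (e01 k)) subrr.
  by rewrite formZ eo ?mulr0.
have rx : form r x = form r r.
  have xr : x = r + \sum_(k < n) form x (e k) *: e k by rewrite subrK.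
  rewrite [in LHS]xr formDr.
  rewrite [X in _ + X]formC form_sum big1 ?rmorph0 ?addr0// => k _.
  by rewrite formZ (formC r (e k)) r_orth rmorph0 mulr0.
rewrite -lecR -form_re -subr_ge0; have := form_ge0 r; rewrite -rx.
rewrite /r formD formN form_sum rc_sum; congr (_ <= _ - _).
apply: eq_bigr => k _; rewrite formZ -mul_conjC_rnorm; congr (_ * _).
exact: formC.
Qed.

Lemma in_span_orth e n k x : orthonormal e -> in_span e n x -> (n <= k)%N ->
  form x (e k) = 0.
Proof.
move=> [_ eo] sx nk; rewrite sx big1// => j _; rewrite eo ?mulr0//.
by rewrite neq_ltn (leq_trans (ltn_ord j) nk).
Qed.

Lemma in_span_le e n m x : orthonormal e -> in_span e n x -> (n <= m)%N ->
  in_span e m x.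
Proof.
move=> oe sx /subnK <-; elim: (m - n)%N => // k ih y.
rewrite addSn big_ord_recr /= -ih (in_span_orth oe sx) ?leq_addl//.
by rewrite mul0r addr0.
Qed.

Lemma in_span0 e n : in_span e n 0.
Proof. by move=> y; rewrite form0l big1// => k _; rewrite form0l mul0r. Qed.

Lemma in_span_lin e n c x y : in_span e n x -> in_span e n y ->
  in_span e n (c *: x + y).
Proof.
move=> sx sy z; rewrite form_lin sx sy mulr_sumr -big_split /=.
by apply: eq_bigr => k _; rewrite form_lin mulrDl mulrA.
Qed.

Lemma parseval e n x : in_span e n x ->
  complex.Re (form x x) = \sum_(k < n) rnorm (form x (e k)) ^+ 2.
Proof.
move=> sx; apply: (@complexI R); rewrite -form_re sx rc_sum; apply: eq_bigr => k _.
by rewrite -mul_conjC_rnorm; congr (_ * _); exact: formC.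
Qed.

Lemma form_comb_le e n (c : 'I_n -> R[i]) : orthonormal e ->
  complex.Re (form (\sum_(k < n) c k *: e k) (\sum_(k < n) c k *: e k)) <=
  \sum_(k < n) rnorm (c k) ^+ 2.
Proof.
move=> [e01 eo]; rewrite -lecR -form_re form_sum rc_sum; apply: ler_sum => k _.
rewrite formZ [form (e k) _]formC form_sum (bigD1 k) //= big1 => [|j jk].
  rewrite addr0 formZ rmorphM mulrA mul_conjC_rnorm.
  rewrite -[leRHS]mulr1 ler_wpM2l ?lecR ?sqr_ge0//.
  by case: (e01 k) => ->; rewrite ?form0l ?rmorph0 ?rmorph1// lecR ler01.
by rewrite formZ eo ?mulr0// eq_sym.
Qed.

(** The matrix is a compression of left multiplication by [d]: synthesis from [e'] and coefficients
    along [e] are contractions, and [form_le] supplies the norm of [d]. *)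
Lemma block_bound e e' m n d (c : 'I_n -> R[i]) : orthonormal e -> orthonormal e' ->
  \sum_(k < m) rnorm (\sum_(l < n) form (cmul d (e' l)) (e k) * c l) ^+ 2 <=
  rnorm d ^+ 2 * \sum_(l < n) rnorm (c l) ^+ 2.
Proof.
move=> oe oe'; pose x := \sum_(l < n) c l *: e' l.
have dx y : form (cmul d x) y = \sum_(l < n) form (cmul d (e' l)) y * c l.
  rewrite form_star form_sum; apply: eq_bigr => l _.
  by rewrite formZ -form_star mulrC.
rewrite (eq_bigr (fun k : 'I_m => rnorm (form (cmul d x) (e k)) ^+ 2)); last first.
  by move=> k _; rewrite dx.
apply: le_trans (bessel m (cmul d x) oe) _.
apply: le_trans (_ : _ <= rnorm d ^+ 2 * complex.Re (form x x)) _.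
  by rewrite -lecR rcM -!form_re; exact: form_le.
by rewrite ler_wpM2l ?sqr_ge0//; exact: form_comb_le.
Qed.

(** The vectors [v] are all words in [D] applied to [xi], so each [D k] maps them to each other or
    to 0, and [D k] applied to [e m] lies in a finite span. [N j.+1] is placed past all spans needed
    by [D 0], ..., [D (i + j)] on the first [N j] vectors. Given [k], only finitely many pairs (i,
    j) violate [k <= i + j]. *)
Lemma orthonormal_chain (D : nat -> A) (i : nat) (xi : A) :
  exists (e : nat -> A) (N : nat -> nat),
  [/\ N 0%N = 0%N, N 1%N = 1%N & forall j, (N j < N j.+1)%N] /\
  [/\ orthonormal e, form xi xi = 1 -> e 0%N = xi & forall j k m, (k <= i + j)%N -> (m < N j)%N ->
    in_span e (N j.+1) (cmul (D k) (e m))].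
Proof.
pose wv (w : option (seq nat)) :=
  if w is Some w then foldr (fun k x => cmul (D k) x) xi w else 0.
pose v n := if n is n'.+1 then wv (unpickle n') else xi.
have [e [oe ve Pe e0]] := gram_schmidt v.
have vD k n : exists n', cmul (D k) (v n) = v n' \/ cmul (D k) (v n) = 0.
  case: n => [|n]; first by exists (pickle [:: k]).+1; left; rewrite /v pickleK.
  rewrite -[v n.+1]/(wv (unpickle n)).
  case: (unpickle n) => [w|]; last by exists 0%N; right; rewrite cmul0r.
  by exists (pickle (k :: w)).+1; left; rewrite /v pickleK.
have De k m : exists n', in_span e n' (cmul (D k) (e m)).
  have [g hg] := choice (vD k).
  pose M := (\sum_(l < m.+1) (g l).+1)%N; exists M.
  apply: (Pe (fun x => in_span e M (cmul (D k) x))).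
  - by rewrite cmul0r; exact: in_span0.
  - by move=> c x y sx sy; rewrite cmulDr cmulZr; exact: in_span_lin.
  - move=> l lm; have [->|->] := hg l; last exact: in_span0.
    apply: (in_span_le oe (ve _)); rewrite /M.
    by rewrite (bigD1 (Ordinal (lm : (l < m.+1)%N))) //= leq_addr.
have [g hg] := choice (fun km : nat * nat => De km.1 km.2).
(* The summand 1 makes [N] strictly increasing. At [N 0 = 0] the double sum vanishes, so [N 1 = 1]
   and the first block consists of [e 0] alone. *)
pose nx j n := (n + 1 + \sum_(k < (i + j).+1) \sum_(m < n) g (k : nat, m : nat))%N.
pose N := fix N j := if j is j'.+1 then nx j' (N j') else 0%N.
exists e, N; split; split=> //.
- by rewrite /= /nx big1 // => k _; rewrite big_ord0.
- by move=> j; rewrite /= /nx addn1 addSn ltnS leq_addr.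
- move=> j k m kij mN; apply: (in_span_le oe (hg (k, m))); apply: leq_trans (leq_addl _ _).
  rewrite (bigD1 (Ordinal (kij : (k < (i + j).+1)%N))) //= (bigD1 (Ordinal mN)) //=.
  by rewrite -addnA leq_addr.
Qed.

End orthonormal_chain.

(** * The block matrices *)

Lemma injective_eventually_ge (g : nat -> nat) : injective g ->
  forall N, exists Q, forall q, (Q <= q)%N -> (N <= g q)%N.
Proof.
move=> gi; elim=> [|N [Q hQ]]; first by exists 0%N.
have [[q0 gq0]|h] := pselect (exists q, g q = N).
  exists (maxn Q q0.+1) => q; rewrite geq_max => /andP[Qq q0q].
  rewrite ltn_neqAle hQ// andbT -gq0; apply: contraTneq q0q => /gi ->.
  by rewrite ltnn.
exists Q => q /hQ Ng; rewrite ltn_neqAle Ng andbT.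
by apply/eqP => Nq; apply: h; exists q.
Qed.

Definition sqnorm (R : realType) n (c : 'cV[R[i]]_n) : R :=
  \sum_(k < n) rnorm (c k 0) ^+ 2.

Lemma sqnorm0 (R : realType) n : sqnorm (0 : 'cV[R[i]]_n) = 0.
Proof. by rewrite /sqnorm big1// => k _; rewrite mxE rnorm0 expr0n. Qed.

Section block_system.
Context {R : realType} {A : cstarAlgType R}.
Implicit Types (a : A) (b i j : nat).

Lemma exists_unit_vector a : exists (f : A -> R[i]) (xi : A),
  pos_functional f /\ (a != 0 -> form f xi xi = 1 /\
    form f (cmul a xi) (cmul a xi) = (rnorm a ^+ 2)%:C).
Proof.
have [f [hf fkk fk]] := exists_pos_functional a.
exists f, ((rnorm a)^-1%:C *: star a); split=> // a0.
have na : rnorm a != 0 by apply: contra_neq a0 => /rnorm0_eq0.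
have na0 : 0 < rnorm a by rewrite lt_def na rnorm_ge0.
have -> : cmul a ((rnorm a)^-1%:C *: star a) = (rnorm a)^-1%:C *: cmul a (star a).
  exact: cmulZr.
rewrite !formZr// !formZ// !conjCr; split; last first.
  by rewrite /form fkk -!rcM; congr (_%:C); field.
(* The missing lower bound: |a|^4, the value of [f] at the square of k = a a^*, is at most |a|^2
   f(k). *)
have -> : form f (star a) (star a) = (rnorm a ^+ 2)%:C.
  apply/le_anti; rewrite {1}/form starK fk /=.
  have := form_le hf a (star a); rewrite {1}/form fkk -[4%N]/(2 + 2)%N exprD rcM.
  by rewrite ler_pM2l// ltcR exprn_gt0.
by rewrite -!rcM -[1]/(1%:C); congr (_%:C); field.
Qed.

Let nbj j := if j is j'.+1 then [:: j'; j; j.+1] else [:: 0%N; 1%N].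

Let nbjC j j' : (j \in nbj j') = (j' \in nbj j).
Proof.
by case: j => [|j]; case: j' => [|j']; rewrite !inE; apply/idP/idP; lia.
Qed.

(* Block [pickle (i, j)] is the [j]-th block of the [i]-th representation. *)
Definition blk_code b : option (nat * nat) := pickle_inv b.

Definition nbr b : seq nat :=
  if blk_code b is Some (i, j) then [seq pickle (i, j') | j' <- nbj j] else [::].

Let codeK (x : nat * nat) : blk_code (pickle x) = Some x.
Proof. exact: pickleK_inv. Qed.

Let codeP b x : blk_code b = Some x -> b = pickle x.
Proof. by move=> E; have := @pickle_invK (nat * nat)%type b; rewrite /oapp -/(blk_code b) E. Qed.

Lemma nbrP b b' : b' \in nbr b -> exists i j j',
  [/\ b = pickle (i, j), b' = pickle (i, j') & j' \in nbj j].
Proof.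
rewrite /nbr; case E: (blk_code b) => [[i j]|//] /mapP[j' jj ->]; exists i, j, j'.
by split=> //; exact: codeP.
Qed.

Lemma nbr_pickle i j j' : (pickle (i, j') \in nbr (pickle (i, j))) = (j' \in nbj j).
Proof.
rewrite /nbr codeK; apply/mapP/idP => [[k kj /(pcan_inj pickleK_inv)[->]//]|h].
by exists j'.
Qed.

Lemma nbrC b b' : (b' \in nbr b) = (b \in nbr b').
Proof.
by apply/idP/idP => /nbrP[i [j [j' [-> -> h]]]]; rewrite nbr_pickle nbjC.
Qed.

Lemma size_nbr b : (size (nbr b) <= 3)%N.
Proof. by rewrite /nbr; case: blk_code => // -[i [|j]]. Qed.

Lemma uniq_nbr b : uniq (nbr b).
Proof.
rewrite /nbr; case: blk_code => // -[i j]; rewrite map_inj_uniq.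
  by case: j => [|j] //; rewrite /= !inE; lia.
by move=> x y /(pcan_inj pickleK_inv) [].
Qed.

(** Neighbouring blocks and everything before them form an initial segment, so a sum over neighbours
    is a full orthonormal expansion once the earlier terms vanish. For j = 0 that condition is
    empty. *)
Let sum_nbj (V : nmodType) (N : nat -> nat) (G : nat -> V) j :
  (forall k, (N k <= N k.+1)%N) -> N 0%N = 0%N ->
  (forall l, (l < N j.-1)%N -> G l = 0) ->
  \sum_(j' <- nbj j) \sum_(t < N j'.+1 - N j') G (N j' + t)%N =
  \sum_(l < N j.+2) G l.
Proof.
move=> Nle N0 G0.
have step k : \sum_(l < N k.+1) G l =
    \sum_(l < N k) G l + \sum_(t < N k.+1 - N k) G (N k + t)%N.
  rewrite -(big_mkord predT G) (big_cat_nat (n := N k)) //=; congr (_ + _).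
    by rewrite big_mkord.
  by rewrite -{1}[N k]add0n big_addn big_mkord; apply: eq_bigr => t _; rewrite addnC.
case: j G0 => [|j] G0.
  by rewrite /= !big_cons big_nil addr0 !step N0 big_ord0 add0r.
rewrite /= !big_cons big_nil addr0 !step [X in _ = X + _ + _ + _]big1 ?add0r ?addrA//.
by move=> l _; apply: G0.
Qed.

(** The matrices [al] are untruncated compressions, zero between different representations; the
    truncation is made later, through [nbr]. Linearity and the norm bound hold on all of A; the
    claims about far blocks are for [S] alone. *)
Theorem block_system : separable A ->
  exists (m : nat -> nat) (S : set A) (al : forall b b', A -> 'M[R[i]]_(m b, m b')),
  dense S /\ [/\
    forall b b' c x y, al b b' (c *: x + y) = c *: al b b' x + al b b' y,
    forall b b' a c, sqnorm (al b b' a *m c) <= rnorm a ^+ 2 * sqnorm c,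
    forall x y, S x -> S y -> exists B, forall b'' b, (B <= b'')%N ->
      [/\ b \notin nbr b'' -> al b b'' x = 0,
        b \notin nbr b'' -> al b b'' (cmul x y) = 0 &
        al b b'' (cmul x y) = \sum_(b' <- nbr b'') al b b' x *m al b' b'' y] &
    forall x, S x -> x != 0 -> forall B, exists b, (B <= b)%N /\
      exists c, sqnorm c <= 1 /\ exists2 b', b' \in nbr b &
        rnorm x ^+ 2 <= 2 * sqnorm (al b' b x *m c)].
Proof.
case=> S cS dS.
have [d0 Sd0] : exists d0 : nat -> A, forall x, S x -> exists k, x = d0 k.
  have [g gi] := countable_injP _ cS.
  have /choice[d0 hd0] : forall n, exists x : A, forall y, S y -> g y = n -> x = y.
    move=> n; have [[x [Sx gx]]|h] := pselect (exists x, S x /\ g x = n).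
      by exists x => y Sy gy; apply: gi; rewrite ?inE// gy.
    by exists 0 => y Sy gy; exfalso; apply: h; exists y.
  by exists d0 => x Sx; exists (g x); rewrite (hd0 _ x).
(* The steering list: the dense sequence, its pairwise products, and the adjoints of both. *)
pose wd (p : bool * bool * nat * nat) : A :=
  let: (s1, s2, k, l) := p in
  let x := if s2 then cmul (d0 k) (d0 l) else d0 k in
  if s1 then star x else x.
pose D n : A := if unpickle n is Some p then wd p else 0.
have Dwd p : D (pickle p) = wd p by rewrite /D pickleK.
(* Representation [i] is made for [d0 (sg i)]; the free second component lets every index occur
   infinitely often. *)
pose sg i : nat := if unpickle i is Some p then (p : nat * nat).1 else 0%N.
have /choice[fx hfx] : forall i, exists fx : (A -> R[i]) * A,
    pos_functional fx.1 /\ (d0 (sg i) != 0 -> form fx.1 fx.2 fx.2 = 1 /\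
    form fx.1 (cmul (d0 (sg i)) fx.2) (cmul (d0 (sg i)) fx.2) = (rnorm (d0 (sg i)) ^+ 2)%:C).
  by move=> i; have [f [xi h]] := exists_unit_vector (d0 (sg i)); exists (f, xi).
have /choice[eN heN] : forall i, exists eN : (nat -> A) * (nat -> nat),
  [/\ eN.2 0%N = 0%N, eN.2 1%N = 1%N & forall j, (eN.2 j < eN.2 j.+1)%N] /\
  [/\ orthonormal (fx i).1 eN.1, form (fx i).1 (fx i).2 (fx i).2 = 1 -> eN.1 0%N = (fx i).2 &
    forall j k m, (k <= i + j)%N -> (m < eN.2 j)%N ->
    in_span (fx i).1 eN.1 (eN.2 j.+1) (cmul (D k) (eN.1 m))].
  move=> i; have [e [N h]] := orthonormal_chain (hfx i).1 D i (fx i).2.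
  by exists (e, N).
pose f i := (fx i).1; pose xi i := (fx i).2; pose e i := (eN i).1; pose N i := (eN i).2.
have hf i : pos_functional (f i) := (hfx i).1.
have N0 i : N i 0%N = 0%N by have [[]] := heN i.
have N1 i : N i 1%N = 1%N by have [[]] := heN i.
have Nlt i j : (N i j < N i j.+1)%N by have [[_ _ ->]] := heN i.
have oe i : orthonormal (f i) (e i) by have [_ []] := heN i.
have De i j k m : (k <= i + j)%N -> (m < N i j)%N ->
    in_span (f i) (e i) (N i j.+1) (cmul (D k) (e i m)).
  by have [_ [_ _ h]] := heN i; exact: h.
have Nmono i j k : (j <= k)%N -> (N i j <= N i k)%N.
  move=> /subnK <-; elim: (k - j)%N => // n ih.
  by rewrite addSn (leq_trans ih)// ltnW.
pose m b := if blk_code b is Some (i, j) then (N i j.+1 - N i j)%N else 0%N.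
have mE i j : m (pickle (i, j)) = (N i j.+1 - N i j)%N by rewrite /m codeK.
pose ent b b' (k l : nat) x : R[i] :=
  if blk_code b is Some (i, j) then if blk_code b' is Some (i', j') then
    if i == i' then form (f i) (cmul x (e i (N i j' + l)%N)) (e i (N i j + k)%N) else 0
  else 0 else 0.
have entE i j j' k l x : ent (pickle (i, j)) (pickle (i, j')) k l x =
    form (f i) (cmul x (e i (N i j' + l)%N)) (e i (N i j + k)%N).
  by rewrite /ent !codeK eqxx.
pose al b b' x : 'M[R[i]]_(m b, m b') := \matrix_(k, l) ent b b' k l x.
exists m, S, al; split=> //; split.
- move=> b b' c x y; apply/matrixP => k l; rewrite !mxE /ent.
  case: blk_code => [[i j]|]; last by rewrite mulr0 addr0.
  case: blk_code => [[i' j']|]; last by rewrite mulr0 addr0.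
  case: eqP => _; last by rewrite mulr0 addr0.
  by rewrite cmulDl cmulZl form_lin.
- move=> b b' a c.
  have al0 : (forall k l, ent b b' k l a = 0) ->
      sqnorm (al b b' a *m c) <= rnorm a ^+ 2 * sqnorm c.
    move=> h; rewrite (_ : al b b' a = 0) ?mul0mx ?sqnorm0.
      by rewrite mulr_ge0 ?sqr_ge0// sumr_ge0// => k _; rewrite sqr_ge0.
    by apply/matrixP => k l; rewrite !mxE h.
  case E : (blk_code b) => [[i j]|]; last by apply: al0 => k l; rewrite /ent E.
  case E' : (blk_code b') => [[i' j']|]; last by apply: al0 => k l; rewrite /ent E E'.
  have [ii|ii] := eqVneq i i'; last by apply: al0 => k l; rewrite /ent E E' (negbTE ii).
  have := block_bound (hf i) (m b) a (fun l => c l 0) (orthonormal_shift (N i j) (oe i))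
    (orthonormal_shift (N i j') (oe i)).
  congr (_ <= _); apply: eq_bigr => k _.
  congr (rnorm _ ^+ 2); rewrite mxE; apply: eq_bigr => l _.
  by rewrite mxE /ent E E' -ii eqxx.
(* [x] raises the block index by at most one. So does its adjoint, and the hermitian symmetry of the
   form turns this into a bound on descent. *)
- have loc x k k' : x = D k -> star x = D k' -> forall i j j' r t,
      (k < i + j')%N -> (k' < i + j')%N -> j \notin nbj j' ->
      (r < N i j.+1 - N i j)%N -> (t < N i j'.+1 - N i j')%N ->
      form (f i) (cmul x (e i (N i j' + t)%N)) (e i (N i j + r)%N) = 0.
    move=> xk xk' i j j' r t kij kij' jj' rN tN.
    have [jj|jj] : (j'.+2 <= j)%N \/ (j.+2 <= j')%N.
      by case: j' jj' {kij kij' tN} => [|j']; rewrite !inE; lia.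
      apply: (in_span_orth (oe i) (n := N i j'.+2)).
        by rewrite xk; apply: De; [lia | rewrite -ltn_subRL].
      by rewrite (leq_trans (Nmono _ _ _ jj)) ?leq_addr.
    rewrite form_star// formC// xk'.
    case: j' kij kij' jj' tN jj => // j' kij kij' jj' tN jj.
    rewrite (in_span_orth (oe i) (n := N i j'.+1)) ?rmorph0 ?leq_addr//.
    apply: De; first by lia.
    by rewrite (leq_trans _ (Nmono _ _ _ (jj : (j.+1 <= j')%N)))// -ltn_subRL.
  move=> x y /Sd0[k ->] /Sd0[l ->].
  pose idx s1 s2 k l := pickle (s1 : bool, s2 : bool, k : nat, l : nat).
  have bnd (q1 q2 q3 q4 q5 q6 : nat) : exists K, [/\ (q1 <= K)%N, (q2 <= K)%N,
      (q3 <= K)%N, (q4 <= K)%N & (q5 <= K)%N /\ (q6 <= K)%N].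
    by exists (q1 + q2 + q3 + q4 + q5 + q6)%N; split; lia.
  have [K [K1 K2 K3 K4 [K5 K6]]] := bnd (idx false false k 0%N) (idx true false k 0%N)
    (idx false true k l) (idx true true k l) (idx false false l 0%N) (idx true false l 0%N).
  (* Only finitely many pairs have [i + j <= K], and [B] exceeds all their codes. *)
  have [B hB] : exists B, forall i j, (B <= pickle (i, j))%N -> (K < i + j)%N.
    exists (\sum_(i < K.+1) \sum_(j < K.+1) (pickle (i : nat, j : nat)).+1)%N => i j.
    rewrite leqNgt; apply: contraNltn => ijK.
    have iK : (i < K.+1)%N by lia.
    have jK : (j < K.+1)%N by lia.
    by rewrite (bigD1 (Ordinal iK)) //= (bigD1 (Ordinal jK)) //= -addnA ltnS leq_addr.
  exists B => b'' b Bb.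
  have al0 b0 z : (forall u v, ent b0 b'' u v z = 0) -> al b0 b'' z = 0.
    by move=> h; apply/matrixP => u v; rewrite !mxE h.
  case E'' : (blk_code b'') => [[i j'']|]; last first.
    have h b0 z : al b0 b'' z = 0.
      by apply: al0 => u v; rewrite /ent E''; case: blk_code => // -[].
    by rewrite !h /nbr E'' big_nil.
  have {E''} Eb := codeP E''; subst b''; have {Bb} Kij := hB _ _ Bb.
  (* If [b] is no block of representation [i], all entries involved vanish and the three claims are
     trivial; the other branch makes [b] the code of a pair (i, j). *)
  have [h|] := pselect (forall b' u v z, b' \in pickle (i, j'') :: nbr (pickle (i, j'')) -> ent b b' u v z = 0).
    rewrite !al0; last 2 first.
    - by move=> u v; apply: h; rewrite mem_head.
    - by move=> u v; apply: h; rewrite mem_head.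
    rewrite big_seq big1// => b' hb'.
    rewrite (_ : al b b' _ = 0) ?mul0mx//; apply/matrixP => u v; rewrite !mxE h//.
    by rewrite inE hb' orbT.
  case E : (blk_code b) => [[i' j]|]; last first.
    by move=> []; move=> b' u v z _; rewrite /ent E.
  have Eb := codeP E; subst b; have [ii|ii] := eqVneq i' i; last first.
    move=> []; move=> b' u v z; rewrite inE => /orP[/eqP ->|/nbrP[i2 [j2 [j3 []]]]].
      by rewrite /ent !codeK (negbTE ii).
    move=> /(pcan_inj pickleK_inv)[<- _] -> _.
    by rewrite /ent !codeK (negbTE ii).
  move=> _; subst i'; rewrite nbr_pickle.
  have locb z (k1 k2 : nat) : z = D k1 -> star z = D k2 -> (k1 <= K)%N -> (k2 <= K)%N ->
      j \notin nbj j'' -> al (pickle (i, j)) (pickle (i, j'')) z = 0.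
    move=> zk1 zk2 kK1 kK2 jj; apply/matrixP => u v; rewrite !mxE entE.
    apply: (loc _ _ _ zk1 zk2) => //.
    - by lia.
    - by lia.
    - by rewrite -mE.
    - by rewrite -mE.
  split.
  - by apply: (locb _ (idx false false k 0) (idx true false k 0%N)); rewrite ?Dwd.
  - by apply: (locb _ (idx false true k l) (idx true true k l)); rewrite ?Dwd.
  apply/matrixP => u v; rewrite !mxE entE summxE /nbr codeK big_map.
  have vN : (N i j'' + v < N i j''.+1)%N by rewrite -ltn_subRL -mE.
  have uN : (u < N i j.+1 - N i j)%N by rewrite -mE.
  have sp : in_span (f i) (e i) (N i j''.+2) (cmul (d0 l) (e i (N i j'' + v)%N)).
    by have := De i j''.+1 (idx false false l 0%N) _ _ vN; rewrite Dwd; apply; lia.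
  (* The image of a vector of block j'' under y is expanded in the vectors up to block j'' + 1.
     Those before block j'' - 1 contribute nothing, since the adjoint of y climbs only one block,
     and the neighbours of j'' remain. *)
  rewrite -cmulA form_star// sp.
  pose G t := form (f i) (cmul (d0 k) (e i t)) (e i (N i j + u)%N) *
    form (f i) (cmul (d0 l) (e i (N i j'' + v)%N)) (e i t).
  rewrite (eq_bigr (fun t : 'I_(N i j''.+2) => G t)); last first.
    by move=> t _; rewrite /G -form_star// mulrC.
  rewrite -(sum_nbj (N := N i))//; last 2 first.
  - by move=> q; exact: ltnW.
  - move=> t tN; rewrite /G [X in _ * X](_ : _ = 0) ?mulr0//.
    rewrite form_star// formC//.
    have j0 : (0 < j'')%N by rewrite lt0n; apply: contraTneq tN => ->; rewrite N0.
    rewrite (in_span_orth (oe i) (n := N i j''.-1.+1)) ?rmorph0//; last first.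
      by rewrite prednK// leq_addr.
    by have := De i j''.-1 (idx true false l 0%N) t; rewrite Dwd; apply => //; lia.
  apply: eq_bigr => j' _; rewrite mxE -[in LHS]mE; apply: eq_bigr => t _.
  by rewrite !mxE !entE.
- move=> x /Sd0[k ->] x0 B.
  pose ch q := pickle (k : nat, q : nat).
  have ch_inj : injective ch by move=> q q' /(pcan_inj pickleK_inv)[].
  have ch0_inj : injective (fun q => pickle (ch q, 0%N)).
    by move=> q q' /(pcan_inj pickleK_inv)[/ch_inj].
  have [Q1 hQ1] := injective_eventually_ge ch_inj (pickle (false, false, k, 0%N)).
  have [Q2 hQ2] := injective_eventually_ge ch0_inj B.
  (* A large second component puts the block beyond [B], and [i] beyond the list index of [d0 k]. *)
  pose i := ch (Q1 + Q2)%N.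
  have hi : (pickle (false, false, k, 0%N) <= i)%N by apply: hQ1; lia.
  have sgi : sg i = k by rewrite /sg /i /ch pickleK.
  exists (pickle (i, 0%N)); split; first by apply: hQ2; lia.
  have m1 : m (pickle (i, 0%N)) = 1%N by rewrite mE N1 N0.
  (* Block 0 is one-dimensional, spanned by the unit vector [xi i]. *)
  exists (const_mx 1); split.
    rewrite /sqnorm (eq_bigr (fun=> 1)) => [|? _]; last by rewrite mxE /rnorm normr1 expr1n.
    by rewrite sumr_const card_ord m1.
  have := (hfx i).2; rewrite sgi => /(_ x0) [xi1 axi].
  have e0 : e i 0%N = xi i by have [_ [_ h _]] := heN i; exact: h.
  have alE j' u : (al (pickle (i, j')) (pickle (i, 0%N)) (d0 k) *m const_mx 1) u 0 =
      form (f i) (cmul (d0 k) (xi i)) (e i (N i j' + u)%N).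
    rewrite mxE (eq_bigr (fun l : 'I_(m (pickle (i, 0%N))) =>
      form (f i) (cmul (d0 k) (e i l)) (e i (N i j' + u)%N))) => [|l _].
      by rewrite m1 big_ord1 e0.
    by rewrite !mxE mulr1 entE N0.
  have sp : in_span (f i) (e i) (N i 2%N) (cmul (d0 k) (xi i)).
    by have := De i 1%N (pickle (false, false, k, 0%N)) 0%N; rewrite Dwd e0 N1; apply; lia.
  have := parseval (hf i) sp; rewrite axi /=.
  pose G t := rnorm (form (f i) (cmul (d0 k) (xi i)) (e i t)) ^+ 2.
  rewrite -[RHS]/(\sum_(t < N i 2%N) G t) -(sum_nbj (N := N i))//; last 2 first.
  - by move=> q; exact: ltnW.
  - by move=> q; rewrite N0.
  have sq j' : \sum_(t < N i j'.+1 - N i j') G (N i j' + t)%N =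
    sqnorm (al (pickle (i, j')) (pickle (i, 0%N)) (d0 k) *m const_mx 1).
    by rewrite -mE /sqnorm; apply: eq_bigr => t _; rewrite alE.
  rewrite /= !big_cons big_nil !sq addr0 => hs.
  (* The image of [xi i] is spread over blocks 0 and 1, and one of them carries at least half of its
     squared length: hence the factor 2. *)
  have [h|h] := lerP (rnorm (d0 k) ^+ 2)
    (2 * sqnorm (al (pickle (i, 0%N)) (pickle (i, 0%N)) (d0 k) *m const_mx 1)).
    by exists (pickle (i, 0%N)) => //; rewrite nbr_pickle.
  by exists (pickle (i, 1%N)); [rewrite nbr_pickle | lra].
Qed.

End block_system.

(** * Rademacher sums *)

Section rademacher.
Context {R : realType}.
Implicit Types (p q t y : R) (m : nat).

Let expR_le y : `|y| <= 2^-1 -> expR y <= 1 + y + 2 * y ^+ 2.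
Proof.
rewrite ler_norml => /andP[y1 y2].
have h : expR y * (1 - y) <= 1.
  by have := ler_wpM2l (expR_ge0 y) (expR_ge1Dx (- y)); rewrite expRxMexpNx_1.
have y3 : 0 <= y ^+ 2 * (1 - 2 * y) by apply: mulr_ge0; [exact: sqr_ge0|lra].
have y4 : 0 < 1 - y by lra.
rewrite -(ler_pM2r y4); apply: le_trans h _.
by rewrite -subr_ge0 (_ : _ - _ = y ^+ 2 * (1 - 2 * y))//; ring.
Qed.

(** A crude form of cosh y <= exp(y^2 / 2): for |y| <= 1/2 a quadratic bound for exp suffices, and
    beyond that 2 y^2 exceeds |y|. *)
Lemma expRDN_le y : expR y + expR (- y) <= 2 * expR (2 * y ^+ 2).
Proof.
have [y1|y1] := lerP `|y| 2^-1.
  have := expR_le y1; have := @expR_le (- y); rewrite normrN => /(_ y1).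
  by have := expR_ge1Dx (2 * y ^+ 2); rewrite sqrrN; lra.
have h z : z <= `|y| -> expR z <= expR (2 * y ^+ 2).
  move=> zy; rewrite ler_expR (le_trans zy)// -(real_normK (num_real y)).
  by have := mulr_ge0 (normr_ge0 y) (ltW (eq_ind _ is_true y1 _ (esym (subr_gt0 _ _)))); lra.
by rewrite mulr_natl mulr2n lerD// h// ?ler_norm// -normrN ler_norm.
Qed.

Lemma powR_le_expR t p : 0 <= t -> 0 < p -> t `^ p <= p `^ p * expR t.
Proof.
move=> t0 p0; have pn : p != 0 by rewrite gt_eqF.
rewrite -{1}(divfK pn t) mulrC.
rewrite powRM ?divr_ge0 ?(ltW p0)//; apply: ler_wpM2l; first exact: powR_ge0.
rewrite -{2}(divfK pn t) expRM ge0_ler_powR ?nnegrE ?(ltW p0) ?expR_ge0//.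
  by rewrite divr_ge0// ltW.
by have := expR_ge1Dx (t / p); lra.
Qed.

Let sg (b : bool) : R := (-1) ^+ b.

Let rademacher_exp m (u : 'I_m -> R) : \sum_k u k ^+ 2 <= 1 ->
  \sum_(w : {ffun 'I_m -> bool}) expR (\sum_k sg (w k) * u k) <= 2 ^+ m * expR 2.
Proof.
move=> u1; under eq_bigr => w _ do rewrite expR_sum.
rewrite -(bigA_distr_bigA (fun k b => expR (sg b * u k))).
apply: le_trans (_ : _ <= \prod_(k < m) (2 * expR (2 * u k ^+ 2))) _.
  apply: ler_prod => k _; rewrite sumr_ge0 => [|b _]; last exact: expR_ge0.
  rewrite big_bool /sg /=.
  by rewrite expr0 expr1 mulN1r mul1r addrC expRDN_le.
rewrite big_split /= prodr_const card_ord -expR_sum -mulr_sumr.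
by rewrite ler_wpM2l ?exprn_ge0// ler_expR ler_piMr.
Qed.

(** The p-th power of |s| is at most p^p (exp s + exp(-s)), and the exponential moments factorise
    over the independent signs. *)
Let rademacher_real p m (u : 'I_m -> R) : 0 < p -> \sum_k u k ^+ 2 <= 1 ->
  \sum_(w : {ffun 'I_m -> bool}) `|\sum_k sg (w k) * u k| `^ p <=
  2 ^+ m * (2 * p `^ p * expR 2).
Proof.
move=> p0 u1.
apply: le_trans (_ : _ <= \sum_(w : {ffun 'I_m -> bool}) p `^ p *
   (expR (\sum_k sg (w k) * u k) + expR (\sum_k sg (w k) * - u k))) _.
  apply: ler_sum => w _; apply: le_trans (powR_le_expR (normr_ge0 _) p0) _.
  apply: ler_wpM2l; first exact: powR_ge0.
  have -> : \sum_k sg (w k) * - u k = - \sum_k sg (w k) * u k.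
    by rewrite -sumrN; apply: eq_bigr => k _; rewrite mulrN.
  set s := \sum_k _; have := expR_ge0 s; have := expR_ge0 (- s).
  by case: (ger0P s); lra.
rewrite -mulr_sumr big_split /=.
have h1 := rademacher_exp u1.
have h2 : \sum_(w : {ffun 'I_m -> bool}) expR (\sum_k sg (w k) * - u k) <= 2 ^+ m * expR 2.
  by apply: rademacher_exp; under eq_bigr => k _ do rewrite sqrrN.
by apply: le_trans (ler_wpM2l (powR_ge0 _ _) (lerD h1 h2)) _; lra.
Qed.

Lemma rnorm_sqr (z : R[i]) : rnorm z ^+ 2 = complex.Re z ^+ 2 + complex.Im z ^+ 2.
Proof.
case: z => a b; rewrite /rnorm normc_def /= sqr_sqrtr//.
by rewrite addr_ge0 ?sqr_ge0.
Qed.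

Lemma powR_addr_le p (a b : R) : 0 <= a -> 0 <= b -> 0 < p ->
  (a + b) `^ p <= 2 `^ p * (a `^ p + b `^ p).
Proof.
move=> a0 b0 p0; have h c d : 0 <= c -> c <= d -> (c + d) `^ p <= 2 `^ p * d `^ p.
  move=> c0 cd; have d0 := le_trans c0 cd; rewrite -powRM//.
  by rewrite ge0_ler_powR ?nnegrE ?(ltW p0) ?addr_ge0 ?mulr_ge0//; lra.
have p2 := powR_ge0 2 p; rewrite mulrDr.
have [ab|/ltW ba] := lerP a b.
  by apply: le_trans (h _ _ a0 ab) _; rewrite lerDr mulr_ge0 ?powR_ge0.
by rewrite addrC; apply: le_trans (h _ _ b0 ba) _; rewrite lerDl mulr_ge0 ?powR_ge0.
Qed.

(** 2^p comes from splitting into real and imaginary part, 4 from two parts with two signs each, exp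
    2 from the exponential moment of a normalised sum. *)
Definition rademacher_const p := 2 `^ p * (4 * p `^ p * expR 2).

Lemma rademacher_le p m (c : 'I_m -> R[i]) : 0 < p -> \sum_k rnorm (c k) ^+ 2 <= 1 ->
  \sum_(w : {ffun 'I_m -> bool}) rnorm (\sum_k (sg (w k))%:C * c k) `^ p <=
  2 ^+ m * rademacher_const p.
Proof.
move=> p0 c1.
have re1 : \sum_k complex.Re (c k) ^+ 2 <= 1.
  by apply: le_trans c1; apply: ler_sum => k _; rewrite rnorm_sqr lerDl sqr_ge0.
have im1 : \sum_k complex.Im (c k) ^+ 2 <= 1.
  by apply: le_trans c1; apply: ler_sum => k _; rewrite rnorm_sqr lerDr sqr_ge0.
apply: le_trans (_ : _ <= \sum_(w : {ffun 'I_m -> bool}) 2 `^ p *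
   (`|\sum_k sg (w k) * complex.Re (c k)| `^ p +
    `|\sum_k sg (w k) * complex.Im (c k)| `^ p)) _.
  apply: ler_sum => w _; set z := \sum_k _.
  have zRe : complex.Re z = \sum_k sg (w k) * complex.Re (c k).
    rewrite /z (big_morph (@complex.Re R) (id1 := 0) (op1 := +%R))//; last by case=> ? ? [].
    by apply: eq_bigr => k _; case: (c k) => a b /=; rewrite mul0r subr0.
  have zIm : complex.Im z = \sum_k sg (w k) * complex.Im (c k).
    rewrite /z (big_morph (@complex.Im R) (id1 := 0) (op1 := +%R))//; last by case=> ? ? [].
    by apply: eq_bigr => k _; case: (c k) => a b /=; rewrite mul0r addr0.
  rewrite -zRe -zIm; apply: le_trans (powR_addr_le _ _ p0) => //.
  rewrite ge0_ler_powR ?nnegrE ?(ltW p0) ?rnorm_ge0 ?addr_ge0//.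
  rewrite -ler_sqr ?nnegrE ?rnorm_ge0 ?addr_ge0// rnorm_sqr sqrrD !real_normK ?num_real//.
  by rewrite addrAC lerDl mulrn_wge0// mulr_ge0.
rewrite -mulr_sumr big_split /=.
have h1 := rademacher_real p0 re1; have h2 := rademacher_real p0 im1.
apply: le_trans (ler_wpM2l (powR_ge0 _ _) (lerD h1 h2)) _.
by rewrite /rademacher_const; lra.
Qed.

Let sg_sum m (k l : 'I_m) :
  \sum_(w : {ffun 'I_m -> bool}) sg (w k) * sg (w l) = (k == l)%:R * 2 ^+ m.
Proof.
have [->|kl] := eqVneq k l.
  under eq_bigr => w _ do rewrite -expr2 sqrr_sign.
  by rewrite sumr_const card_ffun card_bool card_ord natrX mul1r.
pose F j b := if (j == k) || (j == l) then sg b else 1.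
have -> : \sum_(w : {ffun 'I_m -> bool}) sg (w k) * sg (w l) =
    \sum_(w : {ffun 'I_m -> bool}) \prod_j F j (w j).
  apply: eq_bigr => w _; rewrite (bigD1 k) //= (bigD1 l) /=; last by rewrite eq_sym.
  rewrite /F !eqxx orbT big1 ?mulr1// => j /andP[jk jl].
  by rewrite (negbTE jk) (negbTE jl).
rewrite -(bigA_distr_bigA F) (bigD1 k) //= big_bool /F eqxx /sg /=.
by rewrite expr1 expr0 addNr !mul0r.
Qed.

Lemma sqnormZ m (r : R) (c : 'cV[R[i]]_m) : sqnorm (r%:C *: c) = r ^+ 2 * sqnorm c.
Proof.
rewrite /sqnorm mulr_sumr; apply: eq_bigr => k _; rewrite mxE rnormM exprMn.
by congr (_ * _); rewrite rnorm_sqr /= expr0n addr0.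
Qed.

Lemma sqnorm_ge0 m (c : 'cV[R[i]]_m) : 0 <= sqnorm c.
Proof. by apply: sumr_ge0 => k _; exact: sqr_ge0. Qed.

Lemma sqnorm_eq0 m (c : 'cV[R[i]]_m) : sqnorm c = 0 -> c = 0.
Proof.
move=> /eqP; rewrite psumr_eq0 => [|k _]; last exact: sqr_ge0.
move=> /allP h; apply/matrixP => k l; rewrite ord1 mxE; apply: rnorm0_eq0.
by apply/eqP; rewrite -sqrf_eq0; apply: h; rewrite mem_index_enum.
Qed.

Lemma powR_invK (y p : R) : 0 <= y -> p != 0 -> (y `^ p^-1) `^ p = y.
Proof. by move=> y0 p0; rewrite -powRrM mulVf// powRr1. Qed.

Lemma rnorm_rcM r (z : R[i]) : 0 <= r -> rnorm (r%:C * z) = r * rnorm z.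
Proof. by move=> r0; rewrite rnormM rnormC. Qed.

Let embed_norm p m (c : 'I_m -> R[i]) : 0 < p -> \sum_k rnorm (c k) ^+ 2 <= 1 ->
  \sum_(w : {ffun 'I_m -> bool})
    rnorm (\sum_k (((2 ^+ m) `^ (- p^-1)) * sg (w k))%:C * c k) `^ p <=
  rademacher_const p.
Proof.
move=> p0 c1; have m0 : 0 < 2 ^+ m :> R by exact: exprn_gt0.
rewrite -(ler_pM2l m0); apply: le_trans (rademacher_le p0 c1).
rewrite mulr_sumr; apply: ler_sum => w _.
under eq_bigr => k _ do rewrite rcM -mulrA.
rewrite -mulr_sumr rnorm_rcM ?powR_ge0// powRM ?powR_ge0 ?rnorm_ge0//.
rewrite -powRrM mulNr mulVf ?gt_eqF// powR_inv1 ?(ltW m0)// mulrA divff ?gt_eqF//.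
by rewrite mul1r.
Qed.

(* The rows of [J] are the sign vectors and those of [Q] its normalized
   transpose: [l_2^m] sits complementedly in [l_p^(2^m)], uniformly in [m]. *)
Theorem complemented_hilbert_block p : 1 < p ->
  exists K : R, 0 < K /\ forall m, exists (r : nat) (J : 'M[R[i]]_(r, m)) (Q : 'M[R[i]]_(m, r)),
  [/\ (0 < r)%N, Q *m J = 1%:M,
    forall c, \sum_t rnorm ((J *m c) t 0) `^ p <= K * sqnorm c `^ (p / 2) &
    forall x, sqnorm (Q *m x) <= K * (\sum_t rnorm (x t 0) `^ p) `^ (2 / p)].
Proof.
move=> p1; have p0 : 0 < p by exact: lt_trans p1.
pose q := p / (p - 1); have q0 : 0 < q by rewrite divr_gt0// subr_gt0.
have pq : p^-1 + q^-1 = 1 by rewrite /q; field; rewrite !gt_eqF//; lra.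
pose Kp := rademacher_const p; pose Kq := rademacher_const q.
have const0 s : 0 < s -> 0 < rademacher_const s.
  by move=> s0; rewrite !mulr_gt0 ?powR_gt0 ?expR_gt0.
have Kp0 : 0 < Kp by exact: const0.
have Kq0 : 0 < Kq by exact: const0.
exists (Kp + (Kq + 1) ^+ 2); split; first by rewrite addr_gt0// exprn_gt0//; lra.
move=> m; pose W : finType := {ffun 'I_m -> bool}; pose M : R := 2 ^+ m.
have M0 : 0 < M by exact: exprn_gt0.
pose J : 'M[R[i]]_(#|W|, m) := \matrix_(t, k) (M `^ (- p^-1) * sg ((enum_val t : W) k))%:C.
pose Q : 'M[R[i]]_(m, #|W|) := \matrix_(k, t) (M `^ (- q^-1) * sg ((enum_val t : W) k))%:C.
have sumW (V : nmodType) (F : W -> V) : \sum_(t < #|W|) F (enum_val t) = \sum_w F w.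
  by rewrite -(big_enum_val (A := W)).
exists #|W|, J, Q; split.
- by apply/card_gt0P; exists [ffun=> true].
- apply/matrixP => k l; rewrite !mxE.
  under eq_bigr => t _ do rewrite !mxE -rcM mulrACA.
  rewrite -rc_sum (sumW _ (fun w : W => M `^ (- q^-1) * M `^ (- p^-1) * (sg (w k) * sg (w l)))).
  (* As 1/p + 1/q = 1, the normalisations multiply to 1 / M, and the coordinate signs are orthogonal
     with squared length M. *)
  have -> : M `^ (- q^-1) * M `^ (- p^-1) = M^-1.
    rewrite -powRD; last by rewrite [M == 0]gt_eqF// implybT.
    by rewrite -opprD addrC pq powR_inv1// ltW.
  rewrite -mulr_sumr sg_sum mulrCA mulVf ?(lt0r_neq0 M0)// mulr1.
  by case: (k == l).
- move=> c; have [c0|c0] := eqVneq (sqnorm c) 0.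
    rewrite (sqnorm_eq0 c0) mulmx0 sqnorm0 powR0 ?mulr0; last first.
      by rewrite mulf_neq0 ?invr_eq0 ?gt_eqF.
    by rewrite big1// => t _; rewrite mxE rnorm0 powR0// gt_eqF.
  have c1 : 0 < sqnorm c by rewrite lt_def c0 sqnorm_ge0.
  pose s := Num.sqrt (sqnorm c); have s0 : 0 < s by rewrite sqrtr_gt0.
  have ss : s ^+ 2 = sqnorm c by rewrite sqr_sqrtr ?sqnorm_ge0.
  pose c' := s^-1%:C *: c; have cc : c = s%:C *: c' by rewrite scalerCK// gt_eqF.
  have c'1 : sqnorm c' <= 1.
    by rewrite sqnormZ -ss exprVn mulVf// sqrf_eq0 gt_eqF.
  have h : \sum_t rnorm ((J *m c') t 0) `^ p <= Kp.
    apply: le_trans (embed_norm p0 c'1); rewrite -(sumW _ (fun w : W =>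
      rnorm (\sum_k ((2 ^+ m) `^ (- p^-1) * sg (w k))%:C * c' k 0) `^ p)).
    rewrite le_eqVlt; apply/orP; left; apply/eqP; apply: eq_bigr => t _.
    by rewrite mxE; congr (rnorm _ `^ _); apply: eq_bigr => k _; rewrite mxE.
  have -> : sqnorm c `^ (p / 2) = s `^ p.
    by rewrite -ss -powR_mulrn ?(ltW s0)// -powRrM mulrC divfK.
  have -> : \sum_t rnorm ((J *m c) t 0) `^ p = s `^ p * \sum_t rnorm ((J *m c') t 0) `^ p.
    rewrite mulr_sumr; apply: eq_bigr => t _; rewrite {1}cc -scalemxAr mxE.
    by rewrite rnorm_rcM ?(ltW s0)// powRM ?rnorm_ge0 ?(ltW s0).
  rewrite mulrC ler_wpM2r ?powR_ge0//.
  by apply: le_trans h _; rewrite lerDl sqr_ge0.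
(* Duality: the Hilbert norm [s] of [Q *m x] is its pairing with a unit vector, that is, the pairing
   of [x] with the exponent-q embedding [g] of that vector. Young's inequality bounds it by Kq +
   1. *)
- have unit_bound (x : 'cV[R[i]]_#|W|) : \sum_t rnorm (x t 0) `^ p <= 1 -> sqnorm (Q *m x) <= (Kq + 1) ^+ 2.
    move=> x1; pose c := Q *m x; rewrite -/c.
    have [c0|c0] := eqVneq (sqnorm c) 0; first by rewrite c0 sqr_ge0.
    have c1 : 0 < sqnorm c by rewrite lt_def c0 sqnorm_ge0.
    pose s := Num.sqrt (sqnorm c); have s0 : 0 < s by rewrite sqrtr_gt0.
    have ss : s ^+ 2 = sqnorm c by rewrite sqr_sqrtr ?sqnorm_ge0.
    rewrite -ss ler_sqr ?nnegrE ?(ltW s0) ?addr_ge0 ?(ltW Kq0)//.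
    pose c' k := s^-1%:C * Num.conj (c k 0).
    have c'1 : \sum_k rnorm (c' k) ^+ 2 <= 1.
      rewrite (eq_bigr (fun k => s ^- 2 * rnorm (c k 0) ^+ 2)) => [|k _].
        by rewrite -mulr_sumr -/(sqnorm c) -ss mulVf// sqrf_eq0 gt_eqF.
      rewrite rnorm_rcM ?invr_ge0 ?(ltW s0)// exprMn exprVn; congr (_ * _).
      by rewrite !rnorm_sqr; case: (c k 0) => a b /=; rewrite sqrrN.
    pose g w : R[i] := \sum_k (M `^ (- q^-1) * sg ((w : W) k))%:C * c' k.
    have g1 : \sum_(t < #|W|) rnorm (g (enum_val t)) `^ q <= Kq.
      by rewrite (sumW _ (fun w => rnorm (g w) `^ q)); exact: embed_norm.
    have sE : s%:C = \sum_(t < #|W|) g (enum_val t) * x t 0.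
      have -> : s%:C = \sum_k c' k * c k 0.
        rewrite (eq_bigr (fun k => (s^-1 * rnorm (c k 0) ^+ 2)%:C)) => [|k _].
          rewrite -rc_sum -mulr_sumr -/(sqnorm c) -ss; congr (_%:C); field.
          by rewrite gt_eqF.
        by rewrite /c' rcM -mul_conjC_rnorm mulrAC mulrA.
      rewrite /g; under [RHS]eq_bigr => t _ do rewrite mulr_suml.
      rewrite exchange_big /=; apply: eq_bigr => k _.
      have -> : c k 0 = \sum_t Q k t * x t 0 by rewrite mxE.
      rewrite mulr_sumr; apply: eq_bigr => t _.
      by rewrite mxE mulrA; congr (_ * _); exact: mulrC.
    have : s <= \sum_(t < #|W|) (rnorm (g (enum_val t)) `^ q + rnorm (x t 0) `^ p).
      rewrite -[s]rnormC ?(ltW s0)// sE.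
      apply: le_trans (_ : _ <= \sum_(t < #|W|) rnorm (g (enum_val t) * x t 0)) _.
        by apply: (big_ind2 (fun (z : R[i]) y => rnorm z <= y)) => [|z1 y1 z2 y2 h1 h2|//];
          [rewrite rnorm0|exact: le_trans (ler_rnormD _ _) (lerD h1 h2)].
      apply: ler_sum => t _; rewrite rnormM.
      have qp : q^-1 + p^-1 = 1 by rewrite addrC.
      apply: le_trans (conjugate_powR (rnorm_ge0 _) (rnorm_ge0 _) q0 p0 qp) _.
      have p1' : p^-1 <= 1 by rewrite invf_le1// ltW.
      have q1' : q^-1 <= 1 by have := invr_gt0 p; rewrite p0; lra.
      by apply: lerD; rewrite ler_piMr// powR_ge0.
    by rewrite big_split /=; lra.
  move=> x; set S := \sum_t _.
  have S0 : 0 <= S by apply: sumr_ge0 => t _; exact: powR_ge0.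
  have [Sz|Sz] := eqVneq S 0.
    have -> : x = 0.
      apply/matrixP => t l; rewrite ord1 mxE; apply/rnorm0_eq0/(@powR_eq0_eq0 _ _ p).
      apply/le_anti; rewrite powR_ge0 andbT -Sz /S (bigD1 t)//= lerDl.
      by apply: sumr_ge0 => j _; exact: powR_ge0.
    by rewrite mulmx0 sqnorm0 mulr_ge0 ?powR_ge0// addr_ge0 ?sqr_ge0 ?(ltW Kp0).
  have S1 : 0 < S by rewrite lt_def Sz.
  pose s := S `^ p^-1; have s0 : 0 < s by exact: powR_gt0.
  have sp : s `^ p = S by rewrite powR_invK// gt_eqF.
  pose x' := s^-1%:C *: x; have xx : x = s%:C *: x' by rewrite scalerCK// gt_eqF.
  have -> : S `^ (2 / p) = s ^+ 2.
    by rewrite -powR_mulrn ?(ltW s0)// -powRrM mulrC.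
  rewrite xx -scalemxAr sqnormZ mulrC ler_wpM2r ?sqr_ge0//.
  apply: le_trans (unit_bound x' _) _; last by rewrite lerDr ltW.
  rewrite -(ler_pM2l S1) mulr1 -{1}sp mulr_sumr; apply: ler_sum => t _.
  rewrite -powRM ?rnorm_ge0 ?(ltW s0)// -rnorm_rcM ?(ltW s0)//.
  by have -> : x t 0 = s%:C * x' t 0 by rewrite [in LHS]xx mxE.
Qed.

End rademacher.

(** * A compactness criterion in l^p *)

Section lp_compactness.
Context {R : realType} (p : R) (p_ge1 : 1 <= p).
Local Notation L := (lp p_ge1).
Implicit Types (v w : L) (n : nat).

Let p_gt0 : 0 < p. Proof. exact: lt_le_trans p_ge1. Qed.

Let sum_ge0 (x : nat -> R[i]) : (0 <= \sum_(n <oo) (rnorm (x n) `^ p)%:E)%E.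
Proof. by apply: nneseries_ge0 => n _ _; rewrite lee_fin powR_ge0. Qed.

Let series_le (x : nat -> R[i]) B :
  (forall n, \sum_(k < n) rnorm (x k) `^ p <= B) ->
  (\sum_(n <oo) (rnorm (x n) `^ p)%:E <= B%:E)%E.
Proof.
move=> h; apply: lime_le.
  by apply: is_cvg_nneseries => n _ _; rewrite lee_fin powR_ge0.
by apply: nearW => n; rewrite big_mkord sumEFin lee_fin.
Qed.

Lemma lp_mem_le (x : nat -> R[i]) B :
  (forall n, \sum_(k < n) rnorm (x k) `^ p <= B) -> lp_mem p x.
Proof. by move=> /series_le h; apply/asboolP; rewrite (le_lt_trans h)// ltry. Qed.

Lemma lp_build (x : nat -> R[i]) B :
  (forall n, \sum_(k < n) rnorm (x k) `^ p <= B) -> exists w, val w = x.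
Proof. by move=> h; exists (exist _ x (lp_mem_le h)). Qed.

Let rnorm_powR v :
  (rnorm v `^ p)%:E = (\sum_(n <oo) (rnorm (val v n) `^ p)%:E)%E.
Proof.
have /asboolP h := lpP v.
rewrite rnorm_lpE /lp_norm powR_invK ?gt_eqF ?fine_ge0// fineK//.
by rewrite ge0_fin_numE.
Qed.

Lemma lp_sum_le v n : \sum_(k < n) rnorm (val v k) `^ p <= rnorm v `^ p.
Proof.
rewrite -lee_fin rnorm_powR -sumEFin -(big_mkord predT (fun k => (rnorm (val v k) `^ p)%:E)).
by apply: nneseries_lim_ge => k _ _; rewrite lee_fin powR_ge0.
Qed.

Lemma rnorm_lp_le v B : (forall n, \sum_(k < n) rnorm (val v k) `^ p <= B) ->
  rnorm v `^ p <= B.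
Proof. by move=> /series_le h; rewrite -lee_fin rnorm_powR. Qed.

Lemma ler_powR2 (a b : R) : 0 <= a -> 0 <= b -> (a `^ p <= b `^ p) = (a <= b).
Proof.
move=> a0 b0; apply/idP/idP => [|ab]; last by rewrite ge0_ler_powR// ltW.
apply: contraTT; rewrite -!ltNge => ba; rewrite gt0_ltr_powR// in_itv /= andbT.
Qed.

Lemma lp_coord_le v k : rnorm (val v k) <= rnorm v.
Proof.
rewrite -ler_powR2 ?rnorm_ge0// (le_trans _ (lp_sum_le v k.+1))//.
by rewrite big_ord_recr /= lerDr sumr_ge0// => j _; exact: powR_ge0.
Qed.

Lemma lp_dominated v (x : nat -> R[i]) :
  (forall k, rnorm (x k) <= rnorm (val v k)) ->
  exists w, val w = x /\ rnorm w <= rnorm v.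
Proof.
move=> h; have hx n : \sum_(k < n) rnorm (x k) `^ p <= rnorm v `^ p.
  apply: le_trans (lp_sum_le v n); apply: ler_sum => k _.
  by rewrite ler_powR2 ?rnorm_ge0.
have [w wx] := lp_build hx; exists w; split; first exact: wx.
rewrite -(ler_powR2 (rnorm_ge0 _) (rnorm_ge0 _)).
by apply: rnorm_lp_le => n; rewrite wx; exact: hx.
Qed.

Lemma lp_delta_exists (k : nat) : exists w, forall j, val w j = (j == k)%:R.
Proof.
pose x j : R[i] := (j == k)%:R.
have hx n : \sum_(j < n) rnorm (x j) `^ p <= 1.
  have [kn|nk] := ltnP k n; last first.
    rewrite big1 ?ler01// => j _; rewrite /x.
    by rewrite (ltn_eqF (leq_trans (ltn_ord j) nk)) rnorm0 powR0// gt_eqF.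
  rewrite (bigD1 (Ordinal kn)) //= big1 => [|j jk].
    by rewrite /x eqxx addr0 /rnorm normr1 powR1.
  move: jk; rewrite -val_eqE /= => /negbTE jk.
  by rewrite /x jk rnorm0 powR0// gt_eqF.
by have [w wx] := lp_build hx; exists w => j; rewrite wx.
Qed.

Lemma lp_head_tail v n : exists u w, [/\ v = u + w,
  forall k, val u k = if (k < n)%N then val v k else 0,
  rnorm u <= rnorm v & rnorm w <= rnorm v].
Proof.
have [|u [uE ur]] := @lp_dominated v (fun k => if (k < n)%N then val v k else 0).
  by move=> k; case: ifP => // _; rewrite rnorm0 rnorm_ge0.
have [|w [wE wr]] := @lp_dominated v (fun k => if (k < n)%N then 0 else val v k).
  by move=> k; case: ifP => // _; rewrite rnorm0 rnorm_ge0.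
exists u, w; split=> // [|k]; last by rewrite uE.
apply: val_inj; apply/funext => k; rewrite -[val (u + w) k]/(val u k + val w k) uE wE.
by case: ifP; rewrite ?addr0 ?add0r.
Qed.

Let ultra_real_limit (T : Type) (G : set_system T) (f : T -> R) : UltraFilter G ->
  G [set y | `|f y| <= 1] -> exists c, forall e, 0 < e -> G [set y | `|f y - c| < e].
Proof.
move=> uG Gf; have FfG : (f @ G) `[-1, 1]%classic.
  apply: (@filterS _ G _ _ _ _ Gf) => y /= fy.
  by rewrite in_itv /= -ler_norml.
have [c [_ clc]] := @segment_compact R (-1) 1 (f @ G) _ FfG.
exists c => e e0; have [//|Gn] := in_ultra_setVsetC [set y | `|f y - c| < e] uG.
have [|z []] := clc (~` [set z | `|z - c| < e]) [set z | `|z - c| < e] Gn; last by [].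
apply/nbhs_ballP; exists e => //= z.
by rewrite -ball_normE /= distrC.
Qed.

(** Compactness is tested on ultrafilters, along which every bounded coordinate converges; no
    diagonal subsequence has to be extracted. *)
Lemma ultra_limit (T : Type) (G : set_system T) (f : T -> R[i]) : UltraFilter G ->
  G [set y | rnorm (f y) <= 1] -> exists c, forall e, 0 < e -> G [set y | rnorm (f y - c) < e].
Proof.
move=> uG Gf.
have absR (z : R[i]) : `|complex.Re z| <= rnorm z.
  rewrite -ler_sqr ?nnegrE ?rnorm_ge0// real_normK ?num_real// rnorm_sqr.
  by rewrite lerDl sqr_ge0.
have absI (z : R[i]) : `|complex.Im z| <= rnorm z.
  rewrite -ler_sqr ?nnegrE ?rnorm_ge0// real_normK ?num_real// rnorm_sqr.
  by rewrite lerDr sqr_ge0.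
have [a ha] : exists c, forall e, 0 < e -> G [set y | `|complex.Re (f y) - c| < e].
  by apply: ultra_real_limit; apply: filterS Gf => y /=; apply: le_trans.
have [b hb] : exists c, forall e, 0 < e -> G [set y | `|complex.Im (f y) - c| < e].
  by apply: ultra_real_limit; apply: filterS Gf => y /=; apply: le_trans.
exists (a +i* b) => e e0.
have e20 : 0 < e / 2 by rewrite divr_gt0.
apply: filterS (filterI (ha _ e20) (hb _ e20)) => y [/=]; case: (f y) => u v /=.
set s := u - a; set t := v - b => hs ht.
rewrite -ltr_sqr ?nnegrE ?rnorm_ge0 ?(ltW e0)// rnorm_sqr /= -/s -/t.
have : s ^+ 2 < (e / 2) ^+ 2.
  by rewrite -real_normK ?num_real// ltr_sqr ?nnegrE ?(ltW e20).
have : t ^+ 2 < (e / 2) ^+ 2.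
  by rewrite -real_normK ?num_real// ltr_sqr ?nnegrE ?(ltW e20).
by have := exprn_gt0 2 e0; lra.
Qed.

(* An operator which is small on vectors supported far away is a norm limit
   of finite rank operators. *)
Lemma compact_of_tails (D : bop L) :
  (forall e, 0 < e -> exists n, forall v, (forall k, (k < n)%N -> val v k = 0) ->
    rnorm (D v) <= e * rnorm v) ->
  D \in @compact_op R L.
Proof.
move=> tails; apply/asboolP.
have [dl dlE] := choice lp_delta_exists.
apply: compact_precompact; first exact: norm_hausdorff.
rewrite compact_ultra => G uG GD.
have /choice[sg hsg] : forall y : L, exists v : L,
    (D @` [set x | rnorm x <= 1]) y -> rnorm v <= 1 /\ D v = y.
  move=> y; have [[v v1 <-]|h] := pselect ((D @` [set x | rnorm x <= 1]) y).
    by exists v.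
  by exists 0.
(* The limits of the coordinates of chosen preimages; they will form a point of the unit ball whose
   image is the limit sought. *)
have /choice[c hc] : forall k, exists c : R[i], forall e, 0 < e ->
    G [set y | rnorm (val (sg y) k - c) < e].
  move=> k; apply: ultra_limit; apply: filterS GD => y /hsg[h _] /=.
  exact: le_trans (lp_coord_le _ _) h.
have hcn n e : 0 < e -> G [set y | forall k, (k < n)%N -> rnorm (val (sg y) k - c k) < e].
  move=> e0; elim: n => [|n ih]; first by apply: filterS GD.
  apply: filterS (filterI ih (hc n e e0)) => y [/= h1 h2] k.
  by rewrite ltnS leq_eqVlt => /orP[/eqP ->|/h1].
have sum_val n (d : 'I_n -> R[i]) k : val (\sum_(j < n) d j *: dl j : L) k =
    \sum_(j < n) d j * (k == j)%:R.
  rewrite (big_morph (fun v : L => val v k) (id1 := 0) (op1 := +%R)) //.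
  by apply: eq_bigr => j _; rewrite -dlE.
have sum_coord n (d : nat -> R[i]) k : val (\sum_(j < n) d j *: dl j : L) k =
    if (k < n)%N then d k else 0.
  rewrite sum_val; case: ifPn => [kn|]; last first.
    rewrite -leqNgt => nk; rewrite big1// => j _.
    by rewrite gtn_eqF ?mulr0// (leq_trans (ltn_ord j) nk).
  rewrite (bigD1 (Ordinal kn)) //= big1 => [|j]; first by rewrite eqxx mulr1 addr0.
  by rewrite -val_eqE /= eq_sym => /negbTE ->; rewrite mulr0.
pose C n : R := 1 + \sum_(j < n) rnorm (dl j).
have sum_small n (d : nat -> R[i]) e : 0 <= e -> (forall k, (k < n)%N -> rnorm (d k) <= e) ->
    rnorm (\sum_(j < n) d j *: dl j : L) <= C n * e.
  move=> e0 de; apply: (@le_trans _ _ (\sum_(j < n) rnorm (d j *: dl j))).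
    by elim/big_ind2 : _ => [|x a y b h1 h2|//]; rewrite ?rnorm0// (le_trans (ler_rnormD _ _))// lerD.
  rewrite mulrDl mul1r mulr_suml -[leLHS]add0r lerD//; apply: ler_sum => j _.
  by rewrite rnormZ mulrC ler_wpM2l ?rnorm_ge0// de.
have C0 n : 0 < C n by rewrite ltr_pwDl// sumr_ge0// => j _; exact: rnorm_ge0.
(* As in Fatou's lemma: each finite head of [c] is a limit of heads of vectors of the unit ball. *)
have cn n : \sum_(k < n) rnorm (c k) `^ p <= 1.
  have h1 : rnorm (\sum_(j < n) c j *: dl j : L) <= 1.
    apply/ler_addgt0Pr => e e0.
    have d0 : 0 < e / C n by rewrite divr_gt0.
    have [y [/= yc /hsg[y1 _]]] := filter_ex (filterI (hcn n _ d0) GD).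
    have [u [w [vE uE u1 _]]] := lp_head_tail (sg y) n.
    have -> : \sum_(j < n) c j *: dl j = u - \sum_(j < n) (val (sg y) j - c j) *: dl j.
      apply: val_inj; apply/funext => k.
      rewrite -[RHS]/(val u k - val (\sum_(j < n) (val (sg y) j - c j) *: dl j : L) k).
      rewrite (sum_coord n c) (sum_coord n (fun j => val (sg y) j - c j)) uE.
      by case: ifP; rewrite ?subr0// subKr.
    apply: le_trans (ler_rnormD _ _) _; rewrite rnormN.
    apply: lerD; first exact: le_trans u1 y1.
    apply: le_trans (sum_small n (fun j => val (sg y) j - c j) _ (ltW d0) _) _.
      by move=> k kn; exact/ltW/yc.
    by rewrite mulrC divfK// gt_eqF.
  rewrite (eq_bigr (fun k : 'I_n => rnorm (val (\sum_(j < n) c j *: dl j : L) k) `^ p)).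
    apply: le_trans (lp_sum_le _ n) _.
    by have := h1; rewrite -(ler_powR2 (rnorm_ge0 _) ler01) powR1.
  by move=> k _; rewrite sum_coord ltn_ord.
have [x xc] := lp_build cn.
have x1 : rnorm x <= 1.
  rewrite -(ler_powR2 (rnorm_ge0 _) ler01) powR1.
  by apply: rnorm_lp_le => n; rewrite xc; exact: cn.
exists (D x); split; first by exists x.
apply/cvgrPdist_le => -[e e'].
rewrite ltcE /= => /andP[/eqP -> e0].
have e40 : 0 < e / 4 by rewrite divr_gt0.
have [n hn] := tails _ e40.
have D1 : 0 < rnorm D + 1 by rewrite ltr_wpDl ?rnorm_ge0.
(* At this precision the head contributes at most e / 2; the tail has norm at most 2 and is shrunk
   by e / 4. *)
have d0 : 0 < e / 2 / (C n * (rnorm D + 1)) by rewrite !divr_gt0// mulr_gt0.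
apply: filterS (filterI (hcn n _ d0) GD) => y [/= yc /hsg[y1 Dy]].
rewrite rnormE lecR -{}Dy.
pose z := sg y - x; pose u : L := \sum_(j < n) val z j *: dl j.
have zk k : val z k = val (sg y) k - c k by rewrite -xc.
rewrite rdistC (_ : D (sg y) - D x = D u + D (z - u)); last first.
  by rewrite -(linearD D) [u + _]addrC subrK linearB.
rewrite (le_trans (ler_rnormD _ _))// (splitr e) lerD//.
  apply: le_trans (rnorm_bop_le _ _) _.
  have us := sum_small n (fun j => val z j) _ (ltW d0).
  apply: (@le_trans _ _ ((rnorm D + 1) * (C n * (e / 2 / (C n * (rnorm D + 1)))))).
    apply: ler_pM; rewrite ?rnorm_ge0 ?lerDl//; apply: us => k kn.
    by rewrite [X in rnorm X]zk; exact/ltW/yc.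
  by rewrite le_eqVlt; apply/orP; left; apply/eqP; field; rewrite !gt_eqF.
have zu k : val (z - u) k = if (k < n)%N then 0 else val z k.
  rewrite -[LHS]/(val z k - val u k) /u (sum_coord n (fun j => val z j)).
  by case: ifP; rewrite ?subrr ?subr0.
apply: le_trans (hn (z - u) _) _; first by move=> k kn; rewrite zu kn.
have [|w [wE wr]] := @lp_dominated z (fun k => if (k < n)%N then 0 else val z k).
  by move=> k; case: ifP => // _; rewrite rnorm0 rnorm_ge0.
have -> : z - u = w by apply: val_inj; rewrite wE; apply/funext => k; exact: zu.
have z2 : rnorm z <= 1 + 1.
  have := ler_rnormD (sg y) (- x); rewrite rnormN -/z => zle.
  exact: le_trans zle (lerD y1 x1).
apply: le_trans (ler_wpM2l (ltW e40) (le_trans wr z2)) _.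
by rewrite (_ : e / 4 * (1 + 1) = e / 2)//; field.
Qed.

End lp_compactness.

(** * Block decomposition of l^p *)

Section lp_blocks.
Context {R : realType} (p : R) (p_ge1 : 1 <= p) (r : nat -> nat).
Hypothesis r_gt0 : forall b, (0 < r b)%N.
Local Notation L := (lp p_ge1).
Implicit Types (v w : L) (b n : nat).

Let p_gt0 : 0 < p. Proof. exact: lt_le_trans p_ge1. Qed.

Let off b := (\sum_(c < b) r c)%N.

Let offS b : off b.+1 = (off b + r b)%N. Proof. exact: big_ord_recr. Qed.

Let off_mono b b' : (b <= b')%N -> (off b <= off b')%N.
Proof.
move=> /subnK <-; elim: (b' - b)%N => // n ih.
by rewrite addSn offS (leq_trans ih)// leq_addr.
Qed.

(** Nonempty blocks make the offsets unbounded, so the blocks exhaust all coordinates. *)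
Let le_off n : (n <= off n)%N.
Proof.
elim: n => // n ih; rewrite offS -addn1; exact: leq_add ih (r_gt0 n).
Qed.

Let sum_off (F : nat -> R) n :
  \sum_(k < off n) F k = \sum_(b < n) \sum_(t < r b) F (off b + t)%N.
Proof.
elim: n => [|n ih]; first by rewrite /off !big_ord0.
rewrite big_ord_recr /= -ih -(big_mkord predT F) (big_cat_nat (n := off n)) //=.
  rewrite big_mkord; congr (_ + _).
  rewrite -{1}[off n]add0n big_addn big_mkord offS addKn.
  by apply: eq_bigr => t _; rewrite addnC.
by rewrite offS leq_addr.
Qed.

Let off_inj b t b' t' : (t < r b)%N -> (t' < r b')%N -> (off b + t = off b' + t')%N ->
  b = b' /\ t = t'.
Proof.
move=> tb tb' e; have bb : b = b'.
  have [bb|bb|//] := ltngtP b b'.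
    by have := off_mono bb; rewrite offS; lia.
  by have := off_mono bb; rewrite offS; lia.
by split=> //; move: e; rewrite bb; apply: addnI.
Qed.

Let off_surj s : exists b t, (t < r b)%N /\ s = (off b + t)%N.
Proof.
suff h n : (s < off n)%N -> exists b t, (t < r b)%N /\ s = (off b + t)%N.
  exact: h s.+1 (le_off _).
elim: n => [|n ih]; first by rewrite /off big_ord0.
have [sn _|ns] := ltnP s (off n); first exact: ih.
rewrite offS => h; exists n, (s - off n)%N; split; first by rewrite ltn_subLR.
by rewrite subnKC.
Qed.

Definition blk v b : 'cV[R[i]]_(r b) := \col_t val v (off b + t)%N.

Definition colp n (c : 'cV[R[i]]_n) : R := \sum_t rnorm (c t 0) `^ p.

Lemma colp_ge0 n (c : 'cV[R[i]]_n) : 0 <= colp c.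
Proof. by apply: sumr_ge0 => t _; exact: powR_ge0. Qed.

Let colp_blk v b : colp (blk v b) = \sum_(t < r b) rnorm (val v (off b + t)%N) `^ p.
Proof. by apply: eq_bigr => t _; rewrite /blk mxE. Qed.

Lemma sum_colp_le v n : \sum_(b < n) colp (blk v b) <= rnorm v `^ p.
Proof.
apply: le_trans (lp_sum_le v (off n)).
rewrite (sum_off (fun k => rnorm (val v k) `^ p)).
by apply: ler_sum => b _; rewrite colp_blk.
Qed.

Lemma colp_le v b : colp (blk v b) <= rnorm v `^ p.
Proof.
apply: le_trans (sum_colp_le v b.+1); rewrite big_ord_recr /= lerDr.
by apply: sumr_ge0 => k _; exact: colp_ge0.
Qed.

Lemma blk_lin (c : R[i]) v w b : blk (c *: v + w) b = c *: blk v b + blk w b.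
Proof. by apply/matrixP => t k; rewrite !mxE. Qed.

Lemma blkB v w b : blk (v - w) b = blk v b - blk w b.
Proof. by apply/matrixP => t k; rewrite !mxE. Qed.

Lemma blkZ (c : R[i]) v b : blk (c *: v) b = c *: blk v b.
Proof. by apply/matrixP => t k; rewrite !mxE. Qed.

Lemma blk_inj v w : (forall b, blk v b = blk w b) -> v = w.
Proof.
move=> h; apply: val_inj; apply/funext => s.
have [b [t [tb ->]]] := off_surj s.
have /matrixP /(_ (Ordinal tb) 0) := h b.
by rewrite !mxE.
Qed.

Lemma blk_tail n : exists N, forall v, (forall k, (k < N)%N -> val v k = 0) ->
  forall b, (b < n)%N -> blk v b = 0.
Proof.
exists (off n) => v h b bn; apply/matrixP => t k; rewrite !mxE h//.
by apply: leq_trans (off_mono bn); rewrite offS ltn_add2l.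
Qed.

Lemma glue (c : forall b, 'cV[R[i]]_(r b)) (B : R) :
  (forall n, \sum_(b < n) colp (c b) <= B) ->
  exists w, (forall b, blk w b = c b) /\ rnorm w `^ p <= B.
Proof.
move=> hB.
(* Summing over [b <= s] is enough: a block containing coordinate [s] has [b <= off b <= s]. *)
pose x s : R[i] := \sum_(b < s.+1) \sum_(t < r b) if (off b + t == s)%N then c b t 0 else 0.
have xE b (t : 'I_(r b)) : x (off b + t)%N = c b t 0.
  have bs : (b < (off b + t).+1)%N.
    by rewrite ltnS (leq_trans (le_off b))// leq_addr.
  rewrite /x (bigD1 (Ordinal bs)) //= [X in _ + X]big1 => [|b' bb'].
    rewrite addr0 (bigD1 t) //= eqxx big1 ?addr0// => t' tt'.
    by case: eqP => // /off_inj[]// _ /val_inj e; rewrite e eqxx in tt'.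
  rewrite big1// => t' _; case: eqP => // /off_inj[]// e _.
  by exfalso; move: bb'; rewrite -val_eqE /= e eqxx.
have hx n : \sum_(k < n) rnorm (x k) `^ p <= B.
  apply: le_trans (hB n).
  rewrite [leRHS](eq_bigr (fun b : 'I_n => \sum_(t < r b) rnorm (x (off b + t)%N) `^ p)).
    rewrite -(sum_off (fun k => rnorm (x k) `^ p)).
    rewrite -(big_mkord predT (fun k => rnorm (x k) `^ p)).
    rewrite -(big_mkord predT (fun k => rnorm (x k) `^ p)).
    rewrite [leRHS](big_cat_nat (n := n)) //= lerDl.
    by apply: sumr_ge0 => k _; exact: powR_ge0.
  by move=> b _; apply: eq_bigr => t _; rewrite xE.
have [w wx] := lp_build p_ge1 hx; exists w; split=> [b|].
  by apply/matrixP => t k; rewrite ord1 mxE wx xE.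
by apply: rnorm_lp_le => n; rewrite wx; exact: hx.
Qed.

Lemma block_operator (f : forall b, L -> 'cV[R[i]]_(r b)) (M : R) : 0 <= M ->
  (forall b (c : R[i]) v w, f b (c *: v + w) = c *: f b v + f b w) ->
  (forall v n, \sum_(b < n) colp (f b v) <= M `^ p * rnorm v `^ p) ->
  exists T : bop L, (forall v b, blk (T v) b = f b v) /\ rnorm T <= M.
Proof.
move=> M0 flin fM.
have /choice[T hT] : forall v, exists w, (forall b, blk w b = f b v) /\
    rnorm w `^ p <= M `^ p * rnorm v `^ p.
  by move=> v; exact: (glue (fM v)).
have TM v : rnorm (T v) <= M * rnorm v.
  rewrite -(ler_powR2 p_ge1 (rnorm_ge0 _) (mulr_ge0 M0 (rnorm_ge0 _))).
  by rewrite powRM ?rnorm_ge0//; exact: (hT v).2.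
have Tm : bop_mem T.
  apply/asboolP; split; last by exists M.
  move=> c v w; apply: blk_inj => b.
  by rewrite (hT _).1 flin blk_lin !(hT _).1.
exists (exist _ T Tm); split; first by move=> v; exact: (hT v).1.
by rewrite rnorm_bopE; apply: opnorm_lub.
Qed.

End lp_blocks.

(** * The representation in the Calkin algebra *)

Section finite_sums.
Implicit Types (s t : seq nat).

Lemma big_seq_capC (V : nmodType) s t (F : nat -> V) : uniq s -> uniq t ->
  \sum_(i <- s | i \in t) F i = \sum_(i <- t | i \in s) F i.
Proof.
move=> us ut; rewrite -big_filter -[RHS]big_filter; apply: perm_big.
apply: uniq_perm; rewrite ?filter_uniq// => i.
by rewrite !mem_filter andbC.
Qed.

Lemma big_seq_sub (V : nmodType) s t (F : nat -> V) : uniq s -> uniq t ->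
  {subset s <= t} -> \sum_(i <- s) F i = \sum_(i <- t | i \in s) F i.
Proof.
move=> us ut st; rewrite -(big_seq_capC _ us ut) big_seq [RHS]big_seq_cond.
by apply: eq_bigl => i; case: (boolP (i \in s)) => //= /st ->.
Qed.

Lemma mem_lt_sum s b : b \in s -> (b < \sum_(c <- s) c.+1)%N.
Proof.
elim: s => // c s ih; rewrite inE big_cons => /orP[/eqP ->|/ih h]; lia.
Qed.

(** The neighbour relation is symmetric with finitely many neighbours each, so only finitely many
    blocks have one below [B]. *)
Lemma nbr_far B : exists N, forall b b', (N <= b)%N -> b' \in nbr b -> (B <= b')%N.
Proof.
exists (\sum_(c < B) \sum_(b <- nbr c) b.+1)%N => b b' Nb; rewrite nbrC => bb'.
rewrite leqNgt; apply: contraTN Nb => b'B; rewrite -ltnNge.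
by rewrite (bigD1 (Ordinal b'B)) //= (leq_trans (mem_lt_sum bb'))// leq_addr.
Qed.

Context {R : realType}.

Lemma sum_nbr_le (g : nat -> R) (B : R) n : (forall b, 0 <= g b) ->
  (forall N, \sum_(b < N) g b <= B) -> \sum_(b < n) \sum_(b' <- nbr b) g b' <= 3 * B.
Proof.
move=> g0 gB; pose N := (\sum_(b < n) \sum_(b' <- nbr b) b'.+1)%N.
have sub (b : 'I_n) : {subset nbr b <= iota 0 N}.
  move=> b' bb'; rewrite mem_iota /= add0n /N (bigD1 b) //=.
  by rewrite (leq_trans (mem_lt_sum bb'))// leq_addr.
rewrite (eq_bigr (fun b : 'I_n => \sum_(b' <- iota 0 N | b' \in nbr b) g b')); last first.
  by move=> b _; rewrite (big_seq_sub _ (uniq_nbr b) (iota_uniq 0 N)).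
rewrite (exchange_big_dep xpredT) //=.
apply: (@le_trans _ _ (\sum_(b' <- iota 0 N) 3 * g b')); last first.
  rewrite -mulr_sumr ler_wpM2l//; have := gB N; rewrite -(big_mkord predT g).
  by rewrite /index_iota subn0.
apply: ler_sum => b' _.
rewrite (eq_bigl (fun b : 'I_n => (b : nat) \in nbr b')); last by move=> b; rewrite nbrC.
rewrite -(big_mkord (fun b => b \in nbr b') (fun=> g b')) /index_iota subn0.
rewrite (big_seq_capC _ (iota_uniq 0 n) (uniq_nbr b')).
apply: (@le_trans _ _ (\sum_(b <- nbr b') g b')).
  by rewrite big_mkcond /=; apply: ler_sum => b _; case: ifP.
rewrite big_const_seq count_predT iter_addr_0 -[_ *+ size _]mulr_natl ler_wpM2r//.
by rewrite ler_nat size_nbr.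
Qed.

(** Two successive splittings by [sqnormD]: the errors e / 16 are each doubled three times, the main
    term twice. *)
Lemma two_step_bound (e q q1 q2 q3 q4 q5 : R) :
  q <= 2 * (q1 + q2) -> q2 <= 2 * (q3 + q4) ->
  q1 <= q5 -> q3 <= e / 16 -> q4 <= e / 16 -> 2 * q <= 4 * q5 + e.
Proof. lra. Qed.

Lemma sqnormD n (u v : 'cV[R[i]]_n) : sqnorm (u + v) <= 2 * (sqnorm u + sqnorm v).
Proof.
rewrite /sqnorm -big_split mulr_sumr; apply: ler_sum => k _ /=; rewrite mxE.
have h := ler_rnormD (u k 0) (v k 0).
have := sqr_ge0 (rnorm (u k 0) - rnorm (v k 0)).
have : rnorm (u k 0 + v k 0) ^+ 2 <= (rnorm (u k 0) + rnorm (v k 0)) ^+ 2.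
  by rewrite ler_sqr ?nnegrE ?addr_ge0 ?rnorm_ge0.
lra.
Qed.

Lemma sqnorm_sum_le n (s : seq nat) (c : nat -> 'cV[R[i]]_n) :
  sqnorm (\sum_(b <- s) c b) <= 2 ^+ size s * \sum_(b <- s) sqnorm (c b).
Proof.
elim: s => [|b s ih]; first by rewrite !big_nil sqnorm0 mulr0.
rewrite !big_cons /= exprS; apply: le_trans (sqnormD _ _) _.
have := sqnorm_ge0 (c b); have h : 1 <= 2 ^+ size s :> R by rewrite exprn_ege1// ler1n.
move=> c0; have := ler_wpM2r c0 h; lra.
Qed.

End finite_sums.

Section representation.
Context {R : realType} (p : R) (p_gt1 : 1 < p) (A : cstarAlgType R).
Local Notation L := (lp (ltW p_gt1)).
Variables (m : nat -> nat) (S : set A) (al : forall b b', A -> 'M[R[i]]_(m b, m b')).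
Hypothesis dS : dense S.
Hypothesis al_lin : forall b b' c x y, al b b' (c *: x + y) = c *: al b b' x + al b b' y.
Hypothesis al_le : forall b b' a c, sqnorm (al b b' a *m c) <= rnorm a ^+ 2 * sqnorm c.
Hypothesis al_far : forall x y, S x -> S y -> exists B, forall b'' b, (B <= b'')%N ->
  [/\ b \notin nbr b'' -> al b b'' x = 0,
    b \notin nbr b'' -> al b b'' (cmul x y) = 0 &
    al b b'' (cmul x y) = \sum_(b' <- nbr b'') al b b' x *m al b' b'' y].
Hypothesis al_big : forall x, S x -> x != 0 -> forall B, exists b, (B <= b)%N /\
  exists c, sqnorm c <= 1 /\ exists2 b', b' \in nbr b &
    rnorm x ^+ 2 <= 2 * sqnorm (al b' b x *m c).
Variables (K : R) (r : nat -> nat) (J : forall b, 'M[R[i]]_(r b, m b))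
  (Q : forall b, 'M[R[i]]_(m b, r b)).
Hypothesis K_gt0 : 0 < K.
Hypothesis r_gt0 : forall b, (0 < r b)%N.
Hypothesis QJ : forall b, Q b *m J b = 1%:M.
Hypothesis J_le : forall b c, colp p (J b *m c) <= K * sqnorm c `^ (p / 2).
Hypothesis Q_le : forall b x, sqnorm (Q b *m x) <= K * colp p x `^ (2 / p).
Implicit Types (a x y : A) (v w : L) (b : nat).

Let p_gt0 : 0 < p. Proof. exact: lt_trans p_gt1. Qed.

(** Summing over [nbr b] only is the truncation to three diagonals. The value stays in the Hilbert
    block, with [J] applied afterwards, so that [Q *m J] cancels in a composition. *)
Let core a b v := \sum_(b' <- nbr b) al b b' a *m (Q b' *m blk r v b').

Let core_lin a b (c : R[i]) v w : core a b (c *: v + w) = c *: core a b v + core a b w.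
Proof.
rewrite /core scaler_sumr -big_split; apply: eq_bigr => b' _ /=.
by rewrite blk_lin !mulmxDr -!scalemxAr.
Qed.

Let core_lin_l (c : R[i]) a a' b v : core (c *: a + a') b v = c *: core a b v + core a' b v.
Proof.
rewrite /core scaler_sumr -big_split; apply: eq_bigr => b' _ /=.
by rewrite al_lin mulmxDl -scalemxAl.
Qed.

(** 24 is 2^3, from splitting a sum of at most three vectors, times its number of terms 3. The
    leading 3 counts how often a block is a neighbour. *)
Let M := (3 * (K * (24 * K) `^ (p / 2))) `^ p^-1.

Let M_ge0 : 0 <= M. Proof. exact: powR_ge0. Qed.

Let core_le a b v : colp p (J b *m core a b v) <=
  K * (24 * K) `^ (p / 2) * rnorm a `^ p * \sum_(b' <- nbr b) colp p (blk r v b').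
Proof.
apply: le_trans (J_le _) _; rewrite -!mulrA ler_wpM2l ?(ltW K_gt0)//.
set s := \sum_(_ <- _) _.
have s0 : 0 <= s by apply: sumr_ge0 => b' _; exact: colp_ge0.
have h : sqnorm (core a b v) <= 24 * K * (rnorm a ^+ 2 * s `^ (2 / p)).
  apply: le_trans (sqnorm_sum_le _ _) _.
  have each b' : b' \in nbr b ->
      sqnorm (al b b' a *m (Q b' *m blk r v b')) <= rnorm a ^+ 2 * (K * s `^ (2 / p)).
    move=> bb'; apply: le_trans (al_le _ _ _) _; apply: ler_wpM2l; first exact: sqr_ge0.
    apply: le_trans (Q_le _) _; rewrite ler_wpM2l ?(ltW K_gt0)//.
    rewrite ge0_ler_powR ?nnegrE ?colp_ge0 ?divr_ge0 ?(ltW p_gt0)//.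
    rewrite /s (perm_big _ (perm_to_rem bb')) big_cons /= lerDl.
    by apply: sumr_ge0 => k _; exact: colp_ge0.
  apply: (@le_trans _ _ (8 * (3 * (rnorm a ^+ 2 * (K * s `^ (2 / p)))))); last lra.
  have X0 : 0 <= rnorm a ^+ 2 * (K * s `^ (2 / p)).
    by rewrite mulr_ge0 ?sqr_ge0 ?mulr_ge0 ?powR_ge0 ?(ltW K_gt0).
  apply: ler_pM.
  - exact: exprn_ge0.
  - by apply: sumr_ge0 => b' _; exact: sqnorm_ge0.
  - by rewrite (_ : 8 = 2 ^+ 3); [rewrite ler_eXn2l ?size_nbr ?ltr1n|ring].
  - apply: (@le_trans _ _ (\sum_(b' <- nbr b) rnorm a ^+ 2 * (K * s `^ (2 / p)))).
      by rewrite big_seq [leRHS]big_seq; apply: ler_sum.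
    rewrite big_const_seq count_predT iter_addr_0 -[_ *+ size _]mulr_natl ler_wpM2r//.
    by rewrite ler_nat size_nbr.
apply: (@le_trans _ _ ((24 * K * (rnorm a ^+ 2 * s `^ (2 / p))) `^ (p / 2))).
  rewrite ge0_ler_powR ?nnegrE ?sqnorm_ge0 ?divr_ge0 ?(ltW p_gt0)//.
  exact: le_trans (sqnorm_ge0 _) h.
have K24 : 0 <= 24 * K by rewrite mulr_ge0 ?(ltW K_gt0).
rewrite (powRM _ K24 (mulr_ge0 (sqr_ge0 _) (powR_ge0 _ _))).
rewrite (powRM _ (sqr_ge0 _) (powR_ge0 _ _)).
have pn : p != 0 by rewrite gt_eqF.
rewrite -(powR_mulrn _ (rnorm_ge0 a)) -!powRrM.
rewrite (_ : 2 * (p / 2) = p); last by field.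
rewrite (_ : 2 / p * (p / 2) = 1); last by field.
by rewrite powRr1.
Qed.

Let exists_operators : exists T : A -> bop L,
  (forall a v b, blk r (T a v) b = J b *m core a b v) /\
  (forall a, rnorm (T a) <= M * rnorm a).
Proof.
suff /choice[T hT] : forall a, exists T : bop L,
    (forall v b, blk r (T v) b = J b *m core a b v) /\ rnorm T <= M * rnorm a.
  by exists T; split=> a; have [] := hT a.
move=> a; apply: block_operator => //.
- by rewrite mulr_ge0 ?rnorm_ge0.
- by move=> b c v w; rewrite core_lin mulmxDr -scalemxAr.
- move=> v n; rewrite (powRM _ M_ge0 (rnorm_ge0 a)).
  have K0 : 0 <= K * (24 * K) `^ (p / 2) by rewrite mulr_ge0 ?powR_ge0 ?(ltW K_gt0).
  rewrite /M (powR_invK (mulr_ge0 (ler0n _ 3) K0) (lt0r_neq0 p_gt0)).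
  apply: (@le_trans _ _ (\sum_(b < n) K * (24 * K) `^ (p / 2) * rnorm a `^ p *
      \sum_(b' <- nbr b) colp p (blk r v b'))).
    by apply: ler_sum => b _; exact: core_le.
  rewrite -mulr_sumr.
  have h := sum_nbr_le n (fun b => colp_ge0 p (blk r v b)) (fun N => sum_colp_le r v N).
  have K1 : 0 <= K * (24 * K) `^ (p / 2) * rnorm a `^ p by rewrite mulr_ge0 ?powR_ge0.
  by apply: le_trans (ler_wpM2l K1 h) _; rewrite le_eqVlt; apply/orP; left; apply/eqP; ring.
Qed.

Section operators.
Variable T : A -> bop L.
Hypothesis blk_T : forall a v b, blk r (T a v) b = J b *m core a b v.
Hypothesis T_le : forall a, rnorm (T a) <= M * rnorm a.

Let T_lin (c : R[i]) a a' : T (c *: a + a') = c *: T a + T a'.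
Proof.
apply: bop_ext => v; apply: (blk_inj r_gt0) => b.
by rewrite bop_addE bop_scaleE blk_lin !blk_T core_lin_l mulmxDr -scalemxAr.
Qed.

Let TB a a' : T (a - a') = T a - T a'.
Proof. by rewrite addrC -scaleN1r T_lin scaleN1r addrC. Qed.

(** Far out the equality is exact: paths from [b''] over [b'] to [b] compose the two tridiagonal
    matrices, and [al_far] sums them to the block of [cmul x y]. *)
Let T_mul_tail x y : S x -> S y -> exists N, forall v,
  (forall k, (k < N)%N -> val v k = 0) -> T x (T y v) = T (cmul x y) v.
Proof.
move=> Sx Sy; have [B hB] := al_far Sx Sy; have [N1 hN1] := nbr_far B.
have [N hN] := blk_tail (ltW p_gt1) r (maxn B N1).
exists N => v /hN {}hN; apply: (blk_inj r_gt0) => b; rewrite !blk_T; congr (_ *m _).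
pose z b := Q b *m blk r v b.
have z0 b' : (b' < maxn B N1)%N -> z b' = 0 by move=> /hN h; rewrite /z h mulmx0.
(* All blocks reached from [b] in one or two steps, a common finite index set for interchanging the
   sums. *)
pose U := undup (nbr b ++ flatten [seq nbr b' | b' <- nbr b]).
have uU : uniq U by exact: undup_uniq.
have -> : core x b (T y v) = \sum_(b' <- nbr b) \sum_(b'' <- U | b'' \in nbr b')
    al b b' x *m (al b' b'' y *m z b'').
  apply: eq_big_seq => b' bb'; rewrite blk_T (mulmxA (Q b')) QJ mul1mx.
  rewrite -mulmx_sumr; congr (_ *m _); apply: big_seq_sub => //; first exact: uniq_nbr.
  move=> b'' b'b''; rewrite mem_undup mem_cat; apply/orP; right.
  by apply/flattenP; exists (nbr b') => //; apply: map_f.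
have -> : core (cmul x y) b v = \sum_(b'' <- U | b'' \in nbr b) al b b'' (cmul x y) *m z b''.
  apply: big_seq_sub => //; first exact: uniq_nbr.
  by move=> b' bb'; rewrite mem_undup mem_cat bb'.
rewrite (exchange_big_dep xpredT) //= [RHS]big_mkcond /=; apply: eq_bigr => b'' _.
have [b''N|Nb''] := ltnP b'' (maxn B N1).
  rewrite z0// mulmx0 if_same big1// => b' _; by rewrite !mulmx0.
have [Bb'' N1b''] : (B <= b'')%N /\ (N1 <= b'')%N.
  by move: Nb''; rewrite geq_max => /andP.
have [_ h1 h2] := hB b'' b Bb''.
have -> : (if b'' \in nbr b then al b b'' (cmul x y) *m z b'' else 0) =
    al b b'' (cmul x y) *m z b''.
  by case: ifPn => //; rewrite nbrC => /h1 ->; rewrite mul0mx.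
rewrite h2 mulmx_suml.
rewrite (eq_bigl (fun b' => b' \in nbr b'')); last by move=> b'; rewrite nbrC.
rewrite (big_seq_capC _ (uniq_nbr b) (uniq_nbr b'')) big_mkcond.
apply: eq_big_seq => b' b'b''; rewrite mulmxA; case: ifPn => // bb'.
(* Since [b''] is beyond [N1], its neighbour [b'] is beyond [B]: the paths missing from the
   left-hand sum have a zero factor. *)
have [h3 _ _] := hB b' b (hN1 _ _ N1b'' b'b'').
by rewrite h3 ?mul0mx// nbrC.
Qed.

Let dense_approx a (e : R) : 0 < e -> exists2 x, S x & rnorm (a - x) <= e.
Proof.
move=> e0; have ec : 0 < e%:C by rewrite ltcR.
have ne : ball a e%:C !=set0 by exists a; exact: ballxx.
have op : open (ball a e%:C) by exact: ball_open.
have [x [xa Sx]] := dS ne op.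
exists x => //; move: xa; rewrite -ball_normE /= rnormE ltcR; exact: ltW.
Qed.

(** Replacing both factors by elements of [S] costs little in norm, and for elements of [S] the
    operator vanishes on tails. *)
Let T_mul_compact a a' : T a * T a' - T (cmul a a') \in @compact_op R L.
Proof.
apply: compact_of_tails => e e0.
(* The perturbation errors below add up to [C * d]; [d <= 1] bounds the norm of [x] by that of [a]
   plus 1. *)
pose C := (M * M + M) * (rnorm a + rnorm a' + 1).
have C0 : 0 <= C.
  by rewrite mulr_ge0 ?addr_ge0 ?mulr_ge0 ?rnorm_ge0.
pose d := Num.min 1 (e / (C + 1)).
have C1 : 0 < C + 1 by rewrite ltr_wpDl.
have d0 : 0 < d by rewrite lt_min ltr01 divr_gt0.
have d1 : d <= 1 by rewrite ge_min lexx.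
have de : C * d <= e.
  apply: (@le_trans _ _ ((C + 1) * (e / (C + 1)))).
    by apply: ler_pM => //; rewrite ?(ltW d0) ?lerDl// ge_min lexx orbT.
  by rewrite mulrC divfK// gt_eqF.
have [x Sx ax] := dense_approx a d0; have [y Sy ay] := dense_approx a' d0.
have [N hN] := T_mul_tail Sx Sy; exists N => v vN.
have xa : rnorm x <= rnorm a + 1.
  rewrite -[x](subKr a) (le_trans (ler_rnormD _ _))// rnormN lerD//.
  exact: le_trans ax d1.
have -> : (T a * T a' - T (cmul a a') : bop L) v =
   (T (a - x) * T a' + T x * T (a' - y) - T (cmul (a - x) a' + cmul x (a' - y)) : bop L) v.
  have -> : cmul (a - x) a' + cmul x (a' - y) = cmul a a' - cmul x y.
    by rewrite cmulBl cmulBr addrA subrK.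
  rewrite !TB mulrBl mulrBr addrA subrK.
  rewrite -[LHS]/((T a * T a' : bop L) v - T (cmul a a') v).
  rewrite -[RHS]/((T a * T a' : bop L) v - T x (T y v) - (T (cmul a a') v - T (cmul x y) v)).
  by rewrite hN// opprB addrA subrK.
have rM (B C' : bop L) c1 c2 : rnorm B <= c1 -> rnorm C' <= c2 -> rnorm (B * C' : bop L) <= c1 * c2.
  by move=> h1 h2; apply: le_trans (rnorm_bopM _ _) _; apply: ler_pM => //; exact: rnorm_ge0.
have T1 : rnorm (T (a - x)) <= M * d by apply: le_trans (T_le _) _; exact: ler_wpM2l.
have T2 : rnorm (T (a' - y)) <= M * d by apply: le_trans (T_le _) _; exact: ler_wpM2l.
have T3 : rnorm (T x) <= M * (rnorm a + 1) by apply: le_trans (T_le _) _; exact: ler_wpM2l.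
have T4 : rnorm (cmul (a - x) a' + cmul x (a' - y)) <= d * rnorm a' + (rnorm a + 1) * d.
  apply: le_trans (ler_rnormD _ _) _; apply: lerD; apply: le_trans (rnorm_cmul _ _) _.
    by apply: ler_wpM2r => //; exact: rnorm_ge0.
  by apply: ler_pM => //; exact: rnorm_ge0.
have T5 := le_trans (T_le _) (ler_wpM2l M_ge0 T4).
have T6 := rM _ _ _ _ T1 (T_le a'); have T7 := rM _ _ _ _ T3 T2.
apply: le_trans (rnorm_bop_le _ _) _; apply: ler_wpM2r; first exact: rnorm_ge0.
apply: le_trans _ de; apply: le_trans (ler_rnormD _ _) _; rewrite rnormN.
apply: le_trans (lerD (ler_rnormD _ _) (lexx _)) _.
apply: le_trans (lerD (lerD T6 T7) T5) _.
by rewrite le_eqVlt; apply/orP; left; apply/eqP; rewrite /C; ring.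
Qed.

Let Q_blk_le b v : sqnorm (Q b *m blk r v b) <= K * rnorm v ^+ 2.
Proof.
apply: le_trans (Q_le _) _; rewrite ler_wpM2l ?(ltW K_gt0)//.
have -> : rnorm v ^+ 2 = (rnorm v `^ p) `^ (2 / p).
  by rewrite -powRrM mulrC divfK ?gt_eqF// powR_mulrn// rnorm_ge0.
rewrite ge0_ler_powR ?nnegrE ?colp_ge0 ?powR_ge0 ?divr_ge0 ?(ltW p_gt0)//.
exact: colp_le.
Qed.

Let single_block b (x : 'cV[R[i]]_(r b)) : exists v, [/\ blk r v b = x,
  forall b', b' != b -> blk r v b' = 0 & rnorm v `^ p <= colp p x].
Proof.
pose f b' : 'cV[R[i]]_(r b') :=
  if @eqP _ b b' is ReflectT e then ecast z 'cV[R[i]]_(r z) e x else 0.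
have fb : f b = x by rewrite /f; case: eqP => // e; rewrite (eq_axiomK e).
have f0 b' : b' != b -> f b' = 0.
  by move=> bb'; rewrite /f; case: eqP => // e; exfalso; move: bb'; rewrite -e eqxx.
have [|v [vf vx]] := glue (ltW p_gt1) r_gt0 (c := f) (B := colp p x).
- move=> n; have [bn|nb] := ltnP b n.
    rewrite (bigD1 (Ordinal bn)) //= fb big1 ?addr0// => b' bb'.
    by rewrite f0// /colp big1// => t _; rewrite mxE rnorm0 powR0// gt_eqF.
  rewrite big1 ?colp_ge0// => b' _; rewrite f0.
    by rewrite /colp big1// => t _; rewrite mxE rnorm0 powR0// gt_eqF.
  by rewrite neq_ltn (leq_trans (ltn_ord b') nb).
exists v; split; first by rewrite vf.
- by move=> b' bb'; rewrite vf f0.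
- exact: vx.
Qed.

(** Scales [J b *m c], of norm at most K^(1/p) when [sqnorm c <= 1], into the unit ball. *)
Let lam : R := (K `^ p^-1)^-1.

Let lam_gt0 : 0 < lam. Proof. by rewrite invr_gt0 powR_gt0. Qed.

(** The pair consists of a vector living in a single block and the index of a neighbouring block in
    which its image is large. The former block is taken far enough for the latter to be beyond
    [n]. *)
Let far_vectors x : S x -> x != 0 -> forall n, exists ub : L * nat,
  [/\ rnorm ub.1 <= 1, (n <= ub.2)%N &
    lam ^+ 2 * rnorm x ^+ 2 <= 2 * sqnorm (Q ub.2 *m blk r (T x ub.1) ub.2)].
Proof.
move=> Sx x0 n; have [B hB] := nbr_far n.
have [b [Bb [c [c1 [b' bb' xc]]]]] := al_big Sx x0 B.
have [v [vb v0 vx]] := single_block (J b *m c).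
exists (lam%:C *: v, b'); split=> /=.
- rewrite rnormZ rnormC ?(ltW lam_gt0)// mulrC -ler_pdivlMr// mul1r invrK.
  rewrite -(ler_powR2 (ltW p_gt1) (rnorm_ge0 _) (powR_ge0 _ _)).
  rewrite (powR_invK (ltW K_gt0) (lt0r_neq0 p_gt0)).
  apply: le_trans vx _; apply: le_trans (J_le _) _.
  rewrite -[leRHS]mulr1 ler_wpM2l ?(ltW K_gt0)//.
  have : sqnorm c `^ (p / 2) <= 1 `^ (p / 2).
    by rewrite ge0_ler_powR ?nnegrE ?sqnorm_ge0 ?divr_ge0 ?(ltW p_gt0).
  by rewrite powR1.
- exact: hB bb'.
- rewrite blk_T mulmxA QJ mul1mx.
  have -> : core x b' (lam%:C *: v) = lam%:C *: (al b' b x *m c).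
    rewrite /core (perm_big _ (perm_to_rem (_ : b \in nbr b'))); last by rewrite nbrC.
    rewrite big_cons /= blkZ vb -!scalemxAr mulmxA (mulmxA _ (J b)) -(mulmxA (al b' b x)) QJ mulmx1.
    rewrite big_seq big1 ?addr0// => b0.
    rewrite mem_rem_uniq ?uniq_nbr// inE => /andP[b0b _].
    by rewrite blkZ v0// scaler0 !mulmx0.
  rewrite sqnormZ [leRHS]mulrCA.
  by rewrite ler_wpM2l ?sqr_ge0.
Qed.

(** Increments of a bounded increasing sequence tend to 0; [d] is chosen so that K d^(2/p) = e. *)
Let blk_small v (e : R) : 0 < e -> exists N, forall b, (N <= b)%N ->
  sqnorm (Q b *m blk r v b) <= e.
Proof.
move=> e0; pose g n := \sum_(b < n) colp p (blk r v b).
have gmono n n' : (n <= n')%N -> g n <= g n'.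
  move=> /subnK <-; elim: (n' - n)%N => // k ih.
  apply: le_trans ih _; rewrite addSn /g big_ord_recr /= lerDl; exact: colp_ge0.
have [l [_ gl lg]] := nondecreasing_sup (fun n n' h => gmono n' n h)
  (fun n => sum_colp_le r v n).
pose d := (e / K) `^ (p / 2).
have d0 : 0 < d by rewrite powR_gt0// divr_gt0.
have [N hN] := lg d d0; exists N => b Nb.
apply: le_trans (Q_le _) _; rewrite mulrC -ler_pdivlMr//.
have -> : e / K = d `^ (2 / p).
  rewrite /d -powRrM (_ : p / 2 * (2 / p) = 1); last by field; rewrite gt_eqF.
  by rewrite powRr1// divr_ge0 ?ltW.
rewrite ge0_ler_powR ?nnegrE ?colp_ge0 ?divr_ge0 ?(ltW p_gt0) ?(ltW d0)//.
have gS : g b.+1 = g b + colp p (blk r v b) by rewrite /g big_ord_recr.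
by apply: le_trans hN; have := gl b.+1; rewrite gS; have := gmono _ _ Nb; lra.
Qed.

(** A compact [C] maps far vectors close to a cluster point [y] infinitely often, and [y] is
    negligible on far blocks, so there [T x] acts almost as [T x - C]. The constant 4 is the 2 of
    [far_vectors] times the 2 of [sqnormD]. *)
Let compact_far (x : A) (C : bop L) : S x -> C \in @compact_op R L ->
  lam ^+ 2 * rnorm x ^+ 2 <= 4 * K * rnorm (T x - C) ^+ 2.
Proof.
move=> Sx /asboolP[X CX [cX _]].
have [->|x0] := eqVneq x 0.
  by rewrite rnorm0 expr0n /= mulr0 -mulrA; do 2!apply: mulr_ge0 => //; [exact: ltW|exact: sqr_ge0].
have /choice[ub hub] := far_vectors Sx x0.
have [|y [_ cly]] := cX ((fun n => C (ub n).1) @ \oo) _.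
  by exists 0%N => // n _; apply: CX; exists (ub n).1 => //; case: (hub n).
apply/ler_addgt0Pr => e e0.
pose d := e / (16 * K); have d0 : 0 < d by rewrite divr_gt0// mulr_gt0.
have [N hN] := blk_small y (mulr_gt0 K_gt0 d0).
pose s := Num.sqrt d; have s0 : 0 < s by rewrite sqrtr_gt0.
have sc : 0 < s%:C by rewrite ltcR.
have [|z [[n /= Nn <-]]] := cly [set C (ub n).1 | n in [set n | (N <= n)%N]] (ball y s%:C) _ (nbhsx_ballx y _ sc).
  by exists N => // n /= Nn; exists n.
rewrite -ball_normE /= rnormE ltcR => /ltW yz.
have [u1 nb] := hub n; set u := (ub n).1 in u1 yz *; set b := (ub n).2 in nb *.
move=> h; apply: le_trans h _.
have e1 : blk r (T x u) b = blk r ((T x - C : bop L) u) b + blk r (C u) b.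
  by rewrite -[(T x - C : bop L) u]/(T x u - C u) blkB subrK.
have e2 : blk r (C u) b = blk r (C u - y) b + blk r y b by rewrite blkB subrK.
have h1 := sqnormD (Q b *m blk r ((T x - C : bop L) u) b) (Q b *m blk r (C u) b).
have h2 := sqnormD (Q b *m blk r (C u - y) b) (Q b *m blk r y b).
have h3 := Q_blk_le b ((T x - C : bop L) u).
have h4 := Q_blk_le b (C u - y).
have h5 := hN b (leq_trans Nn nb).
rewrite -mulmxDr -e1 in h1; rewrite -mulmxDr -e2 in h2.
have h6 : K * rnorm ((T x - C : bop L) u) ^+ 2 <= K * rnorm (T x - C) ^+ 2.
  rewrite ler_wpM2l ?(ltW K_gt0)// ler_sqr ?nnegrE ?rnorm_ge0//.
  apply: le_trans (rnorm_bop_le _ _) _; rewrite -[leRHS]mulr1.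
  by apply: ler_wpM2l => //; exact: rnorm_ge0.
have h7 : K * rnorm (C u - y) ^+ 2 <= K * d.
  rewrite ler_wpM2l ?(ltW K_gt0)// -(sqr_sqrtr (ltW d0)) -/s.
  have yz' : rnorm (C u - y) <= s by rewrite rdistC; exact: yz.
  by apply: lerXn2r yz'; rewrite nnegrE; [exact: rnorm_ge0|exact: ltW].
have h8 : K * d = e / 16 by rewrite /d; field; rewrite gt_eqF.
rewrite h8 in h5 h7; rewrite -(mulrA 4).
exact: two_step_bound h1 h2 (le_trans h3 h6) (le_trans h4 h7) h5.
Qed.

Let kap : R := lam / (2 * Num.sqrt K).

Let kap_gt0 : 0 < kap.
Proof. by rewrite divr_gt0// mulr_gt0// sqrtr_gt0. Qed.

Let essential_norm_ge a (C : bop L) : C \in @compact_op R L ->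
  kap * rnorm a <= rnorm (T a - C).
Proof.
move=> hC.
have onS x : S x -> kap * rnorm x <= rnorm (T x - C).
  move=> Sx; have := compact_far Sx hC.
  rewrite -exprMn (_ : 4 * K = (2 * Num.sqrt K) ^+ 2); last first.
    by rewrite exprMn sqr_sqrtr ?(ltW K_gt0)// -natrX.
  have sK : 0 < 2 * Num.sqrt K by rewrite mulr_gt0// sqrtr_gt0.
  rewrite -exprMn ler_sqr ?nnegrE ?mulr_ge0 ?rnorm_ge0 ?(ltW lam_gt0) ?sqrtr_ge0//.
  by rewrite -ler_pdivrMl// mulrA (mulrC _ lam).
apply/ler_addgt0Pr => e e0.
(* Passing from [a] to [x] costs [kap * d] on one side and [M * d] on the other, together e. *)
pose d := e / (M + kap); have Mk : 0 < M + kap by rewrite ltr_wpDl.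
have d0 : 0 < d by rewrite divr_gt0.
have [x Sx ax] := dense_approx a d0.
have h1 : rnorm a <= rnorm x + d.
  rewrite -[a in leLHS](subrK x) addrC.
  by apply: le_trans (ler_rnormD _ _) _; apply: lerD.
have h2 : rnorm (T x - C) <= rnorm (T a - C) + M * d.
  have -> : T x - C = (T a - C) + - T (a - x).
    by rewrite TB opprB [RHS]addrC addrA subrK.
  apply: le_trans (ler_rnormD _ _) _; rewrite rnormN; apply: lerD => //.
  by apply: le_trans (T_le _) _; exact: ler_wpM2l.
have h3 := ler_wpM2l (ltW kap_gt0) h1.
have h4 := onS _ Sx.
have h5 : (M + kap) * d = e by rewrite mulrC divfK// gt_eqF.
apply: le_trans h3 _; rewrite mulrDr; apply: le_trans (lerD h4 (lexx _)) _.
apply: le_trans (lerD h2 (lexx _)) _.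
by rewrite -addrA -mulrDl h5.
Qed.

Lemma calkin_embedding_of_operators : exists phi : {linear A -> calkin L},
  (forall a a', phi (cmul a a') = phi a * phi a') /\
  exists C : R, 1 <= C /\ forall a,
    C^-1 * rnorm a <= calkin_norm (phi a) /\ calkin_norm (phi a) <= C * rnorm a.
Proof.
pose f a : calkin L := calkin_pi (T a).
have f_lin : linear f.
  by move=> c a a'; rewrite /f T_lin calkin_piD calkin_piZ.
pose phi : {linear A -> calkin L} := HB.pack f (GRing.isLinear.Build _ _ _ _ f f_lin).
have phiE a : phi a = calkin_pi (T a) by [].
exists phi; split=> [a a'|].
  rewrite !phiE -calkin_piM; apply/esym/calkin_piP; exact: T_mul_compact.
pose C := 1 + M + kap^-1.
have kV : 0 < kap^-1 by rewrite invr_gt0.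
exists C; split; first by rewrite /C -addrA lerDl addr_ge0// ltW.
have C0 : 0 < C by rewrite ltr_wpDl// addr_ge0.
have c0 : (0 : bop L) \in @compact_op R L by exact: rpred0.
move=> a; rewrite phiE calkin_normE; split.
  apply: lb_le_inf => [|_ [D /= hD <-]]; first by exists (rnorm (T a - 0)), 0.
  apply: le_trans (essential_norm_ge a hD).
  apply: ler_wpM2r; first exact: rnorm_ge0.
  by rewrite -[kap]invrK lef_pV2 ?posrE// lerDr addr_ge0.
apply: (@le_trans _ _ (rnorm (T a - 0))).
  apply: inf_lbound; last by exists 0.
  by exists 0 => _ [D _ <-]; exact: rnorm_ge0.
rewrite subr0; apply: le_trans (T_le a) _; apply: ler_wpM2r; first exact: rnorm_ge0.
by rewrite /C addrAC lerDr addr_ge0// ltW.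
Qed.

End operators.

Lemma calkin_embedding : exists phi : {linear A -> calkin L},
  (forall a a', phi (cmul a a') = phi a * phi a') /\
  exists C : R, 1 <= C /\ forall a,
    C^-1 * rnorm a <= calkin_norm (phi a) /\ calkin_norm (phi a) <= C * rnorm a.
Proof. by have [T [hT TM]] := exists_operators; exact: (calkin_embedding_of_operators hT). Qed.

End representation.

Theorem corollary1p2 (R : realType) (p : R) (p_gt1 : 1 < p)
    (A : cstarAlgType R) (A_separable : separable A) :
  exists phi : {linear A -> calkin (lp (ltW p_gt1))},
    (forall a b : A, phi (cmul a b) = phi a * phi b) /\
    exists C : R, 1 <= C /\
      forall a : A,
        C^-1 * rnorm a <= calkin_norm (phi a) /\
        calkin_norm (phi a) <= C * rnorm a.
Proof.
have [m [S [al [dS [al_lin al_le al_far al_big]]]]] := block_system A_separable.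
have [K [K0 hK]] := complemented_hilbert_block p_gt1.
(* [K] is the same for all dimensions, so the matrices may be chosen block by block. *)
pose r b := sval (cid (hK (m b))).
pose J b := sval (cid (svalP (cid (hK (m b))))).
pose Q b := sval (cid (svalP (cid (svalP (cid (hK (m b))))))).
have h b := svalP (cid (svalP (cid (svalP (cid (hK (m b))))))).
have r_gt0 b : (0 < r b)%N by case: (h b).
have QJ b : Q b *m J b = 1%:M by case: (h b).
have J_le b c : colp p (J b *m c) <= K * sqnorm c `^ (p / 2) by case: (h b) => _ _ hJ _; exact: hJ.
have Q_le b x : sqnorm (Q b *m x) <= K * colp p x `^ (2 / p) by case: (h b) => _ _ _ hQ; exact: hQ.
exact: (calkin_embedding p_gt1 dS al_lin al_le al_far al_big K0 r_gt0 QJ J_le Q_le).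
Qed.
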